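(* Let $K$ be a polygon satisfying the mesh assumptions, with triangulation $\mathcal T_K$, let $k\ge1$, let $V_k^{\mathrm{nc}}(K)$ be the 2D nonconforming virtual element space, and let $\widetilde I_k^{\mathrm{nc},K}:V_k^{\mathrm{nc}}(K)\to\widetilde V_{k+1}(\mathcal T_K)$ be the interpolation operator, all as defined in the context. Then for any $v_h\in V_k^{\mathrm{nc}}(K)$, $$(\nabla\widetilde I_k^{\mathrm{nc},K}v_h,\nabla w_h)_K=(\nabla v_h,\nabla w_h)_K\qquad\forall w_h\in V_k^{\mathrm{nc}}(K).$$
   Context: Notation: $(\cdot,\cdot)_S$ is the $L^2(S)$ inner product. $\mathbb P_m(S)$ is the space of polynomials of degree $\le m$ on $S$ ($\{0\}$ if $m<0$); $\overline{\mathbb P}_m(S)$ is the subspace of homogeneous polynomials of degree $m$ in $\bm x-\bm x_S$ ($\{0\}$ if $m<0$), with $\bm x_S$ the barycenter of $S$. $\mathbb M_m(S)=\{((\bm x-\bm x_S)/h_S)^{\bm\beta}:|\bm\beta|\le m\}$ is the scaled monomial basis of $\mathbb P_m(S)$ ($h_S$ the diameter; empty if $m<0$). Mesh assumptions: $K\subset\mathbb R^2$ is a polygon of diameter $h_K$, star-shaped with respect to a disc of radius $\ge\rho h_K$, all of whose edges have length $\ge\rho h_K$ ($\rho>0$ fixed). $\mathcal T_K$ is a conforming shape-regular triangulation of $K$ whose triangles have diameters comparable to $h_K$ and such that the edges of $K$ are not subdivided. $\mathcal V(K),\mathcal E(K)$ are the vertices and edges of $K$; $\mathcal V^{\mathrm{int}}(\mathcal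 T_K)$, $\mathcal E^{\mathrm{int}}(\mathcal T_K)$ are the vertices and edges of $\mathcal T_K$ in the interior of $K$; $\mathcal E^\partial(\mathcal T_K)=\mathcal E(K)$ are the boundary edges. Projections: $Q_m^K$ is the $L^2(K)$ projection onto $\mathbb P_m(K)$. For $v\in H^1(K)$, $\Pi_m^Kv\in\mathbb P_m(K)$ is defined by $(\nabla\Pi_m^Kv,\nabla q)_K=(\nabla v,\nabla q)_K$ for all $q\in\mathbb P_m(K)$ and $\int_{\partial K}\Pi_m^Kv\,\mathrm ds=\int_{\partial K}v\,\mathrm ds$. Virtual element spaces: for $r\ge1$, with $\mathbb B_r(\partial K)=\{v\in C^0(\partial K):v|_e\in\mathbb P_r(e)\ \forall e\in\mathcal E(K)\}$, $V_r^{\mathrm c}(K)=\{v\in H^1(K):\Delta v\in\mathbb P_r(K),\ v|_{\partial K}\in\mathbb B_r(\partial K),\ (v,q)_K=(\Pi_r^Kv,q)_K\ \forall q\in\overline{\mathbb P}_r(K)\oplus\overline{\mathbb P}_{r-1}(K)\}$. The nonconforming space is $$V_k^{\mathrm{nc}}(K)=\{v\in V_{k+1}^{\mathrm c}(K):(v,q)_K=(\Pi_k^Kv,q)_K\ \forall q\in\overline{\mathbb P}_{k-1}(K),\ v(\delta)=\Pi_k^Kv(\delta)\ \forall\delta\in\mathcal V(K)\}.$$ Macro finite element space: for $r\ge1$ and a triangle $T$ with cubic bubble $b_T$ (product of the three barycentric coordinates), $\widetilde V_r(T)=\mathbb P_r(T)\oplus b_T\overline{\mathbb P}_{r-2}(T)\oplus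 b_T\overline{\mathbb P}_{r-1}(T)\oplus b_T\overline{\mathbb P}_r(T)$, with unisolvent degrees of freedom: values at the vertices of $T$, moments $\frac1{|e|}(v,q)_e$, $q\in\mathbb M_{r-2}(e)$, on the edges of $T$, and moments $\frac1{|T|}(v,q)_T$, $q\in\mathbb M_r(T)$. $\widetilde V_r(\mathcal T_K)=\{v\in C^0(K):v|_T\in\widetilde V_r(T)\ \forall T\in\mathcal T_K\}$. Interpolation: for $v_h\in V_k^{\mathrm{nc}}(K)$, $\widetilde I_k^{\mathrm{nc},K}v_h\in\widetilde V_{k+1}(\mathcal T_K)$ is determined by - $\widetilde I_k^{\mathrm{nc},K}v_h(\delta)=v_h(\delta)$, $\delta\in\mathcal V(K)$; - $\widetilde I_k^{\mathrm{nc},K}v_h(\delta)=\Pi_k^Kv_h(\delta)$, $\delta\in\mathcal V^{\mathrm{int}}(\mathcal T_K)$; - $(\widetilde I_k^{\mathrm{nc},K}v_h-v_h,q)_e=0$, $q\in\mathbb M_{k-1}(e)$, $e\in\mathcal E^\partial(\mathcal T_K)$; - $(\widetilde I_k^{\mathrm{nc},K}v_h-\Pi_k^Kv_h,q)_e=0$, $q\in\mathbb M_{k-1}(e)$, $e\in\mathcal E^{\mathrm{int}}(\mathcal T_K)$; - $(\widetilde I_k^{\mathrm{nc},K}v_h-Q_{k+1}^Kv_h,q)_T=0$, $q\in\mathbb M_{k+1}(T)$, $T\in\mathcal T_K$. *)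

(* Defs.v *)
From HB Require Import structures.
From mathcomp Require Import all_boot all_order all_algebra.
From mathcomp Require Import all_classical all_reals all_analysis.
Set Implicit Arguments.
Unset Strict Implicit.
Unset Printing Implicit Defensive.
Import Order.TTheory GRing.Theory Num.Theory.
Import numFieldNormedType.Exports.
Local Open Scope classical_set_scope.
Local Open Scope ring_scope.

(** * Plane geometry *)

Section Plane.
Variable R : realType.
Implicit Types (a b x y : R * R) (S : set (R * R)).

Definition dotp x y : R := x.1 * y.1 + x.2 * y.2.
Definition cross x y : R := x.1 * y.2 - x.2 * y.1.

(* Euclidean: the library norm on [R * R] is the max norm. *)
Definition dist x y : R := Num.sqrt (dotp (x - y) (x - y)).

Definition diam S : R := sup [set dist x y | x in S & y in S].

Definition disc (c : R * R) (r : R) : set (R * R) := [set x | dist c x <= r].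

Definition lin a b (t : R) : R * R :=
  (a.1 + t * (b.1 - a.1), a.2 + t * (b.2 - a.2)).

Definition seg a b : set (R * R) := lin a b @` `[0, 1].

(* The vertices of a polygon (in particular of a triangle) are a family indexed
   by ['I_n]; its [i]-th edge joins [P i] to [P (ordS i)], [ordS] being the
   cyclic successor. *)
Definition boundary n (P : 'I_n -> R * R) : set (R * R) :=
  \bigcup_i seg (P i) (P (ordS i)).

(* [K] is the closed region bounded by the simple closed polygonal curve with
   vertices [P]. Flat angles are allowed. *)
Definition is_polygon n (P : 'I_n -> R * R) (K : set (R * R)) : Prop :=
  [/\ (3 <= n)%N,
      injective P,
      (forall i j x, i != j ->
         seg (P i) (P (ordS i)) x -> seg (P j) (P (ordS j)) x ->
         (j = ordS i /\ x = P j) \/ (i = ordS j /\ x = P i)),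
      compact K &
      closure K `\` interior K = boundary P].

Definition star_shaped K c r : Prop :=
  disc c r `<=` K /\ forall x y, K x -> disc c r y -> seg x y `<=` K.

Definition mesh_polygon (rho : R) n (P : 'I_n -> R * R) K : Prop :=
  [/\ is_polygon P K,
      (exists c r, rho * diam K <= r /\ star_shaped K c r) &
      forall i, rho * diam K <= dist (P i) (P (ordS i))].

(** * Triangulations *)

(* Convex hull of the vertices [T j], [j \in J]. *)
Definition hull (T : 'I_3 -> R * R) (J : {pred 'I_3}) : set (R * R) :=
  [set x | exists c : 'I_3 -> R,
    [/\ forall j, 0 <= c j, forall j, j \notin J -> c j = 0,
        \sum_j c j = 1,
        x.1 = \sum_j c j * (T j).1 & x.2 = \sum_j c j * (T j).2]].

Definition triangle (T : 'I_3 -> R * R) : set (R * R) := hull T predT.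

Definition common (T T' : 'I_3 -> R * R) : {pred 'I_3} :=
  [pred i | [exists j, T i == T' j]].

(* Two distinct triangles meet in the (possibly empty) convex hull of their
   common vertices, of which there are at most two. The last condition says
   that every edge of [K] is an edge of a triangle. *)
Definition triangulation (sigma : R) n (P : 'I_n -> R * R) K
    N (T : 'I_N -> 'I_3 -> R * R) : Prop :=
  [/\ K = \bigcup_i triangle (T i),
      (forall i j, i != j -> (exists l, l \notin common (T i) (T j)) /\
         triangle (T i) `&` triangle (T j) = hull (T i) (common (T i) (T j))),
      (forall i, exists c r,
         sigma * diam (triangle (T i)) <= r /\ disc c r `<=` triangle (T i)),
      (forall i, sigma * diam K <= diam (triangle (T i))) &
      forall m, exists i j,
        (T i j = P m /\ T i (ordS j) = P (ordS m)) \/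
        (T i j = P (ordS m) /\ T i (ordS j) = P m)].

(** * Integrals, differentiation and Sobolev functions *)

Definition leb2 :
    {measure set (measurableTypeR R * measurableTypeR R)%type -> \bar R} :=
  (@lebesgue_measure R \x @lebesgue_measure R)%E.

Implicit Types (f g u v q : R * R -> R).

Definition dotL2 S f g : R := \int[leb2]_(x in S) (f x * g x).

Definition dotL2v S (F G : R * R -> R * R) : R :=
  \int[leb2]_(x in S) dotp (F x) (G x).

Definition L2 S f : Prop := f \_ S \in Lfun leb2 2%:E.

(* Integrals with respect to arc length. *)
Definition int_seg a b f : R :=
  dist a b * \int[@lebesgue_measure R]_(t in `[0, 1]) f (lin a b t).

Definition int_bd n (P : 'I_n -> R * R) f : R :=
  \sum_i int_seg (P i) (P (ordS i)) f.

Definition L2_bd n (P : 'I_n -> R * R) f : Prop :=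
  forall i, (fun t => f (lin (P i) (P (ordS i)) t)) \_ `[0, 1]
    \in Lfun (@lebesgue_measure R) 2%:E.

Definition d1 f x : R := 'D_((1, 0) : R * R) f x.
Definition d2 f x : R := 'D_((0, 1) : R * R) f x.
Definition cgrad f x : R * R := (d1 f x, d2 f x).

Fixpoint Cm (m : nat) f : Prop :=
  continuous f /\
  if m is m'.+1 then
    [/\ forall x, derivable f x ((1, 0) : R * R),
        forall x, derivable f x ((0, 1) : R * R),
        Cm m' (d1 f) & Cm m' (d2 f)]
  else True.

Definition smooth f : Prop := forall m, Cm m f.

(* Smooth functions with compact support in the interior of [K], [K] being
   compact. *)
Definition test K f : Prop :=
  smooth f /\ closure [set x | f x != 0] `<=` interior K.

Definition is_wgrad K v (G : R * R -> R * R) : Prop :=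
  [/\ L2 K (fun x => (G x).1), L2 K (fun x => (G x).2) &
      forall f, test K f ->
        dotL2 K v (d1 f) = - dotL2 K (fun x => (G x).1) f /\
        dotL2 K v (d2 f) = - dotL2 K (fun x => (G x).2) f].

(* The weak gradient on [K], unique up to a null set when it exists. *)
Definition wgrad K v : R * R -> R * R :=
  xget (fun=> (0, 0)) [set G | is_wgrad K v G].

(* The trace operator extends the restriction of smooth functions to the
   boundary by continuity, from the norm of H^1(K) to that of L^2(boundary). *)
Definition is_trace n (P : 'I_n -> R * R) K v f : Prop :=
  L2_bd P f /\
  exists u : nat -> R * R -> R,
    [/\ forall m, smooth (u m),
        dotL2 K (u m \- v) (u m \- v) @[m --> \oo] --> 0,
        dotL2v K (fun x => cgrad (u m) x - wgrad K v x)
                 (fun x => cgrad (u m) x - wgrad K v x) @[m --> \oo] --> 0 &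
        int_bd P (fun x => (u m x - f x) ^+ 2) @[m --> \oo] --> 0].

(* The boundary is a null set: an element of H^1(K) is represented by a function
   whose values on the boundary are its trace, so that the trace of [v] is the
   restriction of the function [v] itself. *)
Definition H1 n (P : 'I_n -> R * R) K v : Prop :=
  [/\ L2 K v, exists G, is_wgrad K v G & is_trace P K v v].

Definition weak_laplacian K v f : Prop :=
  forall g, test K g -> dotL2v K (wgrad K v) (cgrad g) = - dotL2 K f g.

(** * Polynomials *)

(* Degrees are in [int]: in negative degree the spaces are {0} and the sets of
   monomials are empty. *)

Definition Pol (m : int) f : Prop :=
  if m is Posz n then
    exists c : nat -> nat -> R, f = fun x =>
      \sum_(i < n.+1) \sum_(j < n.+1 | (i + j <= n)%N)
         c i j * x.1 ^+ i * x.2 ^+ j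
  else f = cst 0.

(* [fine]: only used for bounded [S]. *)
Definition area S : R := fine (leb2 S).

Definition bary S : R * R :=
  ((\int[leb2]_(x in S) x.1) / area S, (\int[leb2]_(x in S) x.2) / area S).

Definition HPol S (m : int) f : Prop :=
  if m is Posz n then
    exists c : nat -> R, f = fun x =>
      \sum_(i < n.+1)
         c i * (x.1 - (bary S).1) ^+ i * (x.2 - (bary S).2) ^+ (n - i)
  else f = cst 0.

Definition Mon S (m : int) f : Prop :=
  exists i j : nat, (i + j)%N%:Z <= m /\
    f = fun x => ((x.1 - (bary S).1) / diam S) ^+ i *
                 ((x.2 - (bary S).2) / diam S) ^+ j.

(* On an edge: powers of the signed tangential distance to the midpoint, divided
   by the length of the edge. *)
Definition Mon_edge a b (m : int) f : Prop :=
  exists j : nat, j%:Z <= m /\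
    f = fun x => (dotp (x - lin a b (1 / 2)) (b - a) / dist a b ^+ 2) ^+ j.

(* Restriction to an edge, as a polynomial in the parameter of [lin a b]. *)
Definition Pol_edge a b (m : nat) f : Prop :=
  exists p : {poly R}, (size p <= m.+1)%N /\
    forall t, 0 <= t <= 1 -> f (lin a b t) = p.[t].

(** * Projections *)

Definition Qproj K (m : nat) v : R * R -> R :=
  xget (cst 0)
    [set p | Pol m p /\ forall q, Pol m q -> dotL2 K p q = dotL2 K v q].

Definition Piproj n (P : 'I_n -> R * R) K (m : nat) v : R * R -> R :=
  xget (cst 0) [set p | [/\ Pol m p,
    forall q, Pol m q ->
      dotL2v K (wgrad K p) (wgrad K q) = dotL2v K (wgrad K v) (wgrad K q) &
    int_bd P p = int_bd P v]].

(** * Virtual element spaces *)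

Definition Bspace n (P : 'I_n -> R * R) (r : nat) v : Prop :=
  {within boundary P, continuous v} /\
  forall i, Pol_edge (P i) (P (ordS i)) r v.

Definition Vc n (P : 'I_n -> R * R) K (r : nat) v : Prop :=
  [/\ H1 P K v,
      exists2 p, Pol r p & weak_laplacian K v p,
      Bspace P r v &
      forall q q', HPol K r q -> HPol K (r%:Z - 1) q' ->
        dotL2 K v (q \+ q') = dotL2 K (Piproj P K r v) (q \+ q')].

Definition Vnc n (P : 'I_n -> R * R) K (k : nat) v : Prop :=
  [/\ Vc P K k.+1 v,
      forall q, HPol K (k%:Z - 1) q ->
        dotL2 K v q = dotL2 K (Piproj P K k v) q &
      forall i, v (P i) = Piproj P K k v (P i)].

(** * Macro finite element space and interpolation *)

Definition bary_coord (T : 'I_3 -> R * R) (j : 'I_3) x : R :=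
  cross (T (ordS j) - x) (T (ordS (ordS j)) - x) /
  cross (T (ordS j) - T j) (T (ordS (ordS j)) - T j).

Definition bubble (T : 'I_3 -> R * R) x : R := \prod_j bary_coord T j x.

Definition VT (T : 'I_3 -> R * R) (r : nat) f : Prop :=
  exists p q0 q1 q2,
    [/\ Pol r p, HPol (triangle T) (r%:Z - 2) q0,
        HPol (triangle T) (r%:Z - 1) q1, HPol (triangle T) r q2 &
        f = fun x => p x + bubble T x * q0 x + bubble T x * q1 x
                         + bubble T x * q2 x].

Definition Vmacro K N (T : 'I_N -> 'I_3 -> R * R) (r : nat) f : Prop :=
  {within K, continuous f} /\
  forall i, exists2 g, VT (T i) r g & forall x, triangle (T i) x -> f x = g x.

(* [f] is the interpolant of [v]. The interior edges are those whose relative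
   interior lies in the interior of [K]. *)
Definition is_interp n (P : 'I_n -> R * R) K N (T : 'I_N -> 'I_3 -> R * R)
    (k : nat) v f : Prop :=
  Vmacro K T k.+1 f /\
  [/\ forall i, f (P i) = v (P i),
      forall i j, interior K (T i j) -> f (T i j) = Piproj P K k v (T i j),
      forall i q, Mon_edge (P i) (P (ordS i)) (k%:Z - 1) q ->
        int_seg (P i) (P (ordS i)) (fun x => (f x - v x) * q x) = 0,
      forall i j q,
        (forall t, 0 < t < 1 -> interior K (lin (T i j) (T i (ordS j)) t)) ->
        Mon_edge (T i j) (T i (ordS j)) (k%:Z - 1) q ->
        int_seg (T i j) (T i (ordS j))
          (fun x => (f x - Piproj P K k v x) * q x) = 0 &
      forall i q, Mon (triangle (T i)) k.+1 q ->
        dotL2 (triangle (T i)) (f \- Qproj K k.+1 v) q = 0].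

End Plane.

(* Main.v *)
(** Put z = Iv - v. On each edge z is a polynomial of degree at most k+1 that
    vanishes at the end points and is orthogonal to degree k-1, so z = 0 on the
    boundary; and z is orthogonal to all polynomials of degree at most k+1 on K,
    hence to the weak Laplacian p of w. It remains to justify the Green formula
    (grad z, grad w) = - (z, p). Since z vanishes on the boundary, its gradient
    (taken triangle by triangle) satisfies (z, d_i phi) = - (d_i z, phi) for
    every smooth phi, compactly supported or not: this follows from Fubini and
    the fundamental theorem of calculus on lines parallel to the axes, after
    replacing v by smooth approximants. The Laplacian of w, however, is only
    known against test functions. As K is star-shaped with respect to a disc of
    centre c, for 0 < lam < 1 and u in K a small bump around lam u + (1 - lam) c
    is a test function; integrating the equation for w tested by that bump
    against z(u) du, and exchanging derivatives in x and u, gives a smoothed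
    Green formula, whose limit as lam tends to 1 is the wanted one. *)
Require Import Defs.
From HB Require Import structures.
From mathcomp Require Import all_boot all_order all_algebra.
From mathcomp Require Import all_classical all_reals all_analysis.
From mathcomp Require Import measurable_realfun ring lra.
Set Implicit Arguments.
Unset Strict Implicit.
Unset Printing Implicit Defensive.
Import Order.TTheory GRing.Theory Num.Theory.
Import numFieldNormedType.Exports.
Local Open Scope classical_set_scope.
Local Open Scope ring_scope.
(** * Measure and integration in the plane *)

Section PlaneMeasure.
Variable R : realType.

(** The usual route would place z in the closure of the test functions in H^1(K) and pass to the
    limit in the equation of w. The kernel avoids that density statement by treating its two
    variables differently: in x the bump lies in the interior of K, so the equation of w applies to
    it, while in u it may reach or leave the boundary, which is why the formula for z has to hold
    for all smooth functions. The mass of the kernel vanishes as lam tends to 1, so every error is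
    measured relative to that mass, and a Schur estimate gives bounds that are uniform in lam. No
    outer normal is needed: z vanishes on the boundary and the approximants of v tend to v there, so
    a bound by the boundary integral of an absolute value is enough. Since [wgrad] and [Qproj] are
    choices, existence is established before their properties are used, and two weak gradients are
    compared only through integrals. *)

Lemma leb2_sigma_finite : sigma_finite setT (@leb2 R).
Proof.
have /sigma_finiteP [F [TF ndF Foo]] :=
  @sigma_finiteT _ _ _ (@lebesgue_measure R).
exists (fun n => F n `*` F n).
  rewrite predeqE => -[x y]; split => // _.
  have [m _ Fx] : (\bigcup_i F i) x by rewrite -TF.
  have [l _ Fy] : (\bigcup_i F i) y by rewrite -TF.
  exists (maxn m l) => //; split => /=.
    by move: x Fx; exact/subsetPset/ndF/leq_maxl.
  by move: y Fy; exact/subsetPset/ndF/leq_maxr.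
move=> k; have [mF Fk] := Foo k; split; first exact: measurableX.
rewrite [ltLHS](product_measure1E (@lebesgue_measure R) (@lebesgue_measure R)) //.
by rewrite lte_mul_pinfty// ge0_fin_numE.
Qed.

(* Copy of [leb2] carrying the sigma-finite structure that Fubini requires: the
   type of [leb2] only makes it a measure. *)
Definition leb2s : set (measurableTypeR R * measurableTypeR R)%type -> \bar R := @leb2 R.
HB.instance Definition _ := Measure.on leb2s.
HB.instance Definition _ := @Measure_isSigmaFinite.Build _ _ _ leb2s leb2_sigma_finite.

End PlaneMeasure.

Section PlaneMeasurability.
Variable R : realType.
Implicit Types (U K : set (R * R)) (f g : R * R -> R).

Definition qball (q : rat * rat * rat) : set (R * R) :=
  ball (ratr q.1.1 : R, ratr q.1.2 : R) (ratr q.2).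

(** Balls of the product are open squares for the max norm. The doubled radius keeps room for the
    closed square of radius [ratr q.2], which [cutoff_cvg] places inside [U]. *)
Lemma qball_inside U x : open U -> U x ->
  exists q, [/\ 0 < q.2, qball q x & qball (q.1, q.2 *+ 2) `<=` U].
Proof.
move=> oU Ux; have /nbhs_ballP[e /= e0 eU] : nbhs x U by exact: open_nbhs_nbhs.
(* The centre will be within [r] of [x], and a point of the doubled square within [2r] of the
   centre; [r < e / 4] keeps the total [3r] below [e]. *)
have [r /itvP re] := rat_in_itvoo (divr_gt0 e0 (ltr0Sn R 3)).
have r0 : 0 < (ratr r : R) by rewrite re.
have re4 : ratr r < e / 4 by rewrite re.
have [q1 /itvP h1] : exists q, ratr q \in `]x.1 - ratr r, x.1 + ratr r[.
  by apply: rat_in_itvoo; lra.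
have [q2 /itvP h2] : exists q, ratr q \in `]x.2 - ratr r, x.2 + ratr r[.
  by apply: rat_in_itvoo; lra.
have a1 : x.1 - ratr r < ratr q1 by rewrite h1.
have a2 : ratr q1 < x.1 + ratr r by rewrite h1.
have a3 : x.2 - ratr r < ratr q2 by rewrite h2.
have a4 : ratr q2 < x.2 + ratr r by rewrite h2.
exists ((q1, q2), r); split => /=.
- by rewrite -(ltr0q R).
- by split; rewrite /ball /= ltr_norml; apply/andP; split; lra.
- move=> y [/=]; rewrite /ball /= rmorphMn /= !ltr_norml => /andP[b1 b2] /andP[b3 b4].
  by apply: eU; split; rewrite /ball /= ltr_norml; apply/andP; split; lra.
Qed.

Lemma measurable_qball q : measurable (qball q).
Proof.
rewrite (_ : qball q = ball (ratr q.1.1 : R) (ratr q.2) `*`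
  ball (ratr q.1.2 : R) (ratr q.2)) //.
by apply: measurableX; exact: measurable_ball.
Qed.

(** The sigma-algebra is the product one, so second countability is needed: [U] is the union of the
    countably many rational squares that it contains. *)
Lemma open_measurable2 U : open U -> measurable U.
Proof.
move=> oU; rewrite (_ : U = \bigcup_(q in [set: rat * rat * rat])
    (if `[< qball q `<=` U >] then qball q else set0)).
  apply: countable_bigcupT_measurable; first exact: countableP.
  by move=> q; case: ifP => _; [exact: measurable_qball|exact: measurable0].
apply/seteqP; split => [x Ux|x [q _]]; last by case: asboolP => // h /h.
have [q [q0 qx qU]] := qball_inside oU Ux; exists q => //.
case: asboolP => // -[]; apply: subset_trans qU => y.
have r0 : 0 <= (ratr q.2 : R) by rewrite ler0q ltW.
by apply: le_ball; rewrite rmorphMn /=; lra.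
Qed.

Lemma closed_measurable2 K : closed K -> measurable K.
Proof.
move=> cK; rewrite -(setCK K); apply: measurableC; apply: open_measurable2.
exact: closed_openC.
Qed.

Lemma compact_closed2 K : compact K -> closed K.
Proof. by apply: compact_closed; exact: norm_hausdorff. Qed.

Lemma compact_measurable2 K : compact K -> measurable K.
Proof. by move=> cK; apply: closed_measurable2; exact: compact_closed2. Qed.

Lemma within_continuous_measurable2 K f :
  measurable K -> {within K, continuous f} -> measurable_fun K f.
Proof.
move=> mK /continuousP cf.
apply: (measurability _ (RGenOpens.measurableE R)).
move=> _ [_ [a [b ->] <-]].
have oab : open (`]a, b[%classic : set R) by exact: interval_open.
have /open_subspaceP[V oV VK] := cf _ oab.
rewrite setIC -[X in measurable X]VK.
by apply: measurableI => //; exact: open_measurable2.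
Qed.

Lemma continuous_measurable2 K f :
  measurable K -> continuous f -> measurable_fun K f.
Proof.
by move=> mK cf; apply: within_continuous_measurable2 => //; exact: continuous_subspaceT.
Qed.

Lemma compact_bounded2 K : compact K ->
  exists2 M : R, 0 < M & forall x, K x -> `|x.1| <= M /\ `|x.2| <= M.
Proof.
move=> /compact_bounded[M0 [_ hM]].
exists (Num.max 1 (M0 + 1)); first by rewrite lt_max ltr01.
move=> x Kx; have : `|x| <= Num.max 1 (M0 + 1).
  by apply: hM => //; rewrite lt_max ltrDl ltr01 orbT.
by rewrite /Num.norm /= ge_max => /andP[].
Qed.

Lemma leb2_rect (a b c d : R) : a <= b -> c <= d ->
  leb2 R (`[a, b] `*` `[c, d]) = ((b - a) * (d - c))%:E.
Proof.
move=> ab cd.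
have L u v : u <= v -> lebesgue_measure `[u, v] = (v - u)%:E :> \bar R.
  move=> uv; rewrite lebesgue_measure_itv /= lte_fin lt_neqAle uv andbT.
  by have [->|_] := eqVneq u v; rewrite /= ?subrr // EFinB.
transitivity (lebesgue_measure `[a, b] * lebesgue_measure `[c, d] : \bar R)%E.
  exact: (product_measure1E (@lebesgue_measure R) (@lebesgue_measure R)).
by rewrite !L // EFinM.
Qed.

Lemma leb2_compact_lty K : compact K -> (leb2 R K < +oo)%E.
Proof.
move=> cK; have [M M0 hM] := compact_bounded2 cK.
apply: (@le_lt_trans _ _ (leb2 R (`[- M, M] `*` `[- M, M]))).
  apply: le_measure; rewrite ?inE; first exact: compact_measurable2.
    by apply: measurableX; exact: measurable_itv.
  by move=> x /hM[]; rewrite !ler_norml => a b; split; rewrite /= in_itv.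
by rewrite leb2_rect ?ltry//; lra.
Qed.

End PlaneMeasurability.

(** * Square-integrable functions and Young's inequality *)

Section SquareIntegrable.
Context d (T : measurableType d) (R : realType) (mu : {measure set T -> \bar R}).
Implicit Types (D : set T) (f g : T -> R).

(** Square integrability stated on [D] itself, without the extension by zero of [L2]; [L2_sqint]
    relates the two. *)
Definition sqint D f :=
  measurable_fun D f /\ mu.-integrable D (EFin \o (fun x => f x ^+ 2)).

Lemma integrable_le D f g : measurable D -> measurable_fun D f ->
  mu.-integrable D (EFin \o g) -> (forall x, D x -> `|f x| <= g x) ->
  mu.-integrable D (EFin \o f).
Proof.
move=> mD mf ig fg; apply: le_integrable ig => //; first exact/measurable_EFinP.
by move=> x Dx /=; rewrite lee_fin (le_trans (fg _ Dx)) // ler_norm.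
Qed.

Lemma integrableD_fun D f g : measurable D -> mu.-integrable D (EFin \o f) ->
  mu.-integrable D (EFin \o g) -> mu.-integrable D (EFin \o (fun x => f x + g x)).
Proof. by move=> mD i1 i2; have := integrableD mD i1 i2. Qed.

Lemma integrableB_fun D f g : measurable D -> mu.-integrable D (EFin \o f) ->
  mu.-integrable D (EFin \o g) -> mu.-integrable D (EFin \o (fun x => f x - g x)).
Proof. by move=> mD i1 i2; have := integrableB mD i1 i2. Qed.

Lemma integrableZ_fun D f c : measurable D -> mu.-integrable D (EFin \o f) ->
  mu.-integrable D (EFin \o (fun x => c * f x)).
Proof. by move=> mD i1; have := integrableZl mD c i1. Qed.

Lemma integrable_mul D f g : measurable D -> sqint D f -> sqint D g ->
  mu.-integrable D (EFin \o (fun x => f x * g x)).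
Proof.
move=> mD [mf f2] [mg g2].
apply: (integrable_le mD _ (integrableD_fun mD f2 g2)).
  exact: measurable_funM.
move=> x _; rewrite ler_norml; apply/andP; split.
  by have := sqr_ge0 (f x + g x); have := sqr_ge0 (f x);
    have := sqr_ge0 (g x); nra.
by have := sqr_ge0 (f x - g x); have := sqr_ge0 (f x);
  have := sqr_ge0 (g x); nra.
Qed.

Lemma sqintD D f g : measurable D -> sqint D f -> sqint D g ->
  sqint D (fun x => f x + g x).
Proof.
move=> mD [mf f2] [mg g2]; have mfg : measurable_fun D (fun x => f x + g x).
  exact: measurable_funD.
split => //.
apply: (integrable_le mD _ (integrableD_fun mD (integrableZ_fun 2 mD f2)
  (integrableZ_fun 2 mD g2))); first exact: measurable_funX.
move=> x _; rewrite ger0_norm ?sqr_ge0 //.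
by have := sqr_ge0 (f x - g x); nra.
Qed.

Lemma sqintZ D f c : measurable D -> sqint D f -> sqint D (fun x => c * f x).
Proof.
move=> mD [mf f2]; have mcf : measurable_fun D (fun x => c * f x).
  by apply: measurable_funM => //; exact: measurable_cst.
split => //; rewrite (_ : (fun x => _) = (fun x => c ^+ 2 * f x ^+ 2)).
  exact: integrableZ_fun.
by apply/funext => x; rewrite exprMn.
Qed.

Lemma eq_sqint D f g : measurable D -> {in D, f =1 g} -> sqint D f -> sqint D g.
Proof.
move=> mD fg [mf f2]; split; first by apply: eq_measurable_fun mf.
by apply: eq_integrable f2 => // x xD /=; rewrite fg.
Qed.

Lemma sqintB D f g : measurable D -> sqint D f -> sqint D g ->
  sqint D (fun x => f x - g x).
Proof.
move=> mD sf sg; apply: eq_sqint (sqintD mD sf (sqintZ (-1) mD sg)) => //.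
by move=> x _; rewrite mulN1r.
Qed.

Lemma sqint_mul_bounded D f g (M : R) : measurable D -> sqint D f ->
  measurable_fun D g -> (forall x, D x -> `|g x| <= M) ->
  sqint D (fun x => f x * g x).
Proof.
move=> mD [mf f2] mg gM; have mfg : measurable_fun D (fun x => f x * g x).
  exact: measurable_funM.
split => //; apply: (integrable_le mD _ (integrableZ_fun (M ^+ 2) mD f2)).
  exact: measurable_funX.
move=> x Dx; rewrite ger0_norm ?sqr_ge0 // exprMn mulrC.
rewrite ler_wpM2r ?sqr_ge0 // -(real_normK (num_real (g x))).
by rewrite lerXn2r ?nnegrE // (le_trans _ (gM _ Dx)).
Qed.

Lemma sqint_bounded D f (M : R) : measurable D -> (mu D < +oo)%E ->
  measurable_fun D f -> (forall x, D x -> `|f x| <= M) -> sqint D f.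
Proof.
move=> mD Doo mf fM.
apply: (eq_sqint mD _ (sqint_mul_bounded (f := cst 1) mD _ mf fM)).
  by move=> x _; rewrite mul1r.
split; first exact: measurable_cst.
apply: measurable_bounded_integrable => //.
  by apply: measurable_funX; exact: measurable_cst.
by exists 1; split => // N N1 x _ /=; rewrite expr1n normr1 ltW.
Qed.

Lemma sqint_integrable D f : measurable D -> (mu D < +oo)%E -> sqint D f ->
  mu.-integrable D (EFin \o f).
Proof.
move=> mD Doo sf; have s1 : sqint D (cst 1).
  by apply: (@sqint_bounded _ _ 1) => // x _; rewrite normr1.
rewrite (_ : f = fun x => f x * cst 1 x); last by apply/funext => x; rewrite mulr1.
exact: integrable_mul.
Qed.

(** The weight [t] is chosen at each use to make one term small whatever the other is; this serves
    everywhere in place of the Cauchy-Schwarz inequality. *)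
Lemma young_Rintegral D f g (t : R) : measurable D -> 0 < t ->
  sqint D f -> sqint D g ->
  `|\int[mu]_(x in D) (f x * g x)| <=
  t * \int[mu]_(x in D) (f x ^+ 2) + t^-1 * \int[mu]_(x in D) (g x ^+ 2).
Proof.
move=> mD t0 sf sg; have [mf f2] := sf; have [mg g2] := sg.
apply: le_trans (le_normr_Rintegral mD (integrable_mul mD sf sg)) _.
rewrite -!RintegralZl // -RintegralD //; [|exact: integrableZ_fun..].
apply: le_Rintegral => //.
- exact: (integrable_norm (integrable_mul mD sf sg)).
- by apply: integrableD_fun => //; exact: integrableZ_fun.
move=> x _; have ti0 : 0 < t^-1 by rewrite invr_gt0.
have sqn (z : R) : z ^+ 2 = `|z| ^+ 2 by rewrite real_normK ?num_real.
rewrite (sqn (f x)) (sqn (g x)) normrM.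
have tt : t * t^-1 = 1 by rewrite mulfV // gt_eqF.
move: t^-1 ti0 tt `|f x| `|g x| => s s0 tt a b.
(* With [t * s = 1] this square gives a b <= t a^2 + s b^2 / 4, which is slightly better than
   required. *)
have : 0 <= t * (a - s * b / 2) ^+ 2 by rewrite mulr_ge0 ?sqr_ge0 // ltW.
have -> : t * (a - s * b / 2) ^+ 2 =
  t * a ^+ 2 - (t * s) * a * b + (t * s) * s * b ^+ 2 / 4 by field.
rewrite tt; have : 0 <= s * b ^+ 2 by rewrite mulr_ge0 ?sqr_ge0 // ltW.
lra.
Qed.

Lemma cvg_Rintegral_mul D (f_ : nat -> T -> R) f g : measurable D ->
  (forall n, sqint D (f_ n)) -> sqint D f -> sqint D g ->
  \int[mu]_(x in D) ((f_ n x - f x) ^+ 2) @[n --> \oo] --> 0 ->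
  \int[mu]_(x in D) (f_ n x * g x) @[n --> \oo] --> \int[mu]_(x in D) (f x * g x).
Proof.
move=> mD sf_ sf sg h.
pose G := \int[mu]_(x in D) (g x ^+ 2).
have G0 : 0 <= G by apply: Rintegral_ge0 => x _; exact: sqr_ge0.
apply/cvgrPdist_lt => e e0.
have G1 : 0 < G + 1 by lra.
(* This weight puts the term with [g] below [e / 2] for all [n]; [G + 1] replaces [G], which may be
   zero. *)
pose t := 2 * (G + 1) / e.
have G2 : 0 < 2 * (G + 1) by lra.
have t0 : 0 < t by exact: divr_gt0.
have tG : t^-1 * G < e / 2.
  rewrite /t invf_div mulrAC ltr_pdivrMr //; nra.
have /cvgrPdist_lt /(_ (e / 2 / t)) := h.
rewrite !divr_gt0 // => /(_ isT); apply: filterS => n.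
rewrite sub0r normrN => hn.
rewrite distrC -RintegralB //; [|exact: integrable_mul..].
under eq_Rintegral do rewrite -mulrBl.
apply: (le_lt_trans (young_Rintegral mD t0 (sqintB mD (sf_ n) sf) sg)).
rewrite (splitr e) ltrD // mulrC -ltr_pdivlMr //.
by apply: le_lt_trans hn; rewrite ler_norm.
Qed.

End SquareIntegrable.

(** * Integration over triangulations by slices *)

Section IntervalSums.
Variable R : realType.

(** In the application [ne] flags the triangles that a line meets and [a], [b] are the ends of their
    slices; where [ne j] fails, [a j] and [b j] carry no meaning. *)
Definition almost_disjoint N (ne : pred 'I_N) (a b : 'I_N -> R) :=
  forall j l s t, ne j -> ne l -> j != l ->
    a j <= s <= b j -> a l <= s <= b l ->
    a j <= t <= b j -> a l <= t <= b l -> s = t.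

Definition covered N (ne : pred 'I_N) (a b : 'I_N -> R) (s : R) :=
  exists2 l, ne l & a l <= s <= b l.

Lemma almost_disjoint_opp N (ne : pred 'I_N) a b :
  almost_disjoint ne a b -> almost_disjoint ne (fun j => - b j) (fun j => - a j).
Proof.
move=> ad j l s t nej nel jl h1 h2 h3 h4; apply: oppr_inj.
by apply: (ad j l) => //; apply/andP; split; lra.
Qed.

(* The intervals being finitely many, one of them contains points arbitrarily
   close to [x] on its right, hence contains [x] too. *)
Lemma covered_right N (ne : pred 'I_N) (a b : 'I_N -> R) x e : 0 < e ->
  (forall s, x < s < x + e -> covered ne a b s) ->
  exists2 l, ne l & a l <= x < b l.
Proof.
move=> e0 cov.
(* No interval starts strictly between [x] and [x + d], so one that contains [x + d / 2] starts at
   [x] or before. *)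
pose d := \big[Num.min/e]_(l | x < a l) (a l - x).
have d0 : 0 < d.
  rewrite /d; elim/big_ind: _ => // [u v u0 v0|l xl]; first by rewrite lt_min u0.
  by rewrite subr_gt0.
have de : d <= e by rewrite /d; exact: bigmin_le_id.
have dl l : x < a l -> d <= a l - x by move=> xl; rewrite /d; exact: bigmin_le_cond.
have [|l nel /andP[al bl]] := cov (x + d / 2); first by lra.
exists l => //; apply/andP; split; last by lra.
by rewrite leNgt; apply/negP => /dl; lra.
Qed.

(** Some interval [l] contains [x] and extends to its right. Did it start before [x], it would share
    with [j] the nondegenerate segment from the larger of the two left ends to [x]. *)
Lemma adjacent_right N (ne : pred 'I_N) (a b : 'I_N -> R) x e j :
  almost_disjoint ne a b -> ne j -> a j < b j -> b j = x -> 0 < e ->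
  (forall s, x < s < x + e -> covered ne a b s) ->
  exists2 l, ne l && (a l < b l) & a l = x.
Proof.
move=> ad nej abj bj e0 cov.
have [l nel /andP[al bl]] := covered_right e0 cov.
exists l; first by rewrite nel (le_lt_trans al bl).
apply/eqP; rewrite eq_le al /= leNgt; apply/negP => alx.
have jl : j != l by apply/eqP => jl; move: bl; rewrite -jl bj ltxx.
have eqd := ad j l (Num.max (a j) (a l)) x nej nel jl.
have ajx : a j < x by rewrite -bj.
have mx : Num.max (a j) (a l) < x by rewrite gt_max ajx alx.
have m1 : a j <= Num.max (a j) (a l) by rewrite le_max lexx.
have m2 : a l <= Num.max (a j) (a l) by rewrite le_max lexx orbT.
move: mx m1 m2 eqd; move: (Num.max _ _) => m mx m1 m2 eqd.
have : m = x by apply: eqd; apply/andP; split; lra.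
lra.
Qed.

(** Two nondegenerate intervals with the same right end overlap in a nondegenerate segment. *)
Lemma unique_right_end N (ne : pred 'I_N) (a b : 'I_N -> R) j l :
  almost_disjoint ne a b -> ne j -> ne l -> a j < b j -> a l < b l ->
  b j = b l -> j = l.
Proof.
move=> ad nej nel abj abl bjl; apply/eqP/negPn/negP => jl.
have eqd := ad j l (Num.max (a j) (a l)) (b j) nej nel jl.
have mx : Num.max (a j) (a l) < b j by rewrite gt_max abj bjl abl.
have m1 : a j <= Num.max (a j) (a l) by rewrite le_max lexx.
have m2 : a l <= Num.max (a j) (a l) by rewrite le_max lexx orbT.
move: mx m1 m2 eqd; move: (Num.max _ _) => m mx m1 m2 eqd.
have : m = b j by apply: eqd; apply/andP; split; lra.
lra.
Qed.

(* On the line, an interior end point of an interval is also an end point, from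
   the other side, of exactly one other interval: only boundary points remain. *)
Lemma interval_sum_bound N n (ne : pred 'I_N) (a b : 'I_N -> R) (H : R -> R)
    (I : pred 'I_n) (p : 'I_n -> R) :
  almost_disjoint ne a b ->
  (forall x, covered ne a b x -> (exists2 i, I i & x = p i) \/
     exists2 e, 0 < e & forall s, x - e < s < x + e -> covered ne a b s) ->
  `|\sum_(j | ne j && (a j < b j)) (H (b j) - H (a j))| <=
  \sum_(i | I i) `|H (p i)|.
Proof.
move=> ad cov.
pose J := [pred j | ne j && (a j < b j)].
pose E := undup ([seq a j | j in J] ++ [seq b j | j in J]).
have uE : uniq E by exact: undup_uniq.
pose na x := [exists j, J j && (a j == x)].
pose nb x := [exists j, J j && (b j == x)].
(* As a point is the right end, or the left end, of at most one interval, the sum over intervals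
   becomes a sum over distinct end points with weights 0 or 1. *)
have sum_ends (f : 'I_N -> R) : (forall j, J j -> f j \in E) ->
    (forall j l, J j -> J l -> f j = f l -> j = l) ->
    \sum_(j | J j) H (f j) =
    \sum_(x <- E) H x * ([exists j, J j && (f j == x)])%:R.
  move=> fE finj.
  transitivity (\sum_(j | J j) \sum_(x <- E) H x * (f j == x)%:R).
    apply: eq_bigr => j Jj; rewrite (bigD1_seq (f j)) //=; last exact: fE.
    rewrite eqxx mulr1 big1 ?addr0 // => x; rewrite eq_sym => /negPf ->.
    by rewrite mulr0.
  rewrite exchange_big /=; apply: eq_bigr => x _; rewrite -mulr_sumr; congr (_ * _).
  case: existsP => [[j /andP[Jj /eqP fjx]]|nex].
    rewrite (bigD1 j) //= fjx eqxx big1 ?addr0 // => l /andP[Jl lj].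
    case: eqP => // flx; case/eqP: lj; apply: finj => //.
    by rewrite flx.
  rewrite big1 // => j Jj; case: eqP => // fjx.
  by case: nex; exists j; rewrite Jj fjx eqxx.
have aE j : J j -> a j \in E.
  by move=> Jj; rewrite mem_undup mem_cat; apply/orP; left; apply/fintype.imageP; exists j.
have bE j : J j -> b j \in E.
  by move=> Jj; rewrite mem_undup mem_cat; apply/orP; right; apply/fintype.imageP; exists j.
have binj j l : J j -> J l -> b j = b l -> j = l.
  by move=> /andP[j1 j2] /andP[l1 l2]; exact: (unique_right_end ad).
have ainj j l : J j -> J l -> a j = a l -> j = l.
  move=> /andP[j1 j2] /andP[l1 l2] ajl.
  by apply: (unique_right_end (almost_disjoint_opp ad)); rewrite ?ltrN2 // ajl.
rewrite sumrB (sum_ends b bE binj) (sum_ends a aE ainj) -sumrB.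
(* At an interior point both weights agree, so its two contributions cancel. One direction is
   [adjacent_right], the other the same after reflecting the line. *)
have nanb x e : 0 < e -> (forall s, x - e < s < x + e -> covered ne a b s) ->
    na x = nb x.
  move=> e0 ce; apply/existsP/existsP => -[j /andP[/andP[nej abj] /eqP jx]].
    have [|||s|l /andP[nel abl] lx] := @adjacent_right _ ne (fun j => - b j)
      (fun j => - a j) (- x) e j (almost_disjoint_opp ad) nej => //.
    - by rewrite ltrN2.
    - by rewrite jx.
    - move=> /andP[s1 s2]; have [|l nel /andP[l1 l2]] := ce (- s).
        by apply/andP; split; lra.
      by exists l => //; apply/andP; split; lra.
    - exists l; rewrite /= nel -ltrN2 abl; apply/eqP; exact: oppr_inj.
  have [|l Jl lx] := adjacent_right ad nej abj jx e0.
    by move=> s /andP[s1 s2]; apply: ce; apply/andP; split; lra.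
  by exists l; rewrite /= Jl lx eqxx.
apply: (@le_trans _ _ (\sum_(x <- E) \sum_(i | I i) `|H (p i)| * (p i == x)%:R)).
  apply: le_trans (ler_norm_sum _ _ _) _.
  rewrite big_seq [leRHS]big_seq; apply: ler_sum => x xE.
  have cx : covered ne a b x.
    move: xE; rewrite mem_undup mem_cat => /orP[] /fintype.imageP[j /andP[nej abj] ->];
      by exists j => //; rewrite lexx ltW.
  have S0 : 0 <= \sum_(i | I i) `|H (p i)| * (p i == x)%:R.
    by apply: sumr_ge0 => i _; rewrite mulr_ge0.
  case: (cov x cx) => [[i Ii xi]|[e e0 ce]].
    rewrite xi (bigD1 i) //= eqxx mulr1 ler_wpDr //.
      by apply: sumr_ge0 => l _; rewrite mulr_ge0.
    rewrite -mulrBr normrM ler_piMr //.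
    by case: [exists _, _]; case: [exists _, _];
      rewrite ?subrr ?subr0 ?sub0r ?normrN ?normr1 ?normr0.
  by have := nanb x e e0 ce; rewrite /na /nb => ->; rewrite subrr normr0.
(* [E] has no repetitions, so each [p i] is counted at most once. *)
rewrite exchange_big /=; apply: ler_sum => i _; rewrite -mulr_sumr.
rewrite ler_piMr // -natr_sum -[leRHS]/(1%:R) ler_nat.
rewrite (eq_bigr (fun x => if x == p i then 1 else 0)%N); last first.
  by move=> x _; rewrite eq_sym; case: eqP.
by rewrite -big_mkcond sum1_count count_uniq_mem //; case: (_ \in _).
Qed.

End IntervalSums.

(** * Barycentric coordinates and nondegenerate triangles *)

Section TriangleGeometry.
Variable R : realType.
Implicit Types (T : 'I_3 -> R * R) (x y : R * R).

Definition nondeg T := cross (T (lift ord0 ord0) - T ord0) (T ord_max - T ord0) != 0.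

Lemma ord3P (Q : 'I_3 -> Prop) :
  Q ord0 -> Q (lift ord0 ord0) -> Q ord_max -> forall j, Q j.
Proof.
move=> h0 h1 h2 [[|[|[|//]]] hj].
- by rewrite (_ : Ordinal hj = ord0) //; exact: val_inj.
- by rewrite (_ : Ordinal hj = lift ord0 ord0) //; exact: val_inj.
- by rewrite (_ : Ordinal hj = ord_max) //; exact: val_inj.
Qed.

Lemma sum3 (f : 'I_3 -> R) : \sum_j f j = f ord0 + f (lift ord0 ord0) + f ord_max.
Proof.
rewrite !big_ord_recl big_ord0 addr0 addrA; congr (_ + _ + f _); exact: val_inj.
Qed.

Lemma ordS3 : (ordS (ord0 : 'I_3) = lift ord0 ord0) *
  (ordS (lift ord0 ord0 : 'I_3) = ord_max) * (ordS (ord_max : 'I_3) = ord0).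
Proof. by do !split; exact: val_inj. Qed.

(** Twice the signed area is invariant under cyclic relabelling, so the three barycentric
    coordinates have a common denominator. *)
Lemma nondegE T j : nondeg T ->
  cross (T (ordS j) - T j) (T (ordS (ordS j)) - T j) =
  cross (T (lift ord0 ord0) - T ord0) (T ord_max - T ord0).
Proof.
by move=> _; elim/ord3P: j; rewrite !ordS3 // /cross /=; ring.
Qed.

Lemma bary_coord_sum T x : nondeg T ->
  [/\ \sum_j bary_coord T j x = 1,
      \sum_j bary_coord T j x * (T j).1 = x.1 &
      \sum_j bary_coord T j x * (T j).2 = x.2].
Proof.
move=> nd; rewrite !sum3 /bary_coord !nondegE //; move: nd; rewrite /nondeg !ordS3.
rewrite /cross /=; move: (T ord0) (T (lift ord0 ord0)) (T ord_max) x.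
move=> [a1 a2] [b1 b2] [c1 c2] [x1 x2] /= nd.
by split; field.
Qed.

Lemma bary_coord_comb T x (c : 'I_3 -> R) j : nondeg T -> \sum_j c j = 1 ->
  x.1 = \sum_j c j * (T j).1 -> x.2 = \sum_j c j * (T j).2 ->
  bary_coord T j x = c j.
Proof.
move=> nd; rewrite !sum3 => s1 x1 x2.
rewrite /bary_coord nondegE //.
apply: (canLR (mulfK nd)).
rewrite /cross /= {}x1 {}x2.
have c0 : c ord0 = 1 - c (lift ord0 ord0) - c ord_max by lra.
by elim/ord3P: j; rewrite !ordS3 c0; ring.
Qed.

(** Barycentric coordinates are the only possible coefficients of a convex combination, which turns
    the existential of [hull] into sign conditions. *)
Lemma hullP T (J : {pred 'I_3}) x : nondeg T ->
  hull T J x <-> (forall j, 0 <= bary_coord T j x) /\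
                 (forall j, j \notin J -> bary_coord T j x = 0).
Proof.
move=> nd; split => [[c [c0 cJ c1 x1 x2]]|[h0 hJ]].
  by split=> j; rewrite (bary_coord_comb _ nd c1 x1 x2) //; exact: cJ.
have [s1 s2 s3] := bary_coord_sum x nd.
by exists (fun j => bary_coord T j x); split.
Qed.

Lemma triangleP T x : nondeg T ->
  triangle T x <-> forall j, 0 <= bary_coord T j x.
Proof.
by move=> nd; split => [/(hullP _ _ nd)[]|h] //; apply/hullP.
Qed.

Lemma hull_bounded T J x : hull T J x ->
  `|x.1| <= \sum_j `|(T j).1| /\ `|x.2| <= \sum_j `|(T j).2|.
Proof.
move=> [c [c0 _ c1 x1 x2]].
have cle j : c j <= 1.
  by rewrite -c1 (bigD1 j) //= ler_wpDr // sumr_ge0.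
by rewrite x1 x2; split; apply: le_trans (ler_norm_sum _ _ _) _;
  apply: ler_sum => j _; rewrite normrM (ger0_norm (c0 j)) ler_piMl.
Qed.

Lemma continuous_fst2 : continuous (fun x : R * R => x.1).
Proof. by move=> x; exact: cvg_fst. Qed.

Lemma continuous_snd2 : continuous (fun x : R * R => x.2).
Proof. by move=> x; exact: cvg_snd. Qed.

Lemma continuous_cross (p q : R * R) :
  continuous (fun x : R * R => cross (p - x) (q - x)).
Proof.
move=> x; rewrite /cross /=.
have c1 (u : R) : u - y.1 @[y --> x] --> u - x.1.
  by apply: cvgB; [exact: cvg_cst|exact: continuous_fst2].
have c2 (u : R) : u - y.2 @[y --> x] --> u - x.2.
  by apply: cvgB; [exact: cvg_cst|exact: continuous_snd2].
by apply: cvgB; apply: cvgM.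
Qed.

Lemma continuous_bary_coord T j : continuous (bary_coord T j).
Proof.
move=> x; rewrite /bary_coord; apply: cvgM; last exact: cvg_cst.
exact: continuous_cross.
Qed.

Lemma triangle_compact T : nondeg T -> compact (triangle T).
Proof.
move=> nd.
pose M1 := \sum_j `|(T j).1|; pose M2 := \sum_j `|(T j).2|.
have cR : compact (`[- M1, M1]%classic `*` `[- M2, M2]%classic : set (R * R)).
  by apply: compact_setX; exact: segment_compact.
apply: (subclosed_compact _ cR); last first.
  by move=> x /hull_bounded[]; rewrite !ler_norml => h1 h2; split; rewrite /= in_itv.
rewrite (_ : triangle T = \bigcap_j (bary_coord T j @^-1` [set y | 0 <= y])).
  apply: closed_bigI => j _; apply: preimage_closed => [x _|].
    exact: continuous_bary_coord.
  exact: closed_ge.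
apply/seteqP; split => x; first by move=> /(triangleP _ nd) h j _ /=.
by move=> h; apply/triangleP => // j; exact: h.
Qed.

(** If the triangle is flat, both edge vectors at the first vertex are parallel to [x - T ord0] for
    each of its points [x]. Comparing the centre of the disc with the point at distance [r] above it
    makes both edges vertical; the point at distance [r] to the right then leaves the triangle. *)
Lemma disc_nondeg T (c : R * R) r : 0 < r -> disc c r `<=` triangle T -> nondeg T.
Proof.
move=> r0 sub; apply/negP => /eqP D0.
have pts (v : R * R) : v.1 ^+ 2 + v.2 ^+ 2 <= r ^+ 2 -> triangle T (c + v).
  move=> hv; apply: sub; rewrite /disc /dist /dotp /=.
  rewrite -(ger0_norm (ltW r0)) -sqrtr_sqr ler_wsqrtr //.
  by apply: le_trans hv; rewrite le_eqVlt; apply/orP; left; apply/eqP; ring.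
have crossT x : triangle T x ->
    cross (T (lift ord0 ord0) - T ord0) (x - T ord0) = 0 /\
    cross (T ord_max - T ord0) (x - T ord0) = 0.
  move=> [d [_ _]]; rewrite !sum3 => d1 x1 x2.
  have d0 : d ord0 = 1 - d (lift ord0 ord0) - d ord_max by lra.
  rewrite /cross /= x1 x2 d0; move: D0; rewrite /cross /=.
  move: (T ord0) (T (lift ord0 ord0)) (T ord_max) => [a1 a2] [b1 b2] [c1 c2] /= D0.
  split.
    rewrite (_ : _ - _ = d ord_max * ((b1 - a1) * (c2 - a2) - (b2 - a2) * (c1 - a1))).
      by rewrite D0 mulr0.
    by ring.
  rewrite (_ : _ - _ = - d (lift ord0 ord0) *
    ((b1 - a1) * (c2 - a2) - (b2 - a2) * (c1 - a1))).
    by rewrite D0 mulr0.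
  by ring.
have r2 : 0 <= r ^+ 2 by exact: sqr_ge0.
have [|p0 q0] := crossT _ (pts (0, 0) _); first by rewrite /= expr0n /= addr0.
have [|p1 q1] := crossT _ (pts (r, 0) _); first by rewrite /= expr0n /= addr0.
have [|p2 q2] := crossT _ (pts (0, r) _); first by rewrite /= expr0n /= add0r.
have := pts (0, 0); have := pts (r, 0); rewrite /= !expr0n /= !addr0.
move=> /(_ (lexx _)) t1 /(_ r2) t0.
move: p0 q0 p1 q1 p2 q2; rewrite /cross /=.
move=> p0 q0 p1 q1 p2 q2.
have e1 : (T (lift ord0 ord0)).1 = (T ord0).1.
  have : r * ((T (lift ord0 ord0)).1 - (T ord0).1) = 0 by nra.
  by move/eqP; rewrite mulf_eq0 (gt_eqF r0) /= subr_eq0 => /eqP.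
have e2 : (T ord_max).1 = (T ord0).1.
  have : r * ((T ord_max).1 - (T ord0).1) = 0 by nra.
  by move/eqP; rewrite mulf_eq0 (gt_eqF r0) /= subr_eq0 => /eqP.
have fst_const x : triangle T x -> x.1 = (T ord0).1.
  move=> [d [_ _]]; rewrite !sum3 => d1 -> _; rewrite e1 e2 -!mulrDl d1 mul1r.
  by [].
have := fst_const _ t1; have := fst_const _ t0; rewrite /=; lra.
Qed.

End TriangleGeometry.

(** * Slices of triangles by lines parallel to the axes *)

Section Slices.
Variable R : realType.
Implicit Types (T : 'I_3 -> R * R) (x : R * R) (K : set (R * R)) (f g : R * R -> R).

(* [pt b] parametrizes the line parallel to the axis selected by [b], so that
   both partial derivatives are treated at once. *)
Definition pt (b : bool) (s y : R) : R * R := if b then (s, y) else (y, s).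
Definition axis (b : bool) : R * R := pt b 1 0.
Definition coo (b : bool) x : R := if b then x.1 else x.2.
Definition dd (b : bool) f x : R := 'D_(axis b) f x.

Lemma pt_coo b x : pt b (coo b x) (coo (~~ b) x) = x.
Proof. by case: x => x1 x2; case: b. Qed.

Lemma coo_pt b s y : coo b (pt b s y) = s.
Proof. by case: b. Qed.

Lemma cooN_pt b s y : coo (~~ b) (pt b s y) = y.
Proof. by case: b. Qed.

Lemma pt_cvg b y (s : R) : pt b t y @[t --> s] --> pt b s y.
Proof.
case: b; rewrite /pt.
  by apply: (@cvg_pair _ _ _ (nbhs s) (nbhs s) (nbhs y)); [exact: cvg_id|exact: cvg_cst].
by apply: (@cvg_pair _ _ _ (nbhs s) (nbhs y) (nbhs s)); [exact: cvg_cst|exact: cvg_id].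
Qed.

Lemma pt_continuous b y : continuous (fun s => pt b s y).
Proof. by move=> s; exact: pt_cvg. Qed.

Definition C1 f := [/\ continuous f, forall b x, derivable f x (axis b) &
  forall b, continuous (dd b f)].

Lemma slice_is_derive f b s y : derivable f (pt b s y) (axis b) ->
  is_derive s 1 (fun t => f (pt b t y)) (dd b f (pt b s y)).
Proof.
have E : (fun h : R => h^-1 *: ((f \o shift (pt b s y)) (h *: axis b) - f (pt b s y))) =
  (fun h : R => h^-1 *: (((fun t => f (pt b t y)) \o shift s) (h *: 1) - f (pt b s y))).
  apply/funext => h; rewrite /= /axis; congr (_ *: (f _ - _)).
  by case: b; rewrite /pt /=; congr (_, _); rewrite /= ?scaler0 ?add0r.
by move=> df; split; rewrite /dd /derivable /derive -?E.
Qed.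

Lemma slice_FTC g b y (u v : R) : C1 g -> u < v ->
  \int[@lebesgue_measure R]_(s in `[u, v]) dd b g (pt b s y) =
  g (pt b v y) - g (pt b u y).
Proof.
move=> [cg dg cdg] uv; rewrite /Rintegral.
have cgs : continuous (fun s => g (pt b s y)).
  by move=> s; apply: continuous_comp; [exact: pt_continuous|exact: cg].
rewrite (@continuous_FTC2 _ (fun s => dd b g (pt b s y)) (fun s => g (pt b s y))) //.
- apply: continuous_subspaceT => s.
  by apply: continuous_comp; [exact: pt_continuous|exact: cdg].
- split.
  + by move=> s _; have [] := slice_is_derive (dg b (pt b s y)).
  + by apply: cvg_at_right_filter; exact: cgs.
  + by apply: cvg_at_left_filter; exact: cgs.
- move=> s _; rewrite derive1E.
  by have [_ ->] := slice_is_derive (dg b (pt b s y)).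
Qed.

Lemma bary_coord_slice T j b y u v (t : R) :
  bary_coord T j (pt b (u + t * (v - u)) y) =
  (1 - t) * bary_coord T j (pt b u y) + t * bary_coord T j (pt b v y).
Proof. by rewrite /bary_coord /cross; case: b => /=; ring. Qed.

Lemma slice_compact K b y : compact K -> compact [set s | K (pt b s y)].
Proof.
move=> cK; have [M M0 hM] := compact_bounded2 cK.
apply: (subclosed_compact _ (@segment_compact _ (- M) M)).
  apply: (preimage_closed (f := fun s => pt b s y)); last exact: compact_closed2.
  by move=> s _; exact: pt_continuous.
move=> s /hM; rewrite !ler_norml /= in_itv /=.
by case: (b) => /= -[].
Qed.

(** A nonempty slice is compact, so it has extreme points; barycentric coordinates are affine along
    the line, so all points between them belong to it. An empty slice is encoded by the flag
    [false]. *)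
Lemma triangle_slice T b y : nondeg T -> exists p : bool * R * R,
  (forall s, triangle T (pt b s y) <-> p.1.1 && (p.1.2 <= s <= p.2)) /\
  (p.1.1 -> p.1.2 <= p.2).
Proof.
move=> nd; pose A := [set s | triangle T (pt b s y)].
have [A0|] := pselect (A !=set0); last first.
  by move=> nA; exists (false, 0, 0); split => //= s; split => // Ts; case: nA; exists s.
have cA : compact A by apply: slice_compact; exact: triangle_compact.
have cid : {within A, continuous (@idfun R)}.
  by apply: continuous_subspaceT => s; exact: cvg_id.
have [c] := compact_EVT_min A0 cA cid; rewrite inE => Ac minc.
have [d] := compact_EVT_max A0 cA cid; rewrite inE => Ad maxd.
have cd : c <= d by apply: minc; rewrite inE.
exists (true, c, d); split => //= s; split => [As|/andP[cs sd]].
  by rewrite minc ?maxd // inE.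
apply/triangleP => // j.
have /(triangleP _ nd)/(_ j) bc := Ac; have /(triangleP _ nd)/(_ j) bd := Ad.
move: cd; rewrite le_eqVlt => /orP[/eqP cd|cd].
  by have -> : s = c by lra.
have dc : 0 < d - c by lra.
pose t := (s - c) / (d - c).
have t0 : 0 <= t by apply: divr_ge0; lra.
have t1 : t <= 1 by rewrite /t ler_pdivrMr // mul1r; lra.
have -> : s = c + t * (d - c) by rewrite /t divfK ?gt_eqF //; lra.
by rewrite bary_coord_slice addr_ge0 // mulr_ge0 //; lra.
Qed.

End Slices.

Section SliceBound.
Variable R : realType.
Implicit Types (x : R * R).

(** The facts on the triangulation that slicing relies on, with shape regularity reduced to
    nondegeneracy; [mesh_triangulation] provides them. *)
Record mesh n (P : 'I_n -> R * R) (K : set (R * R)) N (T : 'I_N -> 'I_3 -> R * R) : Prop := Mesh {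
  mesh_compact : compact K;
  mesh_boundary : closure K `\` interior K = boundary P;
  mesh_nondeg : forall j, nondeg (T j);
  mesh_cover : K = \bigcup_j triangle (T j);
  mesh_conforming : forall i j, i != j ->
    (exists l, l \notin common (T i) (T j)) /\
    triangle (T i) `&` triangle (T j) = hull (T i) (common (T i) (T j)) }.

(** Both points lie on the line carrying the edge opposite to vertex [l]. If that edge were parallel
    to the slicing line, [x] would have the same transversal coordinate as its end points; so the
    two lines meet only once. *)
Lemma edge_slice_unique (T : 'I_3 -> R * R) (l : 'I_3) b x x' : nondeg T ->
  (forall j, coo (~~ b) x <> coo (~~ b) (T j)) -> coo (~~ b) x = coo (~~ b) x' ->
  bary_coord T l x = 0 -> bary_coord T l x' = 0 -> coo b x = coo b x'.
Proof.
move=> nd hy xx' lx lx'.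
have [s1 s2 s3] := bary_coord_sum x nd.
have [s1' s2' s3'] := bary_coord_sum x' nd.
move: hy xx' s1 s2 s3 s1' s2' s3'; rewrite !sum3.
move=> hy; have {hy} := (hy ord0, hy (lift ord0 ord0), hy ord_max).
have gen (p q p' q' y1 y2 t1 t2 u u' y y' : R) : p + q = 1 -> p' + q' = 1 ->
    p * y1 + q * y2 = y -> p' * y1 + q' * y2 = y' ->
    p * t1 + q * t2 = u -> p' * t1 + q' * t2 = u' ->
    y = y' -> y <> y1 -> u = u'.
  move=> h1 h2 h3 h4 h5 h6 h7 h8.
  have h : (p - p') * (y1 - y2) = 0 by nra.
  move/eqP: h; rewrite mulf_eq0 !subr_eq0 => /orP[/eqP e|/eqP e]; last first.
    by case: h8; rewrite -h3 -e -mulrDl h1 mul1r.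
  have e2 : q = q' by lra.
  by rewrite -h5 -h6 e e2.
move: lx lx'; elim/ord3P: l => -> ->; rewrite ?(mul0r, add0r, addr0) => -[[n0 n1] n2];
  case: b n0 n1 n2 => /= n0 n1 n2 xx' s1 s2 s3 s1' s2' s3';
  by [apply: (gen _ _ _ _ _ _ _ _ _ _ _ _ s1 s1' s3 s3' s2 s2' xx')
     |apply: (gen _ _ _ _ _ _ _ _ _ _ _ _ s1 s1' s2 s2' s3 s3' xx')].
Qed.

Context n (P : 'I_n -> R * R) (K : set (R * R)) N (T : 'I_N -> 'I_3 -> R * R).
Hypothesis PKT : mesh P K T.

(** A finite, hence null, set: the other lines contain no vertex and therefore no edge. *)
Definition exceptional (b : bool) : set R :=
  [set y | (exists j l, y = coo (~~ b) (T j l)) \/ exists i, y = coo (~~ b) (P i)].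

(** By conformity the intersection lies in the hull of the common vertices, where the coordinate of
    some vertex [l] of [T i] vanishes; [edge_slice_unique] applies to it. *)
Lemma triangles_slice_inter b y i j s t : ~ exceptional b y -> i != j ->
  triangle (T i) (pt b s y) -> triangle (T j) (pt b s y) ->
  triangle (T i) (pt b t y) -> triangle (T j) (pt b t y) -> s = t.
Proof.
move=> ny ij si sj ti tj.
have [[l lc] I] := mesh_conforming PKT ij.
have nd := mesh_nondeg PKT i.
have /(hullP _ _ nd)[_ /(_ _ lc) s0] : hull (T i) (common (T i) (T j)) (pt b s y).
  by rewrite -I.
have /(hullP _ _ nd)[_ /(_ _ lc) t0] : hull (T i) (common (T i) (T j)) (pt b t y).
  by rewrite -I.
rewrite -(coo_pt b s y) -(coo_pt b t y).
apply: (edge_slice_unique nd _ _ s0 t0); last by rewrite !cooN_pt.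
by move=> k; rewrite cooN_pt => yk; apply: ny; left; exists i, k.
Qed.

Definition crosses b i y : bool :=
  (coo (~~ b) (P i) - y) * (coo (~~ b) (P (ordS i)) - y) < 0.

Definition edge_pt b i y : R * R := lin (P i) (P (ordS i))
  ((y - coo (~~ b) (P i)) / (coo (~~ b) (P (ordS i)) - coo (~~ b) (P i))).

Lemma coo_lin b (p q : R * R) t :
  coo b (lin p q t) = coo b p + t * (coo b q - coo b p).
Proof. by case: b. Qed.

Lemma coo_edge_pt b i y : crosses b i y -> coo (~~ b) (edge_pt b i y) = y.
Proof.
rewrite /crosses /edge_pt coo_lin => cr.
rewrite divfK; first by rewrite addrC subrK.
rewrite subr_eq0; apply/eqP => e; move: cr; rewrite e -expr2.
by rewrite ltNge sqr_ge0.
Qed.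

Lemma boundary_edge_pt b s y : ~ exceptional b y -> boundary P (pt b s y) ->
  exists2 i, crosses b i y & pt b s y = edge_pt b i y.
Proof.
move=> ny [i _ [t /=]]; rewrite in_itv /= => /andP[t0 t1] e.
have := cooN_pt b s y; rewrite -e coo_lin.
set p := coo _ _; set q := coo _ _ => ey.
have py : y <> p by move=> h; apply: ny; right; exists i.
have qy : y <> q by move=> h; apply: ny; right; exists (ordS i).
have qp : q - p != 0.
  by apply/eqP => h; apply: py; rewrite -ey h mulr0 addr0.
have {}t0 : 0 < t.
  rewrite lt_neqAle t0 andbT; apply/eqP => h; apply: py.
  by rewrite -ey -h mul0r addr0.
have {}t1 : t < 1.
  rewrite lt_neqAle t1 andbT; apply/eqP => h; apply: qy.
  by rewrite -ey h; lra.
exists i.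
  rewrite /crosses -/p -/q -ey.
  rewrite (_ : _ * _ = - (t * (1 - t) * (q - p) ^+ 2)); last by ring.
  rewrite oppr_lt0 mulr_gt0 //; first by rewrite mulr_gt0 // subr_gt0.
  by rewrite exprn_even_gt0.
by rewrite /edge_pt -/p -/q -ey (addrC p) addrK mulfK.
Qed.

(** On the line, the fundamental theorem of calculus turns each triangle into a difference of two
    values of [h]. Since [h] is the same function on all triangles, [interval_sum_bound] leaves only
    the points where the line meets the boundary. *)
Lemma slice_bound b y (g : 'I_N -> R * R -> R) (h : R * R -> R) :
  ~ exceptional b y -> (forall j, C1 (g j)) ->
  (forall j x, triangle (T j) x -> h x = g j x) ->
  `|\sum_j \int[@lebesgue_measure R]_s (dd b (g j) \_ (triangle (T j))) (pt b s y)|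
  <= \sum_(i | crosses b i y) `|h (edge_pt b i y)|.
Proof.
move=> ny cg hg.
have /choice[F hF] := fun j => triangle_slice b y (mesh_nondeg PKT j).
pose ne j := (F j).1.1; pose u j := (F j).1.2; pose v j := (F j).2.
have trP j s : triangle (T j) (pt b s y) <-> ne j && (u j <= s <= v j).
  by have [+ _] := hF j; exact.
have int j : \int[@lebesgue_measure R]_s (dd b (g j) \_ (triangle (T j))) (pt b s y)
  = if ne j && (u j < v j) then h (pt b (v j) y) - h (pt b (u j) y) else 0.
  have [nej|nej] := boolP (ne j); last first.
    rewrite (_ : (fun s => _) = cst 0) ?Rintegral_cst //=; last first.
      apply/funext => s; rewrite /patch; case: ifPn => //.
      by rewrite inE => /trP; rewrite (negPf nej).
    by rewrite mul0r.
  have -> : (fun s => (dd b (g j) \_ (triangle (T j))) (pt b s y)) =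
      (fun s => dd b (g j) (pt b s y)) \_ `[u j, v j].
    apply/funext => s; rewrite /patch; congr (if _ then _ else _).
    by apply/idP/idP; rewrite !inE /= in_itv /= trP nej.
  rewrite -Rintegral_mkcond /=.
  have uv : u j <= v j by have [_] := hF j; exact.
  case: ltP => [uv'|vu].
    rewrite slice_FTC // (hg j (pt b (u j) y)) ?(hg j (pt b (v j) y)) //; apply/trP;
      rewrite nej lexx ?uv //=.
  have -> : v j = u j by apply/eqP; rewrite eq_le uv vu.
  by rewrite set_itv1 Rintegral_set1.
rewrite (eq_bigr _ (fun j _ => int j)) -big_mkcond /=.
pose H s := h (pt b s y); pose p i := coo b (edge_pt b i y).
apply: le_trans (@interval_sum_bound R N n ne u v H (fun i => crosses b i y) p _ _) _.
- move=> i j s t nei nej ij s1 s2 t1 t2.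
  by apply: (triangles_slice_inter ny ij); apply/trP; rewrite ?nei ?nej.
- move=> s [j nej sj].
  have Ks : K (pt b s y) by rewrite (mesh_cover PKT); exists j => //; apply/trP; rewrite nej.
  have [bs|nbs] := pselect (boundary P (pt b s y)).
    have [i cr e] := boundary_edge_pt ny bs.
    by left; exists i => //; rewrite /p -e coo_pt.
  (* Off the boundary curve a point of [K] is interior, so a neighbourhood of it on the line is
     covered by slices. *)
  right; have : interior K (pt b s y).
    apply: contrapT => ni; apply: nbs; rewrite -(mesh_boundary PKT).
    by split => //; exact: subset_closure.
  move=> /pt_cvg; rewrite -[nbhs _ _]/(\forall t \near s, K (pt b t y)).
  move=> /nbhs_ballP[e /= e0 eK]; exists e => // t /andP[t1 t2].
  have : K (pt b t y).
    by apply: eK; rewrite /ball /= ltr_norml; apply/andP; split; lra.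
  by rewrite (mesh_cover PKT) => -[l _ /trP /andP[nel tl]]; exists l.
- apply: ler_sum => i cr; rewrite /H /p.
  by rewrite -[X in pt _ _ X](coo_edge_pt cr) pt_coo.
Qed.

End SliceBound.

(** * Affine changes of variable on the line *)

Section AffineSubstitution.
Variable R : realType.
Notation leb := (@lebesgue_measure R).

Lemma affine_is_derive (m c x : R) : is_derive x 1 (fun t : R => m + t * c) c.
Proof.
have -> : (fun t : R => m + t * c) = (cst m) + (c \*: (@idfun R)).
  by apply/funext => t /=; rewrite [in RHS]fctE /= mulrC.
by apply: is_derive_eq; rewrite /= add0r scaler1.
Qed.

Lemma affine_derive1 (m c : R) : (fun t : R => m + t * c)^`()%classic = cst c.
Proof. by apply/funext => x; rewrite derive1E; have [_ ->] := affine_is_derive m c x. Qed.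

Lemma affine_LRcontinuous (m c a b : R) :
  derivable_oo_LRcontinuous (fun t : R => m + t * c) a b.
Proof.
have cF : continuous (fun t : R => m + t * c).
  by move=> x; apply: cvgD; [exact: cvg_cst|apply: cvgM; [exact: cvg_id|exact: cvg_cst]].
split.
- by move=> x _; have [] := affine_is_derive m c x.
- by apply: cvg_at_right_filter; exact: cF.
- by apply: cvg_at_left_filter; exact: cF.
Qed.

Lemma continuous_affine_comp (G : R -> R) (m c : R) : continuous G ->
  continuous (fun t : R => G (m + t * c)).
Proof.
move=> cG x; apply: (@continuous_comp _ _ _ (fun t : R => m + t * c) G).
  by apply: cvgD; [exact: cvg_cst|apply: cvgM; [exact: cvg_id|exact: cvg_cst]].
exact: cG.
Qed.

Lemma continuous_integrable_itv (G : R -> R) (a b : R) : continuous G ->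
  leb.-integrable `[a, b] (EFin \o G).
Proof.
move=> cG; apply: continuous_compact_integrable; first exact: segment_compact.
exact: continuous_subspaceT.
Qed.

Lemma Rintegral_affine_increasing (G : R -> R) (m c a b : R) :
  continuous G -> 0 < c -> a <= b ->
  \int[leb]_(x in `[m + a * c, m + b * c]) G x =
  c * \int[leb]_(t in `[a, b]) G (m + t * c).
Proof.
move=> cG c0 ab; pose F (t : R) := m + t * c.
rewrite -RintegralZl //; last exact: (continuous_integrable_itv _ _ (continuous_affine_comp cG)).
rewrite /Rintegral; congr fine.
rewrite -/(F a) -/(F b) integration_by_substitution_increasing //.
- by apply: eq_integral => x _; rewrite [in LHS]fctE /= affine_derive1 mulrC.
- by move=> x y _ _ xy; rewrite /F ltrD2l ltr_pM2r.
- by move=> x _; rewrite affine_derive1; exact: cvg_cst.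
- by rewrite affine_derive1; exact: is_cvg_cst.
- by rewrite affine_derive1; exact: is_cvg_cst.
- exact: affine_LRcontinuous.
- exact: continuous_subspaceT.
Qed.

Lemma Rintegral_affine_decreasing (G : R -> R) (m c a b : R) :
  continuous G -> c < 0 -> a <= b ->
  \int[leb]_(x in `[m + b * c, m + a * c]) G x =
  - c * \int[leb]_(t in `[a, b]) G (m + t * c).
Proof.
move=> cG c0 ab; pose F (t : R) := m + t * c.
rewrite -RintegralZl //; last exact: (continuous_integrable_itv _ _ (continuous_affine_comp cG)).
rewrite /Rintegral; congr fine.
rewrite -/(F a) -/(F b) integration_by_substitution_decreasing //.
- apply: eq_integral => x _.
  by rewrite [in LHS]fctE /= [in LHS]fctE /= affine_derive1 mulrC.
- by move=> x y _ _ xy; rewrite /F ltrD2l ltr_nM2r.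
- by move=> x _; rewrite affine_derive1; exact: cvg_cst.
- by rewrite affine_derive1; exact: is_cvg_cst.
- by rewrite affine_derive1; exact: is_cvg_cst.
- exact: affine_LRcontinuous.
- exact: continuous_subspaceT.
Qed.

End AffineSubstitution.

(** * Fubini on slices and the boundary estimate *)

Section PlaneSlices.
Variable R : realType.
Notation leb := (@lebesgue_measure R).
Implicit Types (K : set (R * R)) (f : R * R -> R).

Lemma fubini_slices b (F : R * R -> \bar R) : (leb2 R).-integrable setT F ->
  (\int[leb2 R]_x F x = \int[leb]_y \int[leb]_s F (pt b s y))%E.
Proof.
by move=> iF; case: b; [exact/esym/integral21_prod_meas1|exact/esym/integral12_prod_meas1].
Qed.

Lemma fubini_slices_ge0 b (F : R * R -> \bar R) :
  measurable_fun setT F -> (forall x, 0 <= F x)%E ->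
  (\int[leb2 R]_x F x = \int[leb]_y \int[leb]_s F (pt b s y))%E.
Proof.
move=> mF F0; case: b.
  exact: (@fubini_tonelli2 _ _ _ _ _ (@lebesgue_measure R) (@lebesgue_measure R)).
exact: (@fubini_tonelli1 _ _ _ _ _ (@lebesgue_measure R) (@lebesgue_measure R)).
Qed.

Lemma measurable_fubini_slices b (F : R * R -> \bar R) : (leb2 R).-integrable setT F ->
  measurable_fun setT (fun y => \int[leb]_s F (pt b s y))%E.
Proof.
by move=> iF; case: b; [exact: (measurable_fubini_G (m1 := leb) (m2 := leb) iF)|
  exact: (measurable_fubini_F (m1 := leb) (m2 := leb) iF)].
Qed.

Lemma compact_bounded_fun K f : compact K -> {within K, continuous f} ->
  exists2 M, 0 < M & forall x, K x -> `|f x| <= M.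
Proof.
move=> cK cf; have [K0|K0] := pselect (K !=set0); last first.
  by exists 1 => // x Kx; case: K0; exists x.
have cnf : {within K, continuous (fun x => `|f x|)}.
  move=> x; apply: (@continuous_comp _ _ _ (f : subspace K -> R)); first exact: cf.
  exact: norm_continuous.
have [c _ hc] := compact_EVT_max K0 cK cnf.
exists (`|f c| + 1); first by rewrite ltr_wpDl.
by move=> x Kx; rewrite (le_trans (hc x _)) ?inE // ler_wpDr.
Qed.

Lemma sqint_compact K f : compact K -> {within K, continuous f} -> sqint (leb2 R) K f.
Proof.
move=> cK cf; have [M M0 hM] := compact_bounded_fun cK cf.
have mK := compact_measurable2 cK.
apply: (@sqint_bounded _ _ _ (leb2 R) K f M) => //; first exact: leb2_compact_lty.
exact: within_continuous_measurable2.
Qed.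

Lemma sqint_continuous K f : compact K -> continuous f -> sqint (leb2 R) K f.
Proof. by move=> cK cf; apply: sqint_compact => //; exact: continuous_subspaceT. Qed.

Lemma integrable_continuous2 K f : compact K -> continuous f ->
  (leb2 R).-integrable K (EFin \o f).
Proof.
move=> cK cf; apply: sqint_integrable; first exact: compact_measurable2.
  exact: leb2_compact_lty.
exact: sqint_continuous.
Qed.

Lemma EFin_patch T (D : set T) (h : T -> R) : EFin \o (h \_ D) = (EFin \o h) \_ D.
Proof. by apply/funext => x; rewrite /patch /=; case: ifP. Qed.

Lemma slice_integrable b y K f : compact K -> continuous f ->
  leb.-integrable setT (fun s => ((f \_ K) (pt b s y))%:E).
Proof.
move=> cK cf; have cA := slice_compact (b := b) (y := y) cK.
rewrite (_ : (fun s => _) = (EFin \o (fun s => f (pt b s y))) \_ [set s | K (pt b s y)]).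
  have [+ _] := integrable_mkcond (mu := leb) (EFin \o (fun s => f (pt b s y)))
    (compact_measurable cA).
  apply.
  apply: continuous_compact_integrable => //; apply: continuous_subspaceT => s.
  by apply: continuous_comp; [exact: pt_continuous|exact: cf].
apply/funext => s; rewrite /patch.
rewrite (_ : (pt b s y \in K) = (s \in [set s | K (pt b s y)])); first by case: ifP.
by apply/idP/idP; rewrite !inE.
Qed.

Context n (P : 'I_n -> R * R) K N (T : 'I_N -> 'I_3 -> R * R).
Hypothesis PKT : mesh P K T.

Lemma exceptional_null b : \forall y \ae leb, ~ exceptional P T b y.
Proof.
have cE : countable (exceptional P T b).
  apply: finite_set_countable.
  rewrite (_ : exceptional P T b = ((fun p => coo (~~ b) (T p.1 p.2)) @` setT)
    `|` ((fun i => coo (~~ b) (P i)) @` setT)).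
    by rewrite finite_setU; split; apply: finite_image; exact: finite_finset.
  apply/seteqP; split => y [].
  - by move=> [j [l ->]]; left; exists (j, l).
  - by move=> [i ->]; right; exists i.
  - by move=> [[j l] _ <-]; left; exists j, l.
  - by move=> [i _ <-]; right; exists i.
exists (exceptional P T b); split.
- by apply: countable_measurable => // t; exact: measurable_set1.
- exact: countable_lebesgue_measure0.
- by move=> y /contrapT.
Qed.

Lemma continuous_edge_parameter (p q : R) (H : R -> R) : continuous H ->
  continuous (fun y : R => `|H ((y - p) / (q - p))|).
Proof.
move=> cH; rewrite (_ : (fun y => _) =
    (fun y => `|H (- p / (q - p) + y * (q - p)^-1)|)).
  by apply: (continuous_affine_comp (G := fun t => `|H t|)) => t; exact: cvg_norm (cH t).
by apply/funext => y; congr (`|H _|); rewrite mulrBl addrC mulNr.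
Qed.

Lemma measurable_crossing (p q : R) (H : R -> R) : continuous H ->
  measurable_fun setT (fun y : R =>
    (if (p - y) * (q - y) < 0 then `|H ((y - p) / (q - p))| else 0)%:E).
Proof.
move=> cH; apply/measurable_EFinP; apply: measurable_fun_ifT.
- apply: measurable_fun_ltr; last exact: measurable_cst.
  apply: continuous_measurable_fun => y.
  by apply: cvgM; apply: cvgB; (exact: cvg_cst || exact: cvg_id).
- by apply: continuous_measurable_fun; exact: continuous_edge_parameter.
- exact: measurable_cst.
Qed.

(** Substituting y = p + t (q - p) produces the factor |q - p|, the length of the projected edge;
    [d] will be the length of the edge itself. An edge with [p = q] is never crossed. *)
Lemma edge_integral (p q d : R) (H : R -> R) : continuous H -> `|q - p| <= d ->
  (\int[leb]_y (if (p - y) * (q - y) < 0 then `|H ((y - p) / (q - p))| else 0)%:E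
   <= (d * \int[leb]_(t in `[0, 1]) `|H t|)%:E)%E.
Proof.
move=> cH qpd; have mf := measurable_crossing p q cH.
pose G y := `|H ((y - p) / (q - p))|.
have cG : continuous G by exact: continuous_edge_parameter.
have I0 : 0 <= \int[leb]_(t in `[0, 1]) `|H t| by apply: Rintegral_ge0.
have bound u v : (forall y, (p - y) * (q - y) < 0 -> u <= y <= v) ->
    \int[leb]_(y in `[u, v]) G y = `|q - p| * \int[leb]_(t in `[0, 1]) `|H t| ->
    (\int[leb]_y (if ((p - y) * (q - y) < 0)%R then `|H ((y - p) / (q - p))| else 0%R)%:E
      <= (d * \int[leb]_(t in `[0, 1]) `|H t|)%:E)%E.
  move=> uv IG; have iG := continuous_integrable_itv u v cG.
  apply: (@le_trans _ _ (\int[leb]_(y in `[u, v]) (G y)%:E)%E).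
    rewrite [leRHS]integral_mkcond; apply: ge0_le_integral => //.
    - by move=> y _; rewrite lee_fin; case: ifP.
    - apply/(measurable_restrictT _ _).1 => //.
      by case/integrableP : iG.
    - move=> y _; rewrite /patch; case: ifPn => [/uv uvy|_].
        by rewrite mem_set //= in_itv.
      by case: ifP => // _; rewrite lee_fin /G.
  rewrite -[leLHS]fineK; last exact: integrable_fin_num.
  by rewrite lee_fin -[leLHS]/(Rintegral _ _ _) IG ler_wpM2r.
have Gp t : q - p != 0 -> G (p + t * (q - p)) = `|H t|.
  by move=> nz; rewrite /G addrC addKr mulfK.
have [pq|qp|pq] := ltgtP p q.
- have c0 : 0 < q - p by lra.
  apply: (bound p q) => [y|]; first by move=> h; apply/andP; split; nra.
  have := Rintegral_affine_increasing p cG c0 ler01.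
  rewrite mul0r addr0 mul1r addrC subrK (gtr0_norm c0) => ->.
  by congr (_ * _); apply: eq_Rintegral => t _; rewrite Gp // gt_eqF.
- have c0 : q - p < 0 by lra.
  apply: (bound q p) => [y|]; first by move=> h; apply/andP; split; nra.
  have := Rintegral_affine_decreasing p cG c0 ler01.
  rewrite mul0r addr0 mul1r addrC subrK (ltr0_norm c0) => ->.
  by congr (_ * _); apply: eq_Rintegral => t _; rewrite Gp // lt_eqF.
- rewrite integral0_eq; first by rewrite lee_fin mulr_ge0 // (le_trans _ qpd).
  by move=> y _; rewrite pq -expr2 ltNge sqr_ge0.
Qed.

(** A divergence theorem in the form of an inequality: [slice_bound] is integrated over the
    non-exceptional lines, and each crossed edge contributes at most its own integral of |h| because
    projecting shortens it. *)
Lemma triangle_sum_bound b (g : 'I_N -> R * R -> R) (h : R * R -> R) :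
  (forall j, C1 (g j)) ->
  (forall j x, triangle (T j) x -> h x = g j x) ->
  (forall i, exists2 H : R -> R, continuous H &
    forall t, 0 <= t <= 1 -> h (lin (P i) (P (ordS i)) t) = H t) ->
  `|\sum_j \int[leb2 R]_(x in triangle (T j)) dd b (g j) x| <=
  int_bd P (fun x => `|h x|).
Proof.
move=> cg hg hH; have [H cH hHE] : exists2 H : 'I_n -> R -> R, forall i, continuous (H i) &
    forall i t, 0 <= t <= 1 -> h (lin (P i) (P (ordS i)) t) = H i t.
  have /choice[H hH'] : forall i, exists H : R -> R, continuous H /\
     forall t, 0 <= t <= 1 -> h (lin (P i) (P (ordS i)) t) = H t.
    by move=> i; have [H] := hH i; exists H.
  by exists H => i; have [] := hH' i.
pose Phi x := \sum_j (dd b (g j) \_ (triangle (T j))) x.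
have cT j : compact (triangle (T j)) by exact: triangle_compact (mesh_nondeg PKT j).
have cdd j : continuous (dd b (g j)) by have [_ _] := cg j; exact.
have iPhij j : (leb2 R).-integrable setT (EFin \o (dd b (g j) \_ (triangle (T j)))).
  rewrite EFin_patch; have [+ _] := integrable_mkcond (mu := leb2 R)
    (EFin \o dd b (g j)) (compact_measurable2 (cT j)).
  by apply; exact: integrable_continuous2.
have iPhi : (leb2 R).-integrable setT (EFin \o Phi).
  rewrite (_ : EFin \o Phi = fun x => \sum_j (EFin \o (dd b (g j) \_ (triangle (T j)))) x)%E.
    by apply: integrable_sum => // j _; exact: iPhij.
  by apply/funext => x /=; rewrite sumEFin.
have sPhi y : (\int[leb]_s (EFin \o Phi) (pt b s y) =
   (\sum_j \int[leb]_s (dd b (g j) \_ (triangle (T j))) (pt b s y))%:E)%E.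
  transitivity (\int[leb]_s \sum_j ((dd b (g j) \_ (triangle (T j))) (pt b s y))%:E)%E.
    by apply: eq_integral => s _; rewrite sumEFin.
  rewrite integral_sum //; last by move=> j; exact: slice_integrable.
  rewrite -sumEFin; apply: eq_bigr => j _; rewrite /Rintegral fineK //.
  by apply: integrable_fin_num => //; exact: slice_integrable.
have -> : \sum_j \int[leb2 R]_(x in triangle (T j)) dd b (g j) x =
    fine (\int[leb2 R]_x (EFin \o Phi) x).
  rewrite (_ : \int[_]_x _ = \sum_j \int[leb2 R]_(x in setT)
      (EFin \o (dd b (g j) \_ (triangle (T j)))) x)%E; last first.
    rewrite -integral_sum //.
    by apply: eq_integral => x _ /=; rewrite sumEFin.
  rewrite -sum_fine; last by move=> j _; exact: integrable_fin_num.
  by apply: eq_bigr => j _; rewrite Rintegral_mkcond.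
rewrite -lee_fin -[X in (X <= _)%E]/(`|(fine _)%:E|)%E fineK; last exact: integrable_fin_num.
rewrite (fubini_slices b iPhi).
have mS := measurable_fubini_slices b iPhi.
apply: (le_trans (le_abse_integral leb measurableT mS)).
pose W i y := if crosses P b i y then
  `|H i ((y - coo (~~ b) (P i)) / (coo (~~ b) (P (ordS i)) - coo (~~ b) (P i)))| else 0.
have mW i : measurable_fun setT (fun y => (W i y)%:E).
  exact: measurable_crossing _ _ (cH i).
apply: (@le_trans _ _ (\int[leb]_y \sum_i (W i y)%:E)%E).
  apply: ae_ge0_le_integral => //.
  - exact: measurableT_comp.
  - by move=> y _; rewrite sume_ge0 // => i _; rewrite lee_fin /W; case: ifP.
  - by apply: emeasurable_sum => i; exact: mW.
  - move: (exceptional_null b); apply: filterS; first exact: (ae_filter_ringOfSetsType leb).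
    move=> y ny _.
    rewrite sPhi abse_EFin sumEFin lee_fin.
    apply: le_trans (slice_bound PKT ny cg hg) _.
    rewrite big_mkcond /=; apply: ler_sum => i _; rewrite /W.
    (* The crossing point of a crossed edge has its parameter in [0, 1], where [h] and [H i]
       agree. *)
    case: ifP => // cr; rewrite /edge_pt hHE //; move: cr; rewrite /crosses.
    set p := coo _ _; set q := coo _ _ => cr.
    have [pq|qp|pq] := ltgtP p q; last by move: cr; rewrite pq -expr2 ltNge sqr_ge0.
      by rewrite divr_ge0 ?ler_pdivrMr ?mul1r; nra.
    rewrite -mulrNN -invrN divr_ge0 ?ler_pdivrMr ?mul1r; nra.
rewrite ge0_integral_sum //; last by move=> i y _; rewrite lee_fin /W; case: ifP.
rewrite /int_bd -sumEFin; apply: lee_sum => i _.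
apply: le_trans (edge_integral (d := dist (P i) (P (ordS i))) (cH i) _) _.
  rewrite /dist -sqrtr_sqr ler_wsqrtr // /dotp /=.
  by case: (b) => /=; [rewrite ler_wpDl|rewrite ler_wpDr]; rewrite -?expr2 ?sqr_ge0 //
    -sqrrN opprB.
rewrite /int_seg lee_fin le_eqVlt; apply/orP; left; apply/eqP; congr (_ * _).
apply: eq_Rintegral => t; rewrite inE /= in_itv /= => t01.
by rewrite hHE.
Qed.

End PlaneSlices.

(** * Smooth functions and cut-offs *)

Section SmoothCalculus.
Variable R : realType.
Implicit Types (f g : R * R -> R) (phi psi : R -> R).

Lemma slice_is_derive_conv b f x df :
  is_derive (coo b x) 1 (fun t => f (pt b t (coo (~~ b) x))) df ->
  is_derive x (axis R b) f df.
Proof.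
have E : (fun h : R => h^-1 *: ((f \o shift x) (h *: axis R b) - f x)) =
  (fun h : R => h^-1 *: (((fun t => f (pt b t (coo (~~ b) x))) \o shift (coo b x)) (h *: 1)
     - f (pt b (coo b x) (coo (~~ b) x)))).
  apply/funext => h; rewrite pt_coo /= /axis; congr (_ *: (f _ - _)).
  by case: x => x1 x2; case: b; rewrite /pt /=; congr (_, _); rewrite /= ?scaler0 ?add0r.
by move=> [df1 df2]; split; [rewrite /derivable E|rewrite -df2 /derive E].
Qed.

Lemma Cm_step m f : Cm m.+1 f <-> continuous f /\
  forall b, (forall x, derivable f x (axis R b)) /\ Cm m (dd b f).
Proof.
split => -[cf h]; split; try exact: cf.
  by case: h => h1 h2 h3 h4; case; split; [exact: h1|exact: h3|exact: h2|exact: h4].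
have [h1 h3] := h true; have [h2 h4] := h false.
by split; [exact: h1|exact: h2|exact: h3|exact: h4].
Qed.

Lemma Cm_continuous m f : Cm m f -> continuous f.
Proof. by case: m => [|m] []. Qed.

Lemma CmS m f : Cm m.+1 f -> Cm m f.
Proof.
elim: m f => [|m IH] f; first by move=> [].
move=> /Cm_step[cf h]; apply/Cm_step; split => // b; have [h1 h2] := h b.
by split => //; exact: IH.
Qed.

Lemma Cm_of_derivatives m f (df : bool -> R * R -> R) : continuous f ->
  (forall b x, is_derive x (axis R b) f (df b x)) -> (forall b, Cm m (df b)) ->
  Cm m.+1 f.
Proof.
move=> cf hd hc; apply/Cm_step; split => // b; split => [x|].
  by have [] := hd b x.
by rewrite (_ : dd b f = df b) //; apply/funext => x; have [_] := hd b x.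
Qed.

Lemma ddE b f x df : is_derive x (axis R b) f df -> dd b f x = df.
Proof. by move=> [_]. Qed.

Lemma Cm_derive m f b x : Cm m.+1 f -> is_derive x (axis R b) f (dd b f x).
Proof. by move=> /Cm_step[_ h]; have [h1 _] := h b; split. Qed.

Lemma Cm_cst m (c : R) : Cm m (cst c : R * R -> R).
Proof.
elim: m c => [|m IH] c; first by split => // x; exact: cvg_cst.
apply: (@Cm_of_derivatives m (cst c) (fun _ => cst 0)).
- by move=> x; exact: cvg_cst.
- by move=> _; exact: IH.
Qed.

Lemma CmD m f g : Cm m f -> Cm m g -> Cm m (fun x => f x + g x).
Proof.
elim: m f g => [|m IH] f g.
  by move=> [cf _] [cg _]; split => // x; apply: cvgD; [exact: cf|exact: cg].
move=> Cf Cg; have cf := Cm_continuous Cf; have cg := Cm_continuous Cg.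
apply: (@Cm_of_derivatives m (fun x => f x + g x) (fun b x => dd b f x + dd b g x)).
- by move=> x; apply: cvgD; [exact: cf|exact: cg].
- by move=> b x; apply: is_deriveD; [exact: Cm_derive Cf|exact: Cm_derive Cg].
- move=> b; have /Cm_step[_ /(_ b)[_ h1]] := Cf; have /Cm_step[_ /(_ b)[_ h2]] := Cg.
  exact: IH.
Qed.

Lemma CmM m f g : Cm m f -> Cm m g -> Cm m (fun x => f x * g x).
Proof.
elim: m f g => [|m IH] f g.
  by move=> [cf _] [cg _]; split => // x; apply: cvgM; [exact: cf|exact: cg].
move=> Cf Cg; have cf := Cm_continuous Cf; have cg := Cm_continuous Cg.
apply: (@Cm_of_derivatives m (fun x => f x * g x)
  (fun b x => f x * dd b g x + g x * dd b f x)).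
- by move=> x; apply: cvgM; [exact: cf|exact: cg].
- by move=> b x; apply: is_deriveM; [exact: Cm_derive Cf|exact: Cm_derive Cg].
- move=> b; have /Cm_step[_ /(_ b)[_ h1]] := Cf; have /Cm_step[_ /(_ b)[_ h2]] := Cg.
  by apply: CmD; apply: IH => //; exact: CmS.
Qed.

(** One-variable counterpart of [Cm]. The derivative is an existential witness at each order, so
    closure properties follow by induction from an explicit candidate. *)
Fixpoint Cm1 (m : nat) phi : Prop :=
  if m is m'.+1 then exists2 psi : R -> R, (forall x : R, is_derive x 1 phi (psi x)) & Cm1 m' psi
  else continuous phi.

Lemma is_derive_continuous phi psi : (forall x : R, is_derive x 1 phi (psi x)) ->
  continuous phi.
Proof.
move=> h x; apply: differentiable_continuous.
by apply/derivable1_diffP; have [] := h x.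
Qed.

Lemma Cm1_continuous m phi : Cm1 m phi -> continuous phi.
Proof. by case: m => // m [psi h _]; exact: is_derive_continuous h. Qed.

Lemma Cm1S m phi : Cm1 m.+1 phi -> Cm1 m phi.
Proof.
elim: m phi => [|m IH] phi [psi h1 h2]; first exact: is_derive_continuous h1.
by exists psi => //; exact: IH.
Qed.

Lemma Cm1D m phi psi : Cm1 m phi -> Cm1 m psi -> Cm1 m (fun x => phi x + psi x).
Proof.
elim: m phi psi => [|m IH] phi psi.
  by move=> cf cg x; apply: cvgD; [exact: cf|exact: cg].
move=> [phi' h1 h2] [psi' h3 h4]; exists (fun x => phi' x + psi' x); last exact: IH.
by move=> x; exact: is_deriveD.
Qed.

Lemma Cm1_cst m (c : R) : Cm1 m (cst c).
Proof.
elim: m c => [|m IH] c; first by move=> x; exact: cvg_cst.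
by exists (cst 0) => // x; exact: is_derive_cst.
Qed.

Lemma Cm1M m phi psi : Cm1 m phi -> Cm1 m psi -> Cm1 m (fun x => phi x * psi x).
Proof.
elim: m phi psi => [|m IH] phi psi.
  by move=> cf cg x; apply: cvgM; [exact: cf|exact: cg].
move=> C1 C2; have C1' := Cm1S C1; have C2' := Cm1S C2.
move: C1 C2 => [phi' h1 h2] [psi' h3 h4].
exists (fun x => phi x * psi' x + psi x * phi' x); last first.
  by apply: Cm1D; apply: IH.
by move=> x; exact: is_deriveM.
Qed.

Lemma Cm1_affine m phi (a c : R) : Cm1 m phi -> Cm1 m (fun x => phi (a + x * c)).
Proof.
elim: m phi => [|m IH] phi; first exact: continuous_affine_comp.
move=> [psi h1 h2]; exists (fun x => psi (a + x * c) * c); last first.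
  by apply: Cm1M; [exact: IH|exact: Cm1_cst].
move=> x; apply: (@is_derive1_comp _ phi (fun t => a + t * c)).
exact: affine_is_derive.
Qed.

Lemma continuous_coo b : continuous (fun x : R * R => coo b x).
Proof. by case: b; [exact: continuous_fst2|exact: continuous_snd2]. Qed.

Lemma Cm_coo m b phi : Cm1 m phi -> Cm m (fun x => phi (coo b x)).
Proof.
elim: m phi => [|m IH] phi.
  move=> cphi; split => // x; apply: continuous_comp; first exact: continuous_coo.
  exact: cphi.
move=> C; have cphi := Cm1_continuous C; move: C => [psi h1 h2].
apply: (@Cm_of_derivatives m (fun x => phi (coo b x))
  (fun b' x => if b' == b then psi (coo b x) else 0)).
- by move=> x; apply: continuous_comp; [exact: continuous_coo|exact: cphi].
- move=> b' x; apply: slice_is_derive_conv; case: eqP => [->|/eqP nb].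
    rewrite (_ : (fun t => _) = phi) //.
    by apply/funext => t; rewrite coo_pt.
  rewrite (_ : (fun t => _) = cst (phi (coo b x))); first exact: is_derive_cst.
  apply/funext => t /=; congr phi.
  by case: (b) (b') nb => -[].
- by move=> b'; case: eqP => _; [exact: IH|exact: Cm_cst].
Qed.

Lemma Cm1_id m : Cm1 m (fun x => x).
Proof.
case: m => [|m]; first by move=> x; exact: cvg_id.
by exists (cst 1); [move=> x; exact: is_derive_id|exact: Cm1_cst].
Qed.

Lemma smooth_cst (c : R) : smooth (cst c : R * R -> R).
Proof. by move=> m; exact: Cm_cst. Qed.

Lemma smoothD f g : smooth f -> smooth g -> smooth (fun x => f x + g x).
Proof. by move=> sf sg m; exact: CmD. Qed.

Lemma smoothM f g : smooth f -> smooth g -> smooth (fun x => f x * g x).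
Proof. by move=> sf sg m; exact: CmM. Qed.

Lemma smoothN f : smooth f -> smooth (fun x => - f x).
Proof.
move=> sf; rewrite (_ : (fun x => _) = (fun x => cst (-1) x * f x)).
  by apply: smoothM => //; exact: smooth_cst.
by apply/funext => x; rewrite mulN1r.
Qed.

Lemma smoothB f g : smooth f -> smooth g -> smooth (fun x => f x - g x).
Proof. by move=> sf sg; apply: smoothD => //; exact: smoothN. Qed.

Lemma smoothX f n : smooth f -> smooth (fun x => f x ^+ n).
Proof.
move=> sf; elim: n => [|n IH].
  by rewrite (_ : (fun x => _) = cst 1); [exact: smooth_cst|apply/funext => x; rewrite expr0].
rewrite (_ : (fun x => _) = (fun x => f x * f x ^+ n)); first exact: smoothM.
by apply/funext => x; rewrite exprS.
Qed.

Lemma smooth_sum I (r : seq I) (p : pred I) (F : I -> R * R -> R) :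
  (forall i, p i -> smooth (F i)) -> smooth (fun x => \sum_(i <- r | p i) F i x).
Proof.
move=> sF; elim: r => [|i r IH].
  by rewrite (_ : (fun x => _) = cst 0); [exact: smooth_cst|apply/funext => x; rewrite big_nil].
rewrite (_ : (fun x => _) = (fun x => (if p i then F i x else 0) + \sum_(j <- r | p j) F j x)).
  apply: smoothD => //; have := sF i.
  by case: (p i) => h; [exact: h|exact: smooth_cst].
by apply/funext => x; rewrite big_cons; case: ifP; rewrite // add0r.
Qed.

Lemma smooth_prod I (r : seq I) (F : I -> R * R -> R) :
  (forall i, smooth (F i)) -> smooth (fun x => \prod_(i <- r) F i x).
Proof.
move=> sF; elim: r => [|i r IH].
  by rewrite (_ : (fun x => _) = cst 1); [exact: smooth_cst|apply/funext => x; rewrite big_nil].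
rewrite (_ : (fun x => _) = (fun x => F i x * \prod_(j <- r) F j x)); first exact: smoothM.
by apply/funext => x; rewrite big_cons.
Qed.

Lemma smooth_coo b phi : (forall m, Cm1 m phi) -> smooth (fun x => phi (coo b x)).
Proof. by move=> h m; exact: Cm_coo. Qed.

Lemma smooth_fst : smooth (fun x : R * R => x.1).
Proof. by apply: (@smooth_coo true (fun t => t)) => m; exact: Cm1_id. Qed.

Lemma smooth_snd : smooth (fun x : R * R => x.2).
Proof. by apply: (@smooth_coo false (fun t => t)) => m; exact: Cm1_id. Qed.

Lemma smooth_C1 f : smooth f -> C1 f.
Proof.
move=> sf; have /Cm_step[cf h] := sf 1%N; split => //.
  by move=> b x; have [] := h b.
by move=> b; have [_ []] := h b.
Qed.

Lemma smooth_continuous f : smooth f -> continuous f.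
Proof. by move=> /(_ 0%N)[]. Qed.

Lemma smooth_is_derive b f x : smooth f -> is_derive x (axis R b) f (dd b f x).
Proof. by move=> sf; exact: (Cm_derive _ _ (sf 1%N)). Qed.

Lemma smooth_dd b f : smooth f -> smooth (dd b f).
Proof. by move=> sf m; have /Cm_step[_ /(_ b)[]] := sf m.+1. Qed.

Lemma ddM b f g x : smooth f -> smooth g ->
  dd b (fun y => f y * g y) x = f x * dd b g x + g x * dd b f x.
Proof.
by move=> sf sg; apply: ddE; apply: is_deriveM; exact: smooth_is_derive.
Qed.

Lemma ddB b f g x : smooth f -> smooth g ->
  dd b (fun y => f y - g y) x = dd b f x - dd b g x.
Proof.
by move=> sf sg; apply: ddE; apply: is_deriveB; exact: smooth_is_derive.
Qed.

Lemma smooth_Pol k f : Pol k f -> smooth f.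
Proof.
case: k => [n [c ->]|n ->]; last exact: smooth_cst.
apply: smooth_sum => i _; apply: smooth_sum => j _.
apply: smoothM; last by apply: smoothX; exact: smooth_snd.
by apply: smoothM; [exact: smooth_cst|apply: smoothX; exact: smooth_fst].
Qed.

Lemma smooth_HPol S k f : HPol S k f -> smooth f.
Proof.
case: k => [n [c ->]|n ->]; last exact: smooth_cst.
apply: smooth_sum => i _; apply: smoothM; last first.
  apply: smoothX; apply: smoothB; [exact: smooth_snd|exact: smooth_cst].
apply: smoothM; first exact: smooth_cst.
by apply: smoothX; apply: smoothB; [exact: smooth_fst|exact: smooth_cst].
Qed.

Lemma smooth_bary_coord T j : smooth (@bary_coord R T j).
Proof.
apply: smoothM; last exact: smooth_cst.
rewrite /cross; have s1 := smooth_fst; have s2 := smooth_snd.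
by apply: smoothB; apply: smoothM => /=;
  apply: smoothB => //; exact: smooth_cst.
Qed.

(** A local macro element function is a polynomial, so the formula itself extends it smoothly from
    its triangle to the whole plane. *)
Lemma smooth_VT T r f : VT T r f -> smooth f.
Proof.
move=> [p [q0 [q1 [q2 [sp s0 s1 s2 ->]]]]].
have sb : smooth (bubble T) by apply: smooth_prod => j; exact: smooth_bary_coord.
do ![apply: smoothD|apply: smoothM] => //; by [exact: smooth_Pol sp|
  exact: smooth_HPol s0|exact: smooth_HPol s1|exact: smooth_HPol s2].
Qed.

End SmoothCalculus.

(** * Bump functions *)

Section Bumps.
Variable R : realType.

(* The factors [t^-n] make the family closed under differentiation. *)
Definition flat (n : nat) (t : R) : R :=
  if 0 < t then t^-1 ^+ n * expR (- t^-1) else 0.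

Lemma flat_ge0 n t : 0 <= flat n t.
Proof.
rewrite /flat; case: ifP => // t0; rewrite mulr_ge0 ?expR_ge0 // exprn_ge0 //.
by rewrite invr_ge0 ltW.
Qed.

(** The exponential series gives e^x >= x^(n+1) / (n+1)!, used at x = 1/t. The bound yields
    continuity at 0 for the whole family. *)
Lemma flat_linear_bound n t : `|flat n t| <= n.+1`!%:R * `|t|.
Proof.
rewrite ger0_norm ?flat_ge0 // /flat; case: ltP => [t0|_]; last by rewrite mulr_ge0.
have ti0 : 0 < t^-1 by rewrite invr_gt0.
rewrite (gtr0_norm t0) expRN.
have F0 : 0 < n.+1`!%:R :> R by rewrite ltr0n fact_gt0.
have := expR_ge1Dxn n (ltW ti0) => h.
have {}h : t^-1 ^+ n.+1 / n.+1`!%:R <= expR t^-1 by apply: le_trans h; rewrite ler_wpDl.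
rewrite ler_pdivrMr ?expR_gt0 //.
have -> : t^-1 ^+ n = n.+1`!%:R * t * (t^-1 ^+ n.+1 / n.+1`!%:R).
  rewrite exprS; move: (n.+1`!%:R) F0 (t^-1 ^+ n) => F F0 a.
  by field; rewrite !gt_eqF.
by rewrite ler_wpM2l // mulr_ge0 // ltW.
Qed.

Lemma flat_continuous0 n : {for 0, continuous (flat n)}.
Proof.
have f0 : flat n 0 = 0 by rewrite /flat ltxx.
apply/cvgrPdist_lt => e e0; rewrite f0.
have F0 : 0 < n.+1`!%:R :> R by rewrite ltr0n fact_gt0.
near=> t; rewrite sub0r normrN (le_lt_trans (flat_linear_bound n t)) //.
rewrite mulrC -ltr_pdivlMr //.
near: t; apply/nbhs_ballP; exists (e / n.+1`!%:R) => /=; first exact: divr_gt0.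
by move=> t; rewrite /ball /= sub0r normrN.
Unshelve. all: by end_near. Qed.

Lemma flat_is_derive n (t : R) :
  is_derive t 1 (flat n) (flat n.+2 t - n%:R * flat n.+1 t).
Proof.
have [t0|t0|->] := ltgtP t 0.
- have -> : flat n.+2 t - n%:R * flat n.+1 t = 0.
    by rewrite /flat ltNge (ltW t0) /= mulr0 subr0.
  have d0 : is_derive t 1 (cst 0 : R -> R) 0 by exact: is_derive_cst.
  apply: near_eq_is_derive d0.
  near=> s; rewrite /flat ltNge (_ : s <= 0) //.
  by apply: ltW; near: s; exact: lt_nbhsl.
- have tn : t != 0 by rewrite gt_eqF.
  pose g : R -> R := fun s => s^-1.
  have dg : is_derive t 1 g (- t ^- 2).
    have [di1 di2] := is_derive_id t (1 : R).
    split; first exact: (derivableV tn di1).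
    by rewrite (deriveV tn di1) di2 /GRing.scale /= mulr1.
  have de : is_derive t 1 (fun s => expR (- g s)) (expR (- g t) * t ^- 2).
    apply: (@is_derive1_comp _ expR (fun s => - g s)).
    by rewrite -[t ^- 2]opprK; exact: is_deriveN.
  have dgn : is_derive t 1 (fun s => g s ^+ n) (n%:R * g t ^+ n.-1 * - t ^- 2).
    by have := is_deriveX n dg; rewrite exprfctE.
  have dp : is_derive t 1 (fun s => g s ^+ n * expR (- g s))
      (g t ^+ n * (expR (- g t) * t ^- 2) + expR (- g t) * (n%:R * g t ^+ n.-1 * - t ^- 2)).
    exact: is_deriveM.
  rewrite (_ : _ - _ = g t ^+ n * (expR (- g t) * t ^- 2) +
    expR (- g t) * (n%:R * g t ^+ n.-1 * - t ^- 2)).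
    apply: near_eq_is_derive dp.
    near=> s; have s0 : 0 < s by near: s; exact: lt_nbhsr.
    by rewrite /flat s0.
  rewrite /flat t0 /g -!exprVn; case: n {dgn dp} => [|n].
    by rewrite !mul0r mulr0 subr0 addr0 expr0 mul1r mulrC.
  by rewrite /= !exprS expr0; ring.
(* At 0 the slope function is the next member of the family: [flat n z = flat n.+1 z * z]. *)
apply/is_derive1_caratheodory; exists (flat n.+1); split.
- move=> z; rewrite subr0 {2}/flat ltxx subr0 /flat; case: ltP => [z0|_].
    rewrite exprS; move: (expR _) (z^-1 ^+ n) => E a.
    by field; rewrite gt_eqF.
  by rewrite mul0r.
- exact: flat_continuous0.
- by rewrite /flat ltxx mulr0 subr0.
Unshelve. all: by end_near. Qed.

Lemma Cm1_flat m n : Cm1 m (flat n).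
Proof.
elim: m n => [|m IH] n; first exact: is_derive_continuous (flat_is_derive n).
exists (fun t => flat n.+2 t - n%:R * flat n.+1 t); first exact: flat_is_derive.
rewrite (_ : (fun t => _) = (fun t => flat n.+2 t + cst (- n%:R) t * flat n.+1 t)).
  by apply: Cm1D => //; apply: Cm1M => //; exact: Cm1_cst.
by apply/funext => t; rewrite /= mulNr.
Qed.

(** Positive exactly on the open interval from -1 to 1; the factors [t * -1] and [t * 1] have the
    form expected by [Cm1_affine]. *)
Definition bump (t : R) := flat 0 (1 + t * -1) * flat 0 (1 + t * 1).

Lemma Cm1_bump m : Cm1 m bump.
Proof. by apply: Cm1M; apply: Cm1_affine; exact: Cm1_flat. Qed.

Lemma bump_ge0 t : 0 <= bump t.
Proof. by rewrite mulr_ge0 ?flat_ge0. Qed.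

Lemma flat0_le1 t : flat 0 t <= 1.
Proof.
rewrite /flat; case: ifP => // t0; rewrite expr0 mul1r -expR0 ler_expR oppr_le0.
by rewrite invr_ge0 ltW.
Qed.

Lemma bump_le1 t : bump t <= 1.
Proof. by rewrite -[leRHS]mulr1 ler_pM ?flat_ge0 ?flat0_le1. Qed.

Lemma bump_eq0 t : 1 <= `|t| -> bump t = 0.
Proof.
rewrite ler_normr => /orP[] h; rewrite /bump /flat.
  by rewrite ltNge (_ : _ <= 0) ?mul0r //; lra.
by rewrite (ltNge 0 (1 + t * 1)) (_ : 1 + t * 1 <= 0) ?mulr0 //; lra.
Qed.

Lemma bump_gt0 t : `|t| < 1 -> 0 < bump t.
Proof.
rewrite ltr_norml => /andP[h1 h2]; rewrite /bump /flat.
rewrite (_ : 0 < 1 + t * -1); last by lra.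
rewrite (_ : 0 < 1 + t * 1); last by lra.
by rewrite !expr0 !mul1r mulr_gt0 // expR_gt0.
Qed.

Lemma bump_continuous : continuous bump.
Proof. exact: (Cm1_bump 0). Qed.

Definition bump2 (c : R * R) (r : R) (x : R * R) : R :=
  bump ((x.1 - c.1) / r) * bump ((x.2 - c.2) / r).

Definition square (c : R * R) (r : R) : set (R * R) :=
  [set x | `|x.1 - c.1| <= r /\ `|x.2 - c.2| <= r].

Lemma closed_square c r : closed (square c r).
Proof.
have cl b : closed [set x : R * R | `|coo b x - coo b c| <= r].
  apply: (preimage_closed (f := fun x : R * R => `|coo b x - coo b c|)
    (D := [set t | t <= r])); last exact: closed_le.
  move=> x _; apply: cvg_norm; apply: cvgB; last exact: cvg_cst.
  exact: continuous_coo.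
by have := closedI (cl true) (cl false).
Qed.

Lemma smooth_bump2 c r : smooth (bump2 c r).
Proof.
have sb b : smooth (fun x : R * R => bump ((coo b x - coo b c) / r)).
  apply: (@smooth_coo R b (fun t => bump ((t - coo b c) / r))) => m.
  rewrite (_ : (fun t => _) = (fun t => bump (- coo b c / r + t * r^-1))).
    exact/Cm1_affine/Cm1_bump.
  by apply/funext => t; rewrite mulrBl addrC mulNr.
by have := smoothM (sb true) (sb false).
Qed.

Lemma bump2_ge0 c r x : 0 <= bump2 c r x.
Proof. by rewrite mulr_ge0 ?bump_ge0. Qed.

Lemma bump2_le1 c r x : bump2 c r x <= 1.
Proof. by rewrite -[leRHS]mulr1 ler_pM ?bump_ge0 ?bump_le1. Qed.

Lemma bump2_neq0 c r x : 0 < r -> bump2 c r x != 0 -> square c r x.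
Proof.
move=> r0; rewrite /bump2 mulf_eq0 negb_or => /andP[h1 h2].
have le t : bump (t / r) != 0 -> `|t| <= r.
  move=> h; rewrite leNgt; apply/negP => rt; case/eqP: h; apply: bump_eq0.
  by rewrite normrM normfV (gtr0_norm r0) ler_pdivlMr // mul1r ltW.
by split; exact: le.
Qed.

Lemma bump2_gt0 c r x : ball c r x -> 0 < bump2 c r x.
Proof.
move=> [h1 h2].
have lt (s t : R) : ball s r t -> 0 < bump ((t - s) / r).
  rewrite /ball /= distrC => h.
  have r0 : 0 < r by exact: le_lt_trans h.
  by apply: bump_gt0; rewrite normrM normfV (gtr0_norm r0) ltr_pdivrMr // mul1r.
by apply: mulr_gt0; apply: lt.
Qed.

End Bumps.

(** * Null sets and additivity of the integral over the triangles *)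

Section NullSets.
Variable R : realType.
Notation leb := (@lebesgue_measure R).

Lemma slices_null b (S : set (R * R)) : compact S ->
  (\forall y \ae leb, countable [set s | S (pt b s y)]) -> leb2 R S = 0%E.
Proof.
move=> cS aeS; have mS := compact_measurable2 cS.
pose F x : \bar R := (\1_S x)%:E.
have iF : (leb2 R).-integrable setT F.
  have [+ _] := integrable_mkcond (mu := leb2 R) (EFin \o cst 1) mS.
  rewrite (_ : _ \_ S = F); last first.
    by apply/funext => x; rewrite /F /patch indicE; case: ifP.
  by apply; apply: integrable_continuous2 => // x; exact: cvg_cst.
rewrite -[LHS]/(leb2 R S) -[X in leb2 R X]setIT -integral_indic //.
rewrite (fubini_slices b iF).
rewrite (ae_eq_integral (cst 0%E)) ?integral0 //; first exact: measurable_fubini_slices.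
move: aeS; apply: filterS; first exact: (ae_filter_ringOfSetsType leb).
move=> y cy _ /=; transitivity (\int[leb]_s (\1_[set s | S (pt b s y)] s)%:E)%E.
  apply: eq_integral => s _; rewrite /F !indicE.
  by congr ((_ : bool)%:R%:E); apply/idP/idP; rewrite !inE.
rewrite integral_indic //; first by rewrite setIT; exact: countable_lebesgue_measure0.
by apply: countable_measurable => // t; exact: measurable_set1.
Qed.

Context n (P : 'I_n -> R * R) (K : set (R * R)) N (T : 'I_N -> 'I_3 -> R * R).
Hypothesis PKT : mesh P K T.

Let cK := mesh_compact PKT.
Let mK := compact_measurable2 cK.

Lemma mesh_triangle_compact j : compact (triangle (T j)).
Proof. exact: triangle_compact (mesh_nondeg PKT j). Qed.

Lemma mesh_triangle_measurable j : measurable (triangle (T j)).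
Proof. by apply: compact_measurable2; exact: mesh_triangle_compact. Qed.

Lemma mesh_triangle_sub j : triangle (T j) `<=` K.
Proof. by rewrite (mesh_cover PKT) => x Tx; exists j. Qed.

(** A non-exceptional line meets the boundary only at points [edge_pt], of which there are at most
    [n]. *)
Lemma boundary_null : leb2 R (K `\` interior K) = 0%E.
Proof.
have cc : compact (K `\` interior K).
  apply: (subclosed_compact _ cK) => [|x []//].
  rewrite setDE; apply: closedI; first exact: compact_closed2.
  by apply: open_closedC; exact: open_interior.
apply: (@slices_null true) => //.
move: (exceptional_null P T true); apply: filterS.
  exact: (ae_filter_ringOfSetsType leb).
move=> y ny; apply: finite_set_countable.
apply: (@sub_finite_set _ _ ((fun i => coo true (edge_pt P true i y)) @` setT)).
  move=> s [Ks iKs]; have : boundary P (pt true s y).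
    by rewrite -(mesh_boundary PKT); split => //; exact: subset_closure.
  by move=> /(boundary_edge_pt ny)[i _ e]; exists i; rewrite // -e.
by apply: finite_image; exact: finite_finset.
Qed.

Lemma overlap_null i j : i != j -> leb2 R (triangle (T i) `&` triangle (T j)) = 0%E.
Proof.
move=> ij; apply: (@slices_null true).
  have cTi : compact (triangle (T i)) by exact: mesh_triangle_compact.
  apply: (subclosed_compact _ cTi) => [|x []//].
  by apply: closedI; apply: compact_closed2; exact: mesh_triangle_compact.
move: (exceptional_null P T true); apply: filterS.
  exact: (ae_filter_ringOfSetsType leb).
move=> y ny; apply: finite_set_countable.
have [[s [si sj]]|ns] := pselect (exists s, (triangle (T i) `&` triangle (T j)) (pt true s y)).
  apply: (@sub_finite_set _ _ [set s]); last exact: finite_set1.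
  by move=> t [ti tj]; rewrite /= (triangles_slice_inter PKT ny ij ti tj si sj).
rewrite (_ : [set s | _] = set0); first exact: finite_set0.
by apply/seteqP; split => // s sS; case: ns; exists s.
Qed.

Lemma ae_no_overlap : \forall x \ae leb2 R, forall i j, i != j ->
  ~ (triangle (T i) x /\ triangle (T j) x).
Proof.
apply: filter_forall => i; apply: filter_forall => j.
have [ij|ij] := boolP (i != j); last first.
  by apply: aeW.
exists (triangle (T i) `&` triangle (T j)); split.
- by apply: measurableI; exact: mesh_triangle_measurable.
- exact: overlap_null.
- by move=> x /= h; apply: contrapT => nx; apply: h => _.
Qed.

Lemma mesh_integral_sum (f : R * R -> R) : (leb2 R).-integrable K (EFin \o f) ->
  \int[leb2 R]_(x in K) f x = \sum_j \int[leb2 R]_(x in triangle (T j)) f x.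
Proof.
move=> fK.
have fT j : (leb2 R).-integrable (triangle (T j)) (EFin \o f).
  by apply: integrableS fK => //; [exact: mesh_triangle_measurable|exact: mesh_triangle_sub].
have fT' j : (leb2 R).-integrable setT ((EFin \o f) \_ (triangle (T j))).
  have [+ _] := integrable_mkcond (mu := leb2 R) (EFin \o f) (mesh_triangle_measurable j).
  exact.
rewrite /Rintegral sum_fine; last first.
  by move=> j _; apply: integrable_fin_num => //; exact: mesh_triangle_measurable.
congr fine; rewrite integral_mkcond.
transitivity (\int[leb2 R]_x \sum_j ((EFin \o f) \_ (triangle (T j))) x)%E; last first.
  by rewrite integral_sum //; apply: eq_bigr => j _; rewrite [in RHS]integral_mkcond.
apply: ae_eq_integral => //.
- have [+ _] := integrable_mkcond (mu := leb2 R) (EFin \o f) mK.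
  by move=> /(_ fK) /integrableP[].
- by apply: emeasurable_sum => j; have /integrableP[] := fT' j.
move: ae_no_overlap; apply: filterS; first exact: (ae_filter_ringOfSetsType (leb2 R)).
move=> x nx _; rewrite /patch; case: ifPn => [|/negP xK].
  rewrite inE (mesh_cover PKT) => -[i _ Ti].
  rewrite (bigD1 i) //= mem_set // big1 ?adde0 // => j ji.
  by case: ifPn => //; rewrite inE => Tj; case: (nx j i ji).
rewrite big1 // => j _; case: ifPn => //; rewrite inE => Tj.
by case: xK; rewrite inE; exact: mesh_triangle_sub Tj.
Qed.

End NullSets.

(** * Cut-off functions of an open set *)

Section Cutoff.
Variable R : realType.
Implicit Types (U K : set (R * R)).

Definition center (q : rat * rat * rat) : R * R := (ratr q.1.1, ratr q.1.2).

Definition inner_square U (q : rat * rat * rat) : bool :=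
  `[< 0 < q.2 /\ square (center q) (ratr q.2) `<=` U >].

(** An enumeration, through [unpickle], of the bumps on the rational closed squares contained in
    [U]; all other codes give the zero function. *)
Definition cut_bump U (l : nat) : R * R -> R :=
  if (unpickle l : option (rat * rat * rat)) is Some q then
    if inner_square U q then bump2 (center q) (ratr q.2) else cst 0
  else cst 0.

Definition cut_square U (l : nat) : set (R * R) :=
  if (unpickle l : option (rat * rat * rat)) is Some q then
    if inner_square U q then square (center q) (ratr q.2) else set0
  else set0.

(* As [N] grows, this tends to [1] on [U], the sets where the bumps are positive
   covering [U]. *)
Definition cutoff U (N : nat) (x : R * R) : R :=
  1 - \prod_(l < N) (1 - cut_bump U l x) ^+ N.

Lemma smooth_cut_bump U l : smooth (cut_bump U l).
Proof.
rewrite /cut_bump; case: unpickle => [q|]; last exact: smooth_cst.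
by case: ifP => _; [exact: smooth_bump2|exact: smooth_cst].
Qed.

Lemma cut_bump_ge0 U l x : 0 <= cut_bump U l x.
Proof.
rewrite /cut_bump; case: unpickle => [q|] //.
by case: ifP => _ //; exact: bump2_ge0.
Qed.

Lemma cut_bump_le1 U l x : cut_bump U l x <= 1.
Proof.
rewrite /cut_bump; case: unpickle => [q|] //=.
by case: ifP => _ //=; exact: bump2_le1.
Qed.

Lemma smooth_cutoff U N : smooth (cutoff U N).
Proof.
apply: smoothB; first exact: smooth_cst.
apply: smooth_prod => l; apply: smoothX; apply: smoothB; first exact: smooth_cst.
exact: smooth_cut_bump.
Qed.

Lemma cutoff_prod_itv U N x :
  0 <= \prod_(l < N) (1 - cut_bump U l x) ^+ N <= 1.
Proof.
have h l : 0 <= (1 - cut_bump U l x) ^+ N <= 1.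
  have h0 : 0 <= 1 - cut_bump U l x by rewrite subr_ge0 cut_bump_le1.
  rewrite exprn_ge0 // exprn_ile1 //.
  by rewrite lerBlDr lerDl cut_bump_ge0.
apply/andP; split; first by apply: prodr_ge0 => l _; case/andP: (h l).
by apply: prodr_ile1 => l _; exact: h.
Qed.

Lemma cutoff_ge0 U N x : 0 <= cutoff U N x.
Proof. by have /andP[_] := cutoff_prod_itv U N x; rewrite subr_ge0. Qed.

Lemma cutoff_le1 U N x : cutoff U N x <= 1.
Proof. by have /andP[h _] := cutoff_prod_itv U N x; rewrite lerBlDr lerDl. Qed.

(** Some bump is positive at [x]. Once [N] exceeds its index, the product contains the factor
    [z ^+ N] with [0 <= z < 1], and all other factors lie in [0, 1]. *)
Lemma cutoff_cvg U x : open U -> U x -> cutoff U N x @[N --> \oo] --> (1 : R).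
Proof.
move=> oU Ux; have [q [q0 qx qU]] := qball_inside oU Ux.
have sq : square (center q) (ratr q.2) `<=` U.
  apply: subset_trans qU => y [y1 y2]; rewrite /qball /=.
  have r0 : 0 < (ratr q.2 : R) by rewrite ltr0q.
  by split; rewrite /ball /= rmorphMn /= distrC; [move: y1|move: y2] => h;
    apply: le_lt_trans h _; lra.
have aq : inner_square U q by apply/asboolP.
pose z := 1 - cut_bump U (pickle q) x.
have bz : 0 <= z < 1.
  rewrite /z subr_ge0 cut_bump_le1 ltrBlDr ltrDl /cut_bump pickleK aq.
  exact: bump2_gt0.
have [z0 z1] := andP bz.
have zN : (GRing.exp z : nat -> R) N @[N --> \oo] --> (0 : R).
  by apply: cvg_expr; rewrite ger0_norm.
rewrite -[X in _ --> X]subr0; apply: cvgB; first exact: cvg_cst.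
apply: (@squeeze_cvgr _ _ _ _ (cst 0) (GRing.exp z)) => //; last exact: cvg_cst.
near=> N; have lN : (pickle q < N)%N by near: N; exact: nbhs_infty_gt.
have [p0 _] := andP (cutoff_prod_itv U N x); rewrite p0 /=.
rewrite (bigD1 (Ordinal lN)) //= ler_piMr ?exprn_ge0 //.
apply: prodr_ile1 => l _.
have h0 : 0 <= 1 - cut_bump U l x by rewrite subr_ge0 cut_bump_le1.
by rewrite exprn_ge0 // exprn_ile1 // lerBlDr lerDl cut_bump_ge0.
Unshelve. all: by end_near. Qed.

Lemma closed_cut_square U l : closed (cut_square U l).
Proof.
rewrite /cut_square; case: unpickle => [q|]; last exact: closed0.
by case: ifP => _; [exact: closed_square|exact: closed0].
Qed.

Lemma cut_square_sub U l : cut_square U l `<=` U.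
Proof.
rewrite /cut_square; case: unpickle => [q|]; last exact: sub0set.
by case: ifP => [/asboolP[]|_] //; exact: sub0set.
Qed.

(** Only [N] bumps occur, so the support lies in a finite, hence closed, union of closed squares
    inside [U]. *)
Lemma cutoff_support U N :
  closure [set x | cutoff U N x != 0] `<=` U.
Proof.
pose S := \big[setU/set0]_(l < N) cut_square U l.
have cS : closed S by apply: closed_bigsetU => l _; exact: closed_cut_square.
have SU : S `<=` U.
  by rewrite /S -bigcup_mkord => x [l _ /cut_square_sub].
apply: subset_trans SU; rewrite [X in _ `<=` X]((closure_id S).1 cS); apply: closure_subset => x.
apply: contraPP => nS /eqP; apply; rewrite /cutoff big1 ?subrr // => l _.
have -> : cut_bump U l x = 0; last by rewrite subr0 expr1n.
apply/eqP/negPn/negP => h; apply: nS; rewrite /S -bigcup_mkord; exists l => //=.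
move: h; rewrite /cut_bump /cut_square; case: unpickle => [q|]; rewrite ?eqxx //.
case: ifP => [/asboolP[q0 _]|_]; rewrite ?eqxx //.
by apply: bump2_neq0; rewrite ltr0q.
Qed.

Lemma test_cutoff K N (b : R * R -> R) : smooth b ->
  test K (fun x => cutoff (interior K) N x * b x).
Proof.
move=> sb; split; first by apply: smoothM => //; exact: smooth_cutoff.
apply: subset_trans (@cutoff_support (interior K) N); apply: closure_subset => x /=.
by rewrite mulf_eq0 negb_or => /andP[].
Qed.

(** The products of [b] with the cut-offs are test functions. They tend to [b] on the interior,
    hence almost everywhere on [K], and stay below |b|, so dominated convergence applies. *)
Lemma test_orthogonal K (d b : R * R -> R) : compact K ->
  leb2 R (K `\` interior K) = 0%E -> sqint (leb2 R) K d ->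
  (forall f, test K f -> \int[leb2 R]_(x in K) (d x * f x) = 0) ->
  smooth b -> \int[leb2 R]_(x in K) (d x * b x) = 0.
Proof.
move=> cK nK sd dt sb; have mK := compact_measurable2 cK.
have mb : measurable_fun K b by apply: continuous_measurable2 => //; exact: smooth_continuous.
have md : measurable_fun K d by case: sd.
pose f_ N x := (d x * (cutoff (interior K) N x * b x))%:E.
have idb : (leb2 R).-integrable K (EFin \o (fun x => d x * b x)).
  apply: integrable_mul => //; apply: sqint_continuous => //; exact: smooth_continuous.
have [] := @dominated_convergence _ _ _ (leb2 R) K mK f_
  (fun x => (d x * b x)%:E) (abse \o (EFin \o (fun x => d x * b x))).
- move=> N; apply/measurable_EFinP; apply: measurable_funM => //.
  apply: measurable_funM => //; apply: continuous_measurable2 => //.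
  by apply: smooth_continuous; exact: smooth_cutoff.
- by apply/measurable_EFinP; exact: measurable_funM.
- exists (K `\` interior K); split => //.
    apply: measurableD => //; apply: open_measurable2; exact: open_interior.
  move=> x /= h; have [Kx|nKx] := pselect (K x); last by case: h.
  split => // iKx; apply: h => _; apply: cvg_EFin; first by apply: nearW.
  rewrite [X in _ --> X](_ : _ = d x * (1 * b x)); last by rewrite mul1r.
  apply: cvgM; first exact: cvg_cst.
  apply: cvgM; last exact: cvg_cst.
  by apply: cutoff_cvg => //; exact: open_interior.
- by apply: integrable_abse.
- apply: aeW => x N _; rewrite /f_ /= lee_fin !normrM ler_wpM2l //.
  rewrite ler_piMl // ger0_norm ?cutoff_ge0 //; exact: cutoff_le1.
move=> _ _; rewrite (_ : [sequence _]_n = cst 0%E); last first.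
  apply/funext => N /=; have := dt _ (test_cutoff K N sb).
  rewrite /Rintegral => h; rewrite -[LHS]fineK ?h //.
  apply: integrable_fin_num => //; apply: integrable_mul => //.
  apply: sqint_continuous => //; apply: smooth_continuous.
  by apply: smoothM => //; exact: smooth_cutoff.
by move=> /(cvg_unique (@ereal_hausdorff R) (cvg_cst 0%E)) h; rewrite /Rintegral -h.
Qed.

End Cutoff.

(** * Gradients of the interpolation error *)

Section WeakDerivative.
Variable R : realType.
Notation leb := (@lebesgue_measure R).

Lemma Rintegral_sum d (X : measurableType d) (mu : {measure set X -> \bar R})
    (D : set X) I (r : seq I) (f : I -> X -> R) : measurable D ->
  (forall i, mu.-integrable D (EFin \o f i)) ->
  \int[mu]_(x in D) (\sum_(i <- r) f i x) = \sum_(i <- r) \int[mu]_(x in D) f i x.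
Proof.
move=> mD fi; rewrite /Rintegral sum_fine; last first.
  by move=> i _; apply: integrable_fin_num => //; exact: fi.
rewrite -integral_sum //; congr fine; apply: eq_integral => x _.
by rewrite sumEFin.
Qed.

Lemma sqint_sum d (X : measurableType d) (mu : {measure set X -> \bar R})
    (D : set X) I (r : seq I) (f : I -> X -> R) : measurable D ->
  (forall i, sqint mu D (f i)) -> sqint mu D (fun x => \sum_(i <- r) f i x).
Proof.
move=> mD sf; elim: r => [|i r IH].
  rewrite (_ : (fun x => _) = cst 0); last by apply/funext => x; rewrite big_nil.
  split; first exact: measurable_cst.
  rewrite (_ : EFin \o _ = cst 0%E); first exact: integrable0.
  by apply/funext => x /=; rewrite expr0n.
apply: eq_sqint (sqintD mD (sf i) IH) => // x _.
by rewrite big_cons.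
Qed.

Context n (P : 'I_n -> R * R) (K : set (R * R)) N (T : 'I_N -> 'I_3 -> R * R).
Hypothesis PKT : mesh P K T.
Let cK := mesh_compact PKT.
Let mK := compact_measurable2 cK.

(** [H] is continuous on the whole line because the substitution lemmas ask for it; for the virtual
    functions it will be the edge polynomial. *)
Definition edge_continuous (h : R * R -> R) := forall i, exists2 H : R -> R,
  continuous H & forall t, 0 <= t <= 1 -> h (lin (P i) (P (ordS i)) t) = H t.

Lemma edge_continuousM h h' : edge_continuous h -> edge_continuous h' ->
  edge_continuous (fun x => h x * h' x).
Proof.
move=> e e' i; have [H cH hH] := e i; have [H' cH' hH'] := e' i.
exists (fun t => H t * H' t).
  by move=> t; apply: cvgM; [exact: cH|exact: cH'].
by move=> t t01; rewrite hH // hH'.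
Qed.

Lemma edge_continuousB h h' : edge_continuous h -> edge_continuous h' ->
  edge_continuous (fun x => h x - h' x).
Proof.
move=> e e' i; have [H cH hH] := e i; have [H' cH' hH'] := e' i.
exists (fun t => H t - H' t).
  by move=> t; apply: cvgB; [exact: cH|exact: cH'].
by move=> t t01; rewrite hH // hH'.
Qed.

Lemma continuous_lin (p q : R * R) : continuous (lin p q).
Proof.
move=> t; rewrite /lin.
have c (u v : R) : u + s * v @[s --> t] --> u + t * v.
  by apply: cvgD; [exact: cvg_cst|apply: cvgM; [exact: cvg_id|exact: cvg_cst]].
exact: (@cvg_pair _ _ _ (nbhs t) (nbhs (p.1 + t * (q.1 - p.1)))
  (nbhs (p.2 + t * (q.2 - p.2)))).
Qed.

Lemma continuous_edge_continuous h : continuous h -> edge_continuous h.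
Proof.
move=> ch i; exists (fun t => h (lin (P i) (P (ordS i)) t)) => //.
by move=> t; apply: continuous_comp; [exact: continuous_lin|exact: ch].
Qed.

Lemma edge_sqint h i : edge_continuous h ->
  sqint leb `[0, 1] (fun t => h (lin (P i) (P (ordS i)) t)).
Proof.
move=> /(_ i)[H cH hH]; have m01 : measurable (`[0, 1]%classic : set (measurableTypeR R)) by [].
apply: (@eq_sqint _ _ _ leb _ H) => //.
  by move=> t; rewrite inE /= in_itv /= => /hH ->.
split; first by apply: measurable_funTS; exact: continuous_measurable_fun.
rewrite (_ : EFin \o _ = EFin \o (fun t => H t * H t)).
  by apply: continuous_integrable_itv => t; apply: cvgM; exact: cH.
by apply/funext => t; rewrite /= expr2.
Qed.

Lemma young_int_bd (f g : R * R -> R) (t : R) : 0 < t ->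
  edge_continuous f -> edge_continuous g ->
  int_bd P (fun x => `|f x * g x|) <=
  t * int_bd P (fun x => f x ^+ 2) + t^-1 * int_bd P (fun x => g x ^+ 2).
Proof.
move=> t0 ef eg; rewrite /int_bd !mulr_sumr -big_split /=; apply: ler_sum => i _.
rewrite /int_seg !(mulrCA _ (dist _ _)) -mulrDr.
apply: ler_wpM2l; first exact: sqrtr_ge0.
have m01 : measurable (`[0, 1]%classic : set (measurableTypeR R)) by [].
have nf h : edge_continuous h -> edge_continuous (fun x => `|h x|).
  move=> eh j; have [H cH hH] := eh j; exists (fun s => `|H s|).
    by move=> s; apply: cvg_norm; exact: cH.
  by move=> s s01; rewrite hH.
have := young_Rintegral m01 t0 (edge_sqint i (nf _ ef))
  (edge_sqint i (nf _ eg)).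
under eq_Rintegral do rewrite -normrM.
under [X in _ <= _ * X + _]eq_Rintegral do rewrite real_normK ?num_real //.
under [X in _ <= _ + _ * X]eq_Rintegral do rewrite real_normK ?num_real //.
by apply: le_trans; exact: ler_norm.
Qed.

Section Piecewise.
Variables (Iv : R * R -> R) (g : 'I_N -> R * R -> R).
Hypothesis cIv : {within K, continuous Iv}.
Hypothesis sg : forall j, smooth (g j).
Hypothesis Ivg : forall j x, triangle (T j) x -> Iv x = g j x.
Hypothesis eIv : edge_continuous Iv.

(** The derivative taken triangle by triangle. Where triangles overlap the values are added, which
    matters only on a null set. *)
Definition pgrad b x := \sum_j (dd b (g j) \_ (triangle (T j))) x.

Let cT j : compact (triangle (T j)).
Proof. exact: (mesh_triangle_compact PKT). Qed.
Let mT j : measurable (triangle (T j)).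
Proof. by apply: compact_measurable2; exact: cT. Qed.
Let TK j : triangle (T j) `<=` K.
Proof. exact: (mesh_triangle_sub PKT). Qed.

Lemma sqint_piece b j : sqint (leb2 R) K (dd b (g j) \_ (triangle (T j))).
Proof.
have cd : continuous (dd b (g j)) by have [_ _] := smooth_C1 (sg j); exact.
have [M M0 hM] : exists2 M, 0 < M &
    forall x, triangle (T j) x -> `|dd b (g j) x| <= M.
  by apply: compact_bounded_fun; [exact: cT|exact: continuous_subspaceT].
apply: (@sqint_bounded _ _ _ (leb2 R) K _ M) => //.
- exact: leb2_compact_lty.
- apply: measurable_funTS; apply: (measurable_restrictT _ _).1; first exact: mT.
  by apply: continuous_measurable2 => //; exact: mT.
- move=> x _; rewrite /patch; case: ifPn => [|_]; first by rewrite inE => /hM.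
  by rewrite normr0 ltW.
Qed.

Lemma sqint_pgrad b : sqint (leb2 R) K (pgrad b).
Proof. by apply: sqint_sum => // j; exact: sqint_piece. Qed.

Lemma pgrad_integral b phi : continuous phi ->
  \int[leb2 R]_(x in K) (pgrad b x * phi x) =
  \sum_j \int[leb2 R]_(x in triangle (T j)) (dd b (g j) x * phi x).
Proof.
move=> cphi; rewrite /pgrad.
under eq_Rintegral do rewrite mulr_suml.
rewrite Rintegral_sum //; last first.
  move=> j; apply: integrable_mul => //; first exact: sqint_piece.
  exact: sqint_continuous.
apply: eq_bigr => j _.
transitivity (\int[leb2 R]_(x in K) (((fun x => dd b (g j) x * phi x) \_ (triangle (T j))) x)).
  apply: eq_Rintegral => x _; rewrite /patch; case: ifP => // _.
  by rewrite mul0r.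
by rewrite -Rintegral_mkcondr setIidr.
Qed.

(** By the product rule the left side is the sum over the triangles of the integrals of the
    derivative of (g j - u) phi, to which [triangle_sum_bound] applies. A smooth [u] stands in for
    [v], which has only a weak gradient. *)
Lemma green_error b u phi : smooth u -> smooth phi ->
  `|\int[leb2 R]_(x in K) ((pgrad b x - dd b u x) * phi x) +
    \int[leb2 R]_(x in K) ((Iv x - u x) * dd b phi x)| <=
  int_bd P (fun x => `|(Iv x - u x) * phi x|).
Proof.
move=> su sphi.
have cu := smooth_continuous su; have cphi := smooth_continuous sphi.
have cdu : continuous (dd b u) by apply: smooth_continuous; exact: smooth_dd.
have cdphi : continuous (dd b phi) by apply: smooth_continuous; exact: smooth_dd.
have cg j : continuous (g j) by exact: smooth_continuous.
have cdg j : continuous (dd b (g j)) by apply: smooth_continuous; apply: smooth_dd.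
have iM S (f h : R * R -> R) : compact S -> continuous f -> continuous h ->
    (leb2 R).-integrable S (EFin \o (fun x => f x * h x)).
  move=> cS cf ch; apply: integrable_continuous2 => // x.
  by apply: cvgM; [exact: cf|exact: ch].
have iT j (f h : R * R -> R) : continuous f -> continuous h ->
    (leb2 R).-integrable (triangle (T j)) (EFin \o (fun x => f x * h x)).
  by move=> cf ch; apply: iM => //; exact: cT.
have -> : \int[leb2 R]_(x in K) ((pgrad b x - dd b u x) * phi x) +
    \int[leb2 R]_(x in K) ((Iv x - u x) * dd b phi x) =
    \sum_j \int[leb2 R]_(x in triangle (T j)) dd b (fun y => (g j y - u y) * phi y) x.
  under eq_Rintegral do rewrite mulrBl.
  rewrite RintegralB //; [|by apply: integrable_mul => //; [exact: sqint_pgrad|exact: sqint_continuous]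
    |exact: iM].
  rewrite pgrad_integral // (mesh_integral_sum PKT (iM _ _ _ cK cdu cphi)).
  rewrite (@mesh_integral_sum _ _ _ _ _ _ PKT (fun x => (Iv x - u x) * dd b phi x)); last first.
    apply: integrable_mul => //; last exact: sqint_continuous.
    by apply: sqintB => //; [exact: sqint_compact|exact: sqint_continuous].
  rewrite -sumrB -big_split /=; apply: eq_bigr => j _.
  have -> : \int[leb2 R]_(x in triangle (T j)) ((Iv x - u x) * dd b phi x) =
      \int[leb2 R]_(x in triangle (T j)) ((g j x - u x) * dd b phi x).
    by apply: eq_Rintegral => x; rewrite inE => /Ivg ->.
  have cgu : continuous (fun x => g j x - u x).
    by move=> x; apply: cvgB; [exact: cg|exact: cu].
  rewrite -RintegralB; [|exact: mT|exact: iT|exact: iT].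
  rewrite -RintegralD; [|exact: mT| |exact: iT]; last first.
    by apply: integrableB_fun; [exact: mT|exact: iT|exact: iT].
  apply: eq_Rintegral => x _.
  rewrite ddM //; last by exact: smoothB.
  by rewrite ddB //; ring.
have ec : edge_continuous (fun x => (Iv x - u x) * phi x).
  apply: (@edge_continuousM (fun x => Iv x - u x)); last exact: continuous_edge_continuous.
  by apply: edge_continuousB => //; exact: continuous_edge_continuous.
have C1g j : C1 (fun x => (g j x - u x) * phi x).
  by apply: smooth_C1; apply: smoothM => //; exact: smoothB.
have hg j x : triangle (T j) x -> (Iv x - u x) * phi x = (g j x - u x) * phi x.
  by move=> /Ivg ->.
exact: (triangle_sum_bound PKT b C1g hg ec).
Qed.

Lemma boundary_sub i t : 0 <= t <= 1 ->
  (K `\` interior K) (lin (P i) (P (ordS i)) t).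
Proof.
move=> t01; have : boundary P (lin (P i) (P (ordS i)) t).
  by exists i => //; exists t => //=; rewrite in_itv.
rewrite -(mesh_boundary PKT) -(closure_id K).1 //; exact: compact_closed2.
Qed.

(** This is [green_error] with [u = 0]: the boundary consists of non-interior points of [K], where a
    test function vanishes. *)
Lemma pgrad_weak b phi : test K phi ->
  \int[leb2 R]_(x in K) (pgrad b x * phi x) = - \int[leb2 R]_(x in K) (Iv x * dd b phi x).
Proof.
move=> [sphi supp].
have := green_error b (@smooth_cst R 0) sphi.
have d0 x : dd b (cst 0) x = 0 by apply: ddE; exact: is_derive_cst.
under eq_Rintegral do rewrite d0 subr0.
under [X in `|_ + X|]eq_Rintegral do rewrite subr0.
rewrite (_ : int_bd _ _ = 0); last first.
  rewrite /int_bd big1 // => i _; rewrite /int_seg.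
  rewrite (@eq_Rintegral _ _ _ _ _ (cst 0)) ?Rintegral_cst ?mul0r ?mulr0 //.
  move=> t; rewrite inE /= in_itv /= => /(boundary_sub i)[_ ni].
  rewrite (_ : phi _ = 0) ?mulr0 ?normr0 //.
  apply/eqP/negPn/negP => nz; apply: ni; apply: supp.
  exact: subset_closure.
by rewrite normr_le0 addr_eq0 => /eqP.
Qed.

End Piecewise.
End WeakDerivative.

(** * Passage from smooth approximants to their limit in H^1 *)

Section TraceLimit.
Variable R : realType.
Context n (P : 'I_n -> R * R) (K : set (R * R)) N (T : 'I_N -> 'I_3 -> R * R).
Hypothesis PKT : mesh P K T.
Let cK := mesh_compact PKT.
Let mK := compact_measurable2 cK.

Lemma int_bd_cvg0 (f_ : nat -> R * R -> R) (f phi : R * R -> R) :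
  (forall m, edge_continuous P (f_ m)) -> edge_continuous P f ->
  edge_continuous P phi ->
  int_bd P (fun x => (f_ m x - f x) ^+ 2) @[m --> \oo] --> (0 : R) ->
  int_bd P (fun x => `|(f_ m x - f x) * phi x|) @[m --> \oo] --> (0 : R).
Proof.
move=> ef_ ef ephi h.
pose G := int_bd P (fun x => phi x ^+ 2).
have bd0 (k : R * R -> R) : (forall x, 0 <= k x) -> 0 <= int_bd P k.
  move=> k0; apply: sumr_ge0 => i _; apply: mulr_ge0; first exact: sqrtr_ge0.
  exact: Rintegral_ge0.
have G0 : 0 <= G by apply: bd0 => x; exact: sqr_ge0.
apply/cvgrPdist_lt => e e0.
have G1 : 0 < G + 1 by lra.
pose t := 2 * (G + 1) / e.
have G2 : 0 < 2 * (G + 1) by lra.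
have t0 : 0 < t by exact: divr_gt0.
have tG : t^-1 * G < e / 2 by rewrite /t invf_div mulrAC ltr_pdivrMr //; nra.
have /cvgrPdist_lt /(_ (e / 2 / t)) := h.
rewrite !divr_gt0 // => /(_ isT); apply: filterS => m.
rewrite !sub0r !normrN => hm; rewrite ger0_norm; last by apply: bd0.
apply: le_lt_trans (young_int_bd t0 (edge_continuousB (ef_ m) ef) ephi) _.
rewrite (splitr e) ltrD // mulrC -ltr_pdivlMr //.
by apply: le_lt_trans hm; rewrite ler_norm.
Qed.

(** Limit of [green_error] along [u m]: on the boundary [Iv - u m] equals [v - u m], which tends to
    0 in L^2 of the boundary. Hence [phi] need not vanish there. *)
Lemma green_limit (Iv v : R * R -> R) (g : 'I_N -> R * R -> R)
    (Gv : bool -> R * R -> R) (u : nat -> R * R -> R) b phi :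
  {within K, continuous Iv} -> (forall j, smooth (g j)) ->
  (forall j x, triangle (T j) x -> Iv x = g j x) ->
  edge_continuous P v -> (forall x, boundary P x -> Iv x = v x) ->
  sqint (leb2 R) K v -> sqint (leb2 R) K (Gv b) -> (forall m, smooth (u m)) ->
  \int[leb2 R]_(x in K) ((u m x - v x) ^+ 2) @[m --> \oo] --> (0 : R) ->
  \int[leb2 R]_(x in K) ((dd b (u m) x - Gv b x) ^+ 2) @[m --> \oo] --> (0 : R) ->
  int_bd P (fun x => (u m x - v x) ^+ 2) @[m --> \oo] --> (0 : R) ->
  smooth phi ->
  \int[leb2 R]_(x in K) ((Iv x - v x) * dd b phi x) =
  - \int[leb2 R]_(x in K) ((pgrad T g b x - Gv b x) * phi x).
Proof.
move=> cIv sg Ivg ev Ivv sv sGv su cu cdu cbd sphi.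
have Ivv' i t : 0 <= t <= 1 -> Iv (lin (P i) (P (ordS i)) t) = v (lin (P i) (P (ordS i)) t).
  by move=> t01; apply: Ivv; exists i => //; exists t => //=; rewrite in_itv.
have eIv : edge_continuous P Iv.
  by move=> i; have [H cH hH] := ev i; exists H => // t t01; rewrite Ivv' // hH.
have sIv : sqint (leb2 R) K Iv by exact: sqint_compact.
have spg : sqint (leb2 R) K (pgrad T g b) by exact: (sqint_pgrad PKT).
have cont f : smooth f -> continuous f by exact: smooth_continuous.
have ssm f : smooth f -> sqint (leb2 R) K f.
  by move=> sf; apply: sqint_continuous => //; exact: cont.
have sdd f : smooth f -> sqint (leb2 R) K (dd b f).
  by move=> sf; apply: ssm; exact: smooth_dd.
pose A m := \int[leb2 R]_(x in K) ((pgrad T g b x - dd b (u m) x) * phi x) +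
  \int[leb2 R]_(x in K) ((Iv x - u m x) * dd b phi x).
have A0 : A m @[m --> \oo] --> (0 : R).
  have eu m : edge_continuous P (u m) by apply: continuous_edge_continuous; exact: cont.
  have ephi : edge_continuous P phi by apply: continuous_edge_continuous; exact: cont.
  have hb := int_bd_cvg0 eu ev ephi cbd.
  apply/norm_cvg0P.
  apply: (@squeeze_cvgr _ _ _ _ (cst 0)
    (fun m => int_bd P (fun x => `|(u m x - v x) * phi x|))) => //; last exact: cvg_cst.
  apply: nearW => m; rewrite normr_ge0 /=.
  apply: le_trans (green_error PKT cIv sg Ivg eIv b (su m) sphi) _.
  rewrite le_eqVlt; apply/orP; left; apply/eqP; apply: eq_bigr => i _.
  congr (_ * _); apply: eq_Rintegral => t; rewrite inE /= in_itv /= => t01.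
  by rewrite Ivv' // !normrM distrC.
have A1 : A m @[m --> \oo] -->
    \int[leb2 R]_(x in K) ((pgrad T g b x - Gv b x) * phi x) +
    \int[leb2 R]_(x in K) ((Iv x - v x) * dd b phi x).
  apply: cvgD.
    apply: (@cvg_Rintegral_mul _ _ _ (leb2 R) K (fun m x => pgrad T g b x - dd b (u m) x)) => //.
    - by move=> m; apply: sqintB => //; exact: sdd.
    - exact: sqintB.
    - exact: ssm.
    - apply: cvg_trans cdu; apply: near_eq_cvg; apply: nearW => m.
      by apply: eq_Rintegral => x _ /=; ring.
  apply: (@cvg_Rintegral_mul _ _ _ (leb2 R) K (fun m x => Iv x - u m x)) => //.
  - by move=> m; apply: sqintB => //; exact: ssm.
  - exact: sqintB.
  - exact: sdd.
  - apply: cvg_trans cu; apply: near_eq_cvg; apply: nearW => m.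
    by apply: eq_Rintegral => x _ /=; ring.
have := cvg_unique (@norm_hausdorff _ R^o) A0 A1.
by move=> e; apply/eqP; rewrite -addr_eq0 addrC -e.
Qed.

End TraceLimit.

(** * Green's formula on a star-shaped set *)

Section KernelFubini.
Variable R : realType.
Notation mu := (@leb2s R).
Implicit Types (a b : R * R -> R).

Section Whole.
Variables (A B : R * R -> R) (k : (R * R) * (R * R) -> R) (M : R).
Hypothesis iA : mu.-integrable setT (EFin \o A).
Hypothesis iB : mu.-integrable setT (EFin \o B).
Hypothesis mk : measurable_fun setT k.
Hypothesis kM : forall u x, `|A u * (B x * k (u, x))| <= M * `|A u| * `|B x|.

Let F (p : (R * R) * (R * R)) : R := A p.1 * (B p.2 * k p).

Let mA : measurable_fun setT A.
Proof. by have /integrableP[/measurable_EFinP] := iA. Qed.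

Let mB : measurable_fun setT B.
Proof. by have /integrableP[/measurable_EFinP] := iB. Qed.

Let mF : measurable_fun setT F.
Proof.
apply: measurable_funM; first exact: measurableT_comp.
by apply: measurable_funM => //; exact: measurableT_comp.
Qed.

Let slice1 u : mu.-integrable setT (EFin \o (fun x => F (u, x))).
Proof.
apply: (@integrable_le _ _ _ mu setT _ (fun x => M * `|A u| * `|B x|)) => //.
- exact: measurableT_comp.
- by apply: integrableZ_fun => //; exact: (integrable_norm iB).
- by move=> x _; exact: kM.
Qed.

Let slice2 x : mu.-integrable setT (EFin \o (fun u => F (u, x))).
Proof.
apply: (@integrable_le _ _ _ mu setT _ (fun u => (M * `|B x|) * `|A u|)) => //.
- exact: measurableT_comp.
- by apply: integrableZ_fun => //; exact: (integrable_norm iA).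
- by move=> u _; rewrite mulrAC; exact: kM.
Qed.

Let iF : (mu \x mu)%E.-integrable setT (EFin \o F).
Proof.
apply/integrable12ltyP; first exact/measurable_EFinP.
pose c := \int[mu]_x `|B x|.
have iMA : mu.-integrable setT (EFin \o (fun u => (M * c) * `|A u|)).
  by apply: integrableZ_fun => //; exact: (integrable_norm iA).
apply: (@le_lt_trans _ _ (\int[mu]_u ((M * c) * `|A u|)%:E)%E); last first.
  have h := integrable_fin_num measurableT iMA.
  by rewrite ltey_eq h.
apply: ge0_le_integral => //.
- by move=> u _; apply: integral_ge0 => x _; exact: abse_ge0.
- apply: (@measurable_fun_fubini_tonelli_F _ _ _ _ _ mu
    (fun p => `|(EFin \o F) p|%E)) => //.
  by apply: measurableT_comp => //; exact/measurable_EFinP.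
- by case/integrableP : iMA.
- move=> u _; apply: (@le_trans _ _ (\int[mu]_x (M * `|A u| * `|B x|)%:E)%E).
    apply: ge0_le_integral => //.
    + by apply: measurableT_comp => //; have /integrableP[] := slice1 u.
    + by apply/measurable_EFinP; apply: measurable_funM => //; exact: measurableT_comp.
    + by move=> x _; rewrite /= lee_fin kM.
  have iB' := integrable_norm iB.
  rewrite -[leLHS]fineK; last first.
    by apply: integrable_fin_num => //; exact: (integrableZ_fun _ _ iB').
  rewrite lee_fin -[leLHS]/(Rintegral _ _ _) RintegralZl //.
  by rewrite mulrAC.
Qed.

Let inner1 u : (\int[mu]_x (EFin \o F) (u, x))%E = (\int[mu]_x F (u, x))%:E.
Proof. by rewrite /Rintegral fineK //; exact: integrable_fin_num (slice1 u). Qed.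

Let inner2 x : (\int[mu]_u (EFin \o F) (u, x))%E = (\int[mu]_u F (u, x))%:E.
Proof. by rewrite /Rintegral fineK //; exact: integrable_fin_num (slice2 x). Qed.

(** [kM] bounds the whole product rather than [k]: once functions on [K] are extended by zero, a
    bound of the kernel on K x K is enough. *)
Lemma kernel_fubiniT :
  \int[mu]_u (\int[mu]_x F (u, x)) = \int[mu]_x (\int[mu]_u F (u, x)).
Proof.
rewrite {1 3}/Rintegral; congr fine.
transitivity (\int[mu]_u \int[mu]_x (EFin \o F) (u, x))%E.
  by apply: eq_integral => u _; rewrite inner1.
rewrite (Fubini iF); by apply: eq_integral => x _; rewrite inner2.
Qed.

Lemma kernel_integrableT :
  mu.-integrable setT (EFin \o (fun u => \int[mu]_x F (u, x))).
Proof.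
rewrite (_ : EFin \o _ = (fun u => \int[mu]_x (EFin \o F) (u, x))%E).
  exact: integrable_fubini_F iF.
by apply/funext => u; rewrite inner1.
Qed.

End Whole.

Section OnSet.
Variables (K : set (R * R)) (a b : R * R -> R) (k : (R * R) * (R * R) -> R) (M : R).
Hypothesis mK : measurable K.
Hypothesis ia : (leb2 R).-integrable K (EFin \o a).
Hypothesis ib : (leb2 R).-integrable K (EFin \o b).
Hypothesis mk : measurable_fun setT k.
Hypothesis kM : forall u x, K u -> K x -> `|k (u, x)| <= M.

Let iK f : (leb2 R).-integrable K (EFin \o f) ->
  mu.-integrable setT (EFin \o (f \_ K)).
Proof.
move=> jf; rewrite EFin_patch.
by have [+ _] := integrable_mkcond (mu := mu) (EFin \o f) mK; exact.
Qed.

Let bound u x : `|(a \_ K) u * ((b \_ K) x * k (u, x))| <=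
  M * `|(a \_ K) u| * `|(b \_ K) x|.
Proof.
rewrite !normrM /patch; case: ifPn => [|_]; last by rewrite normr0 !(mul0r, mulr0).
rewrite inE => Ku; case: ifPn => [|_]; last by rewrite normr0 !(mul0r, mulr0).
rewrite inE => Kx; have := kM Ku Kx.
move: `|k _| `|a u| `|b x| (normr_ge0 (a u)) (normr_ge0 (b x)) => s t v t0 v0 h.
by rewrite mulrA [leLHS]mulrC -mulrA ler_wpM2r // mulr_ge0.
Qed.

Let measurable_k1 u : measurable_fun setT (fun x => k (u, x)).
Proof. exact: measurableT_comp. Qed.

Let measurable_k2 x : measurable_fun setT (fun u => k (u, x)).
Proof. exact: measurableT_comp. Qed.

Lemma integrable_inner1 u : K u ->
  (leb2 R).-integrable K (EFin \o (fun x => b x * k (u, x))).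
Proof.
move=> Ku; have /integrableP[/measurable_EFinP mb _] := ib.
apply: (@integrable_le _ _ _ (leb2 R) K _ (fun x => M * `|b x|)) => //.
- by apply: measurable_funM => //; apply: measurable_funTS; exact: measurable_k1.
- by apply: integrableZ_fun => //; exact: (integrable_norm ib).
- by move=> x Kx; rewrite normrM mulrC ler_wpM2r // kM.
Qed.

Lemma integrable_inner2 x : K x ->
  (leb2 R).-integrable K (EFin \o (fun u => a u * k (u, x))).
Proof.
move=> Kx; have /integrableP[/measurable_EFinP ma _] := ia.
apply: (@integrable_le _ _ _ (leb2 R) K _ (fun u => M * `|a u|)) => //.
- by apply: measurable_funM => //; apply: measurable_funTS; exact: measurable_k2.
- by apply: integrableZ_fun => //; exact: (integrable_norm ia).
- by move=> u Ku; rewrite normrM mulrC ler_wpM2r // kM.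
Qed.

Let in1 u : \int[mu]_x ((a \_ K) u * ((b \_ K) x * k (u, x))) =
  ((fun u => a u * \int[leb2 R]_(x in K) (b x * k (u, x))) \_ K) u.
Proof.
have [Ku|nKu] := pselect (K u); last first.
  rewrite (_ : (fun x => _) = cst 0) ?Rintegral_cst ?mul0r //; last first.
    by apply/funext => x; rewrite {1}/patch memNset // mul0r.
  by rewrite /patch memNset.
rewrite [RHS]/patch mem_set // -RintegralZl //; last exact: integrable_inner1.
rewrite [RHS]Rintegral_mkcond; congr (Rintegral _ _ _); apply/funext => x.
by rewrite /patch mem_set //; case: ifP => // _; rewrite mul0r mulr0.
Qed.

Let in2 x : \int[mu]_u ((a \_ K) u * ((b \_ K) x * k (u, x))) =
  ((fun x => b x * \int[leb2 R]_(u in K) (a u * k (u, x))) \_ K) x.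
Proof.
have [Kx|nKx] := pselect (K x); last first.
  rewrite (_ : (fun u => _) = cst 0) ?Rintegral_cst ?mul0r //; last first.
    by apply/funext => u; rewrite [X in _ * (X * _)]/patch memNset // mul0r mulr0.
  by rewrite /patch memNset.
rewrite [RHS]/patch mem_set // -RintegralZl //; last exact: integrable_inner2.
rewrite [RHS]Rintegral_mkcond; congr (Rintegral _ _ _); apply/funext => u.
rewrite /patch (mem_set Kx); case: ifP => // _; last by rewrite mul0r.
by rewrite mulrCA.
Qed.

Lemma kernel_fubini :
  \int[leb2 R]_(u in K) (a u * \int[leb2 R]_(x in K) (b x * k (u, x))) =
  \int[leb2 R]_(x in K) (b x * \int[leb2 R]_(u in K) (a u * k (u, x))).
Proof.
have := kernel_fubiniT (iK ia) (iK ib) mk bound.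
under eq_Rintegral do rewrite in1.
under [RHS]eq_Rintegral do rewrite in2.
by rewrite -!Rintegral_mkcond.
Qed.

Lemma kernel_integrable :
  (leb2 R).-integrable K
    (EFin \o (fun u => a u * \int[leb2 R]_(x in K) (b x * k (u, x)))).
Proof.
have := kernel_integrableT (iK ia) (iK ib) mk bound.
rewrite (_ : (fun u => _) = (fun u => a u * \int[leb2 R]_(x in K) (b x * k (u, x))) \_ K).
  rewrite EFin_patch => h.
  have [_] := integrable_mkcond (mu := leb2 R)
    (EFin \o (fun u => a u * \int[leb2 R]_(x in K) (b x * k (u, x)))) mK.
  exact.
by apply/funext => u; rewrite in1.
Qed.

End OnSet.
End KernelFubini.

(** * Mass and derivatives of bumps *)

Section BumpMass.
Variable R : realType.
Notation leb := (@lebesgue_measure R).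

Definition bump_mass : R := \int[leb]_(t in `[-1, 1]) bump t.

Lemma bumpN t : bump (- t) = bump t :> R.
Proof. by rewrite /bump mulrC; congr (flat _ _ * flat _ _); ring. Qed.

Lemma bump_mass_gt0 : 0 < bump_mass.
Proof.
have h1 : - (1 / 2) <= 1 / 2 :> R by lra.
have [c c01 hc] := EVT_min h1 (continuous_subspaceT (@bump_continuous R)).
have c0 : 0 < bump c.
  apply: bump_gt0; rewrite ltr_norml; move: c01; rewrite in_itv /= => /andP[? ?].
  by apply/andP; split; lra.
have i (a b : R) := continuous_integrable_itv a b (@bump_continuous R).
apply: (@lt_le_trans _ _ (\int[leb]_(t in `[- (1 / 2), 1 / 2]) cst (bump c) t)).
  rewrite Rintegral_cst //= lebesgue_measure_itv /= lte_fin.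
  rewrite ifT; last by lra.
  by rewrite -EFinB /= mulr_gt0 //; lra.
apply: (@le_trans _ _ (\int[leb]_(t in `[- (1 / 2), 1 / 2]) bump t)).
  have icst : leb.-integrable `[- (1 / 2), 1 / 2] (EFin \o cst (bump c)).
    by apply: (continuous_integrable_itv (G := cst (bump c))) => x; exact: cvg_cst.
  by apply: (le_Rintegral _ icst (i _ _)) => // t /=; exact: hc.
rewrite /bump_mass /Rintegral fine_le //.
- exact: integrable_fin_num (i _ _).
- exact: integrable_fin_num (i _ _).
- apply: ge0_subset_integral => //.
  + by have /integrableP[] := i (- 1) 1.
  + by move=> t _; rewrite lee_fin bump_ge0.
  + move=> t /=; rewrite !in_itv /= => /andP[? ?]; apply/andP; split; lra.
Qed.

Lemma bump_affine_integral (c r : R) : 0 < r ->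
  (\int[leb]_s (bump ((s - c) / r)%R)%:E = (r * bump_mass)%R%:E)%E.
Proof.
move=> r0; pose G s := bump ((s - c) / r).
have cG : continuous G.
  rewrite (_ : G = (fun s => bump (- c / r + s * r^-1))).
    by apply: continuous_affine_comp; exact: bump_continuous.
  by apply/funext => s; rewrite /G mulrBl addrC mulNr.
transitivity (\int[leb]_(s in `[(c + -1 * r)%R, (c + 1 * r)%R]) (G s)%:E)%E.
  rewrite [RHS]integral_mkcond; apply: eq_integral => s _; rewrite /patch.
  case: ifPn => //; rewrite notin_setE /= in_itv /= => /negP h.
  rewrite /G bump_eq0 // normrM normfV (gtr0_norm r0) ler_pdivlMr // mul1r.
  rewrite ler_normr; move: h; rewrite negb_and -!ltNge => /orP[] h; apply/orP.
    by right; lra.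
  by left; lra.
rewrite -[LHS]fineK; last exact: integrable_fin_num (continuous_integrable_itv _ _ cG).
rewrite -[fine _]/(Rintegral _ _ _) (Rintegral_affine_increasing c cG r0); last by lra.
congr ((_ * _)%:E); apply: eq_Rintegral => t _.
by rewrite /G addrC addKr mulfK // gt_eqF.
Qed.

Lemma continuous_bump2 c r : continuous (@bump2 R c r).
Proof. by apply: smooth_continuous; exact: smooth_bump2. Qed.

Lemma bump2_integral c r : 0 < r ->
  (\int[leb2 R]_x (bump2 c r x)%:E = ((r * bump_mass) ^+ 2)%R%:E)%E.
Proof.
move=> r0; rewrite (@fubini_slices_ge0 _ true); last 2 first.
- apply/measurable_EFinP; apply: continuous_measurable2 => //; exact: continuous_bump2.
- by move=> x; rewrite lee_fin bump2_ge0.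
have mass0 : 0 <= r * bump_mass by rewrite mulr_ge0 ?ltW // bump_mass_gt0.
have mb c' : measurable_fun setT (fun s : R => (bump ((s - c') / r))%:E).
  apply/measurable_EFinP; apply: continuous_measurable_fun.
  rewrite (_ : (fun s => _) = (fun s => bump (- c' / r + s * r^-1))).
    by apply: continuous_affine_comp; exact: bump_continuous.
  by apply/funext => s; rewrite mulrBl addrC mulNr.
transitivity (\int[leb]_y ((r * bump_mass)%R%:E * (bump ((y - c.2) / r)%R)%:E))%E.
  apply: eq_integral => y _.
  rewrite -(bump_affine_integral c.1 r0) -ge0_integralZr //.
  - exact: mb.
  - by move=> s _; rewrite lee_fin bump_ge0.
  - by rewrite lee_fin bump_ge0.
rewrite ge0_integralZl //.
- by rewrite bump_affine_integral // -EFinM expr2.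
- exact: mb.
- by move=> s _; rewrite lee_fin bump_ge0.
Qed.

Lemma bump2_integral_le K c r : compact K -> 0 < r ->
  \int[leb2 R]_(x in K) bump2 c r x <= (r * bump_mass) ^+ 2.
Proof.
move=> cK r0; have mK := compact_measurable2 cK.
rewrite -lee_fin -(bump2_integral c r0) /Rintegral fineK; last first.
  apply: integrable_fin_num => //; apply: integrable_continuous2 => //.
  exact: continuous_bump2.
apply: ge0_subset_integral => //.
- apply/measurable_EFinP; apply: continuous_measurable2 => //; exact: continuous_bump2.
- by move=> x _; rewrite lee_fin bump2_ge0.
Qed.

Lemma bump2_integral_sub K c r : compact K -> 0 < r -> square c r `<=` K ->
  \int[leb2 R]_(x in K) bump2 c r x = (r * bump_mass) ^+ 2.
Proof.
move=> cK r0 sK; apply: EFin_inj; rewrite -(bump2_integral c r0) /Rintegral fineK; last first.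
  apply: integrable_fin_num => //; first exact: compact_measurable2.
  apply: integrable_continuous2 => //; exact: continuous_bump2.
rewrite integral_mkcond; apply: eq_integral => x _; rewrite /patch; case: ifPn => //.
rewrite notin_setE => nK; congr EFin; apply/esym/eqP/negPn/negP => nz.
by apply: nK; apply: sK; exact: bump2_neq0 nz.
Qed.

(** Reading the kernel as a function of its other variable reverses the sign of the radius, see
    [kap_arg]. *)
Lemma bump2N c r x : bump2 c (- r) x = bump2 c r x :> R.
Proof. by rewrite /bump2 !invrN !mulrN !bumpN. Qed.

Lemma bump_derivative : exists2 psi : R -> R,
  (forall t : R, is_derive t 1 (@bump R) (psi t)) & continuous psi.
Proof. by have [psi h1 h2] := Cm1_bump R 1; exists psi. Qed.

Lemma dd_bump2 (psi : R -> R) b c r x :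
  (forall t : R, is_derive t 1 (@bump R) (psi t)) ->
  dd b (bump2 c r) x = psi ((coo b x - coo b c) / r) / r *
    bump ((coo (~~ b) x - coo (~~ b) c) / r).
Proof.
move=> dpsi; apply: ddE; apply: slice_is_derive_conv.
have db : is_derive (coo b x) 1 (fun t => bump (- coo b c / r + t * r^-1))
    (psi ((coo b x - coo b c) / r) * r^-1).
  apply: (@is_derive1_comp _ _ (fun t => - coo b c / r + t * r^-1)).
    by rewrite (_ : - coo b c / r + _ = (coo b x - coo b c) / r) //; ring.
  exact: affine_is_derive.
pose e := bump ((coo (~~ b) x - coo (~~ b) c) / r).
pose G t := bump (- coo b c / r + t * r^-1).
have -> : (fun t => bump2 c r (pt b t (coo (~~ b) x))) = G * cst e.
  apply/funext => t; rewrite fctE /= /bump2 /e /G.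
  have -> : - coo b c / r + t * r^-1 = (t - coo b c) / r by ring.
  by case: (b); rewrite /= // mulrC.
have -> : psi ((coo b x - coo b c) / r) / r * e =
    G (coo b x) *: 0 + cst e (coo b x) *: (psi ((coo b x - coo b c) / r) * r^-1).
  by rewrite scaler0 add0r /GRing.scale /= mulrC.
exact: is_deriveM.
Qed.

End BumpMass.

(** * The kernel adapted to the star shape *)

Section StarKernel.
Variable R : realType.
Variables (K : set (R * R)) (c : R * R) (r : R).
Hypothesis cK : compact K.
Hypothesis r0 : 0 < r.
Hypothesis starK : star_shaped K c r.
Let mK : measurable K := compact_measurable2 cK.

Definition ctr (lam : R) (u : R * R) : R * R :=
  (lam * u.1 + (1 - lam) * c.1, lam * u.2 + (1 - lam) * c.2).

(** Inverse of [ctr lam]: the centre of the kernel seen as a bump in [u]. *)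
Definition ctrV (lam : R) (x : R * R) : R * R :=
  ((x.1 - (1 - lam) * c.1) / lam, (x.2 - (1 - lam) * c.2) / lam).

Definition rad (lam : R) : R := (1 - lam) * (r / 2).

(* [kap lam (u, x)], as a function of [x], is a bump supported in the image of
   a square around the star centre [c] under the contraction towards [u] of
   ratio [1 - lam]; that image lies in the interior of [K] for every [u] in
   [K], including those on the boundary. *)
Definition kap (lam : R) (p : (R * R) * (R * R)) : R :=
  bump2 (ctr lam p.1) (rad lam) p.2.

Lemma coo_ctr b lam u : coo b (ctr lam u) = lam * coo b u + (1 - lam) * coo b c.
Proof. by case: b. Qed.

Lemma coo_ctrV b lam x : coo b (ctrV lam x) = (coo b x - (1 - lam) * coo b c) / lam.
Proof. by case: b. Qed.

(** 5/8 is 1/2 + 1/8, the relative size of the support of the kernel plus the margin taken in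
    [square_interior]; since 2 (5/8)^2 < 1, that max-norm square fits in the Euclidean disc. *)
Lemma in_disc (y : R * R) : `|y.1 - c.1| <= 5 / 8 * r -> `|y.2 - c.2| <= 5 / 8 * r ->
  disc c r y.
Proof.
move=> h1 h2; rewrite /disc /dist /dotp /=.
rewrite -[leRHS](ger0_norm (ltW r0)) -sqrtr_sqr ler_wsqrtr //.
move: h1 h2; rewrite !ler_norml => /andP[? ?] /andP[? ?].
have s1 : (y.1 - c.1) ^+ 2 <= (5 / 8 * r) ^+ 2 by nra.
have s2 : (y.2 - c.2) ^+ 2 <= (5 / 8 * r) ^+ 2 by nra.
have : 0 <= r ^+ 2 by exact: sqr_ge0.
nra.
Qed.

Section FixedRatio.
Variable lam : R.
Hypothesis lam0 : 0 < lam.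
Hypothesis lam1 : lam < 1.

Let lam1' : 0 < 1 - lam. Proof. by rewrite subr_gt0. Qed.

Lemma rad_gt0 : 0 < rad lam.
Proof. by rewrite mulr_gt0 // divr_gt0. Qed.

(** A point [z] near the square is lam u + (1 - lam) y with [y] in the disc by [in_disc], so it lies
    on a segment from [u] to the disc and star-shapedness puts it in [K]. *)
Lemma square_interior u : K u -> square (ctr lam u) (rad lam) `<=` interior K.
Proof.
move=> Ku x [h1 h2]; rewrite /interior /=.
apply/nbhs_ballP; exists ((1 - lam) * (r / 8)) => /=; first by rewrite mulr_gt0 // divr_gt0.
move=> z [z1 z2].
pose y : R * R := (c.1 + (z.1 - (ctr lam u).1) / (1 - lam),
                   c.2 + (z.2 - (ctr lam u).2) / (1 - lam)).
have Ky : disc c r y.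
  apply: in_disc; rewrite /y /= addrC addKr normrM normfV (gtr0_norm lam1') ler_pdivrMr //.
    move: z1 h1; rewrite /ball /= /rad !ler_norml ltr_norml => /andP[? ?] /andP[? ?].
    by apply/andP; split; nra.
  move: z2 h2; rewrite /ball /= /rad !ler_norml ltr_norml => /andP[? ?] /andP[? ?].
  by apply/andP; split; nra.
have [_ star] := starK; apply: (star u y Ku Ky).
exists (1 - lam); first by rewrite /= in_itv /= (ltW lam1') lerBlDr lerDl ltW.
have l1 : 1 - lam != 0 by rewrite gt_eqF.
rewrite /lin /y /ctr /= [RHS]surjective_pairing; congr (_, _); by field.
Qed.

Lemma test_kap u : K u -> test K (fun x => kap lam (u, x)).
Proof.
move=> Ku; have sb := @smooth_bump2 R (ctr lam u) (rad lam); split; first exact: sb.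
apply: subset_trans (square_interior Ku).
rewrite [X in _ `<=` X]((closure_id _).1 (@closed_square R _ _)).
by apply: closure_subset => x; apply: bump2_neq0; exact: rad_gt0.
Qed.

Lemma kap_arg b u x :
  (coo b u - coo b (ctrV lam x)) / (- (rad lam / lam)) =
  (coo b x - coo b (ctr lam u)) / rad lam.
Proof.
rewrite coo_ctr coo_ctrV; have := rad_gt0; move: (rad lam) => m m0.
by field; rewrite !gt_eqF.
Qed.

(** As a function of [u] the kernel is again a bump, but it may stick out of [K]: it is smooth
    without being a test function. *)
Lemma kap_swap u x : kap lam (u, x) = bump2 (ctrV lam x) (rad lam / lam) u.
Proof.
rewrite -bump2N /kap /bump2 /=; congr (bump _ * bump _).
  exact/esym/(kap_arg true).
exact/esym/(kap_arg false).
Qed.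

Lemma dd_kap_swap b u x :
  dd b (fun u => kap lam (u, x)) u = - lam * dd b (fun x => kap lam (u, x)) x.
Proof.
have [psi dpsi _] := bump_derivative R.
rewrite (_ : (fun u => _) = bump2 (ctrV lam x) (- (rad lam / lam))); last first.
  by apply/funext => v; rewrite kap_swap bump2N.
rewrite /kap /= !(dd_bump2 _ _ _ _ dpsi) !kap_arg.
have := rad_gt0; move: (rad lam) => m m0.
by field; rewrite !gt_eqF.
Qed.

Lemma kap_mass u : K u ->
  \int[leb2 R]_(x in K) kap lam (u, x) = (rad lam * bump_mass R) ^+ 2.
Proof.
move=> Ku; rewrite /kap /= bump2_integral_sub //; first exact: rad_gt0.
by apply: subset_trans (square_interior Ku) _; exact: interior_subset.
Qed.

(** Only an upper bound, as part of the bump in [u] may lie outside [K]; its radius is larger by the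
    factor 1 / lam, hence the division by [lam ^+ 2]. *)
Lemma kap_mass_le x : \int[leb2 R]_(u in K) kap lam (u, x) <=
  (rad lam * bump_mass R) ^+ 2 / lam ^+ 2.
Proof.
under eq_Rintegral do rewrite kap_swap.
have := bump2_integral_le (ctrV lam x) cK (divr_gt0 rad_gt0 lam0).
rewrite (_ : (rad lam / lam * bump_mass R) ^+ 2 =
  (rad lam * bump_mass R) ^+ 2 / lam ^+ 2) //.
by field; rewrite gt_eqF.
Qed.

Lemma measurable_kap_arg b :
  measurable_fun setT (fun p : (R * R) * (R * R) =>
    (coo b p.2 - coo b (ctr lam p.1)) / rad lam).
Proof.
have mc : measurable_fun setT (fun x : R * R => coo b x).
  by case: b; [exact: measurable_fst|exact: measurable_snd].
apply: measurable_funM; last exact: measurable_cst.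
apply: measurable_funB; first exact: (measurableT_comp mc).
rewrite (_ : (fun p => _) = (fun p : (R * R) * (R * R) =>
  lam * coo b p.1 + (1 - lam) * coo b c)); last first.
  by apply/funext => p; rewrite coo_ctr.
apply: measurable_funD; last exact: measurable_cst.
by apply: measurable_funM; [exact: measurable_cst|exact: (measurableT_comp mc)].
Qed.

Lemma measurable_kap : measurable_fun setT (kap lam).
Proof.
have mb : measurable_fun setT (@bump R).
  by apply: continuous_measurable_fun; exact: bump_continuous.
apply: measurable_funM; apply: (measurableT_comp mb).
  exact: (measurable_kap_arg true).
exact: (measurable_kap_arg false).
Qed.

Lemma measurable_dd_kap b :
  measurable_fun setT (fun p => dd b (fun x => kap lam (p.1, x)) p.2).
Proof.
have mb : measurable_fun setT (@bump R).
  by apply: continuous_measurable_fun; exact: bump_continuous.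
have [psi dpsi cpsi] := bump_derivative R.
have mpsi : measurable_fun setT psi by exact: continuous_measurable_fun.
rewrite (_ : (fun p => _) = (fun p : (R * R) * (R * R) =>
   psi ((coo b p.2 - coo b (ctr lam p.1)) / rad lam) / rad lam *
   bump ((coo (~~ b) p.2 - coo (~~ b) (ctr lam p.1)) / rad lam))); last first.
  by apply/funext => p; rewrite /kap /= (dd_bump2 _ _ _ _ dpsi).
apply: measurable_funM.
  apply: measurable_funM; last exact: measurable_cst.
  exact: (measurableT_comp mpsi (measurable_kap_arg b)).
exact: (measurableT_comp mb (measurable_kap_arg (~~ b))).
Qed.

Lemma kap_bound p : `|kap lam p| <= 1.
Proof. by rewrite ger0_norm ?bump2_ge0 ?bump2_le1. Qed.

(** The bound may blow up as [lam] tends to 1; it only serves to justify Fubini at a fixed [lam]. *)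
Lemma dd_kap_bounded b : exists M, forall u x, K u -> K x ->
  `|dd b (fun x => kap lam (u, x)) x| <= M.
Proof.
have [psi dpsi cpsi] := bump_derivative R.
have [M0 M00 hM] := compact_bounded2 cK.
pose L := (M0 + (lam * M0 + (1 - lam) * `|coo b c|)) / rad lam.
have L0 : - L <= L.
  suff : 0 <= L by lra.
  apply: divr_ge0; last exact: ltW rad_gt0.
  by rewrite !addr_ge0 ?mulr_ge0 // ltW.
have cn : {within `[- L, L], continuous (fun t => `|psi t|)}.
  by apply: continuous_subspaceT => t; apply: cvg_norm; exact: cpsi.
have [t0 _ ht] := EVT_max L0 cn.
exists (`|psi t0| / rad lam) => u x Ku Kx.
rewrite /kap /= (dd_bump2 _ _ _ _ dpsi) normrM -[leRHS]mulr1.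
apply: ler_pM => //; last by rewrite ger0_norm ?bump_ge0 ?bump_le1.
rewrite normrM normfV (gtr0_norm rad_gt0) ler_pM2r ?invr_gt0 ?rad_gt0 //.
apply: ht; rewrite in_itv /= -ler_norml normrM normfV (gtr0_norm rad_gt0).
rewrite ler_pM2r ?invr_gt0 ?rad_gt0 // coo_ctr.
have coo_le z : K z -> `|coo b z| <= M0 by move=> /hM[]; case: (b).
apply: le_trans (ler_normB _ _) _; rewrite lerD ?coo_le //.
apply: le_trans (ler_normD _ _) _; rewrite !normrM (gtr0_norm lam0) (gtr0_norm lam1').
by rewrite lerD // ler_pM2l // coo_le.
Qed.

(** A smoothed, unnormalised inner product: divided by the mass of the kernel it tends to that of
    L^2(K) as [lam] tends to 1, see [kernel_limit]. *)
Definition Bkap (a b : R * R -> R) : R :=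
  \int[leb2 R]_(u in K) (a u * \int[leb2 R]_(x in K) (b x * kap lam (u, x))).

(* [kap lam (u, x)] depends on [x - lam u] only, so that its derivative in [u] is
   [- lam] times its derivative in [x]. *)
Lemma energy_identity (z p : R * R -> R) (D G : bool -> R * R -> R) :
  sqint (leb2 R) K z -> sqint (leb2 R) K p ->
  (forall b, sqint (leb2 R) K (D b)) -> (forall b, sqint (leb2 R) K (G b)) ->
  (forall b phi, smooth phi -> \int[leb2 R]_(x in K) (z x * dd b phi x) =
     - \int[leb2 R]_(x in K) (D b x * phi x)) ->
  (forall phi, test K phi ->
     \int[leb2 R]_(x in K) (G true x * dd true phi x) +
     \int[leb2 R]_(x in K) (G false x * dd false phi x) =
     - \int[leb2 R]_(x in K) (p x * phi x)) ->
  Bkap (D true) (G true) + Bkap (D false) (G false) = - lam * Bkap z p.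
Proof.
move=> sz sp sD sG zD Gp.
have int f : sqint (leb2 R) K f -> (leb2 R).-integrable K (EFin \o f).
  by apply: sqint_integrable => //; exact: leb2_compact_lty.
have [iz ip] := (int _ sz, int _ sp).
have iD b := int _ (sD b); have iG b := int _ (sG b).
have kb u x : K u -> K x -> `|kap lam (u, x)| <= 1 by move=> _ _; exact: kap_bound.
pose dk b (q : (R * R) * (R * R)) := dd b (fun x => kap lam (q.1, x)) q.2.
have bG b : lam^-1 * Bkap (D b) (G b) =
    \int[leb2 R]_(u in K) (z u * \int[leb2 R]_(x in K) (G b x * dk b (u, x))).
  have [M hM] := dd_kap_bounded b.
  rewrite (@kernel_fubini _ _ _ _ _ M mK iz (iG b) (measurable_dd_kap b) hM).
  rewrite /Bkap (@kernel_fubini _ _ _ _ _ 1 mK (iD b) (iG b) measurable_kap kb).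
  (* [kernel_integrable] concerns the first variable; exchanging the variables gives the
     integrability in [x]. *)
  pose ks (q : (R * R) * (R * R)) := kap lam (q.2, q.1).
  have mks : measurable_fun setT ks.
    by apply: (measurableT_comp measurable_kap); exact: measurable_swap.
  have ksb u x : K u -> K x -> `|ks (u, x)| <= 1 by move=> _ _; exact: kap_bound.
  have iks := kernel_integrable mK (iG b) (iD b) mks ksb.
  rewrite -RintegralZl //.
  apply: eq_Rintegral => x; rewrite inE => Kx; rewrite mulrCA; congr (_ * _).
  apply: (canLR (mulKf (lt0r_neq0 lam0))).
  have sphi : smooth (fun u => kap lam (u, x)).
    have sb := @smooth_bump2 R (ctrV lam x) (rad lam / lam).
    rewrite (_ : (fun u => _) = bump2 (ctrV lam x) (rad lam / lam)) //.
    by apply/funext => u; exact: kap_swap.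
  have E : \int[leb2 R]_(u in K) (z u * dd b (fun u => kap lam (u, x)) u) =
      - lam * \int[leb2 R]_(u in K) (z u * dk b (u, x)).
    transitivity (\int[leb2 R]_(u in K) (- lam * (z u * dk b (u, x)))).
      by apply: eq_Rintegral => u _; rewrite dd_kap_swap mulrCA.
    apply: RintegralZl => //.
    exact: (integrable_inner2 mK iz (measurable_dd_kap b) hM Kx).
  by have := zD b _ sphi; rewrite E mulNr => /oppr_inj ->.
have izG b := kernel_integrable mK iz (iG b) (measurable_dd_kap b).
rewrite mulNr -[Bkap (D true) _](mulVKf (lt0r_neq0 lam0)).
rewrite -[Bkap (D false) _](mulVKf (lt0r_neq0 lam0)) -mulrDr !bG -mulrN; congr (_ * _).
have [M1 hM1] := dd_kap_bounded true; have [M2 hM2] := dd_kap_bounded false.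
rewrite -RintegralD //; [|exact: izG hM1|exact: izG hM2].
rewrite /Bkap -mulN1r -RintegralZl //; last first.
  exact: (kernel_integrable mK iz ip measurable_kap kb).
apply: eq_Rintegral => u; rewrite inE => Ku.
(* The equation of w enters here: for [u] in [K] the kernel is a test function of [x]. *)
by rewrite -mulrDr (Gp _ (test_kap Ku)) mulrN mulN1r.
Qed.

End FixedRatio.
End StarKernel.

(** * Bounds on the kernel as the ratio tends to 1 *)

Section KernelLimit.
Variable R : realType.
Variables (K : set (R * R)) (c : R * R) (r : R).
Hypothesis cK : compact K.
Hypothesis r0 : 0 < r.
Hypothesis starK : star_shaped K c r.
Let mK : measurable K := compact_measurable2 cK.

Lemma uniform_continuity (f : R * R -> R) w : continuous f -> 0 < w ->
  exists2 d, 0 < d & forall x y, K x -> ball x d y -> `|f y - f x| < w.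
Proof.
move=> cf w0; have /compact_near_coveringP/(_ R (0^'+)
  (fun d x => forall y, ball x d y -> `|f y - f x| < w)) := cK.
case=> [x Kx|d0 /= d00 h].
  have w2 : 0 < w / 2 by rewrite divr_gt0.
  have /cvgrPdist_lt/(_ _ w2)/nbhs_ballP[e /= e0 he] := cf x.
  have e2 : 0 < e / 2 by rewrite divr_gt0.
  exists (ball x (e / 2), [set d | d < e / 2]) => /=.
    by split; [exact: nbhsx_ballx|exact: nbhs_right_lt].
  move=> [x' d] [/= xx' de] y x'y.
  have h1 : `|f x - f x'| < w / 2.
    by apply: he; apply: le_ball xx'; lra.
  have h2 : `|f x - f y| < w / 2.
    apply: he; rewrite (splitr e); apply: ball_triangle xx' _.
    by apply: le_ball x'y; exact: ltW.
  apply: le_lt_trans (ler_distD (f x) _ _) _; rewrite (distrC (f y)).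
  by rewrite (splitr w) ltrD.
exists (d0 / 2); first by rewrite divr_gt0.
move=> x y Kx xy; apply: (h (d0 / 2)) => //=.
  rewrite sub0r normrN gtr0_norm ?divr_gt0 //; lra.
by rewrite divr_gt0.
Qed.

Notation m lam := ((rad r lam * bump_mass R) ^+ 2).

(** Schur's test: |a(u) f(x)| <= t a(u)^2 + f(x)^2 / t is integrated against the kernel, whose mass
    in [x] is the stated one and in [u] at most that over lam^2. The 4 bounds 1 / lam^2 for
    [lam >= 1 / 2]. *)
Lemma kap_schur lam a f t : 1 / 2 <= lam -> lam < 1 -> 0 < t ->
  sqint (leb2 R) K a -> sqint (leb2 R) K f ->
  `|Bkap K c r lam a f| <=
  m lam * (t * \int[leb2 R]_(x in K) (a x ^+ 2) + 4 * t^-1 * \int[leb2 R]_(x in K) (f x ^+ 2)).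
Proof.
move=> lam2 lam1 t0 sa sf; have lam0 : 0 < lam by lra.
have := kap_mass cK r0 starK lam0 lam1; have := kap_mass_le c cK r0 lam0 lam1.
have : 0 <= m lam by exact: sqr_ge0.
move: (m lam) => ml ml0 mass_le mass.
have [ma ia2] := sa; have [mf if2] := sf.
have int g : sqint (leb2 R) K g -> (leb2 R).-integrable K (EFin \o g).
  by apply: sqint_integrable => //; exact: leb2_compact_lty.
have mkap := measurable_kap c r lam.
have kb u x : K u -> K x -> `|kap c r lam (u, x)| <= 1 by move=> _ _; exact: kap_bound.
have kge u x : 0 <= kap c r lam (u, x) by exact: bump2_ge0.
have i1 : (leb2 R).-integrable K (EFin \o (fun=> 1 : R)).
  by apply: integrable_continuous2 => // x; exact: cvg_cst.
have iaf := kernel_integrable mK (int _ sa) (int _ sf) mkap kb.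
have iQ := kernel_integrable mK i1 if2 mkap kb.
have ck u : continuous (fun x => kap c r lam (u, x)) :=
  @continuous_bump2 R (ctr c lam u) (rad r lam).
have ti0 : 0 < t^-1 by rewrite invr_gt0.
pose Q u := \int[leb2 R]_(x in K) (f x ^+ 2 * kap c r lam (u, x)).
(* The factor 1 keeps the second term in the shape of [kernel_fubini] with the constant 1 as outer
   function. *)
have pt_bound u : K u -> `|a u * \int[leb2 R]_(x in K) (f x * kap c r lam (u, x))| <=
    (t * ml) * a u ^+ 2 + t^-1 * (1 * Q u).
  move=> Ku; have ifk := integrable_inner1 mK (int _ sf) mkap kb Ku.
  have if2k := integrable_inner1 mK if2 mkap kb Ku.
  have ik := integrable_continuous2 cK (ck u).
  rewrite -RintegralZl // mul1r /Q -RintegralZl //.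
  rewrite -(mass _ Ku) mulrAC -RintegralZl //.
  rewrite -RintegralD //; [|exact: integrableZ_fun|exact: integrableZ_fun].
  have iafk : (leb2 R).-integrable K
      (EFin \o (fun x => a u * (f x * kap c r lam (u, x)))) by exact: integrableZ_fun.
  apply: le_trans; first by apply: (le_normr_Rintegral _ iafk); exact: mK.
  apply: le_Rintegral; [exact: mK|exact: (integrable_norm iafk)| |move=> x _].
    by apply: integrableD_fun => //; exact: integrableZ_fun.
  rewrite mulrA normrM (ger0_norm (kge u x)) [t^-1 * _]mulrA -mulrDl.
  rewrite ler_wpM2r // ler_norml.
  have tt : t * t^-1 = 1 by rewrite mulfV // gt_eqF.
  have h s : 0 <= t * (a u - s * (t^-1 * f x)) ^+ 2.
    by rewrite mulr_ge0 ?sqr_ge0 // ltW.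
  have E s : t * (a u - s * (t^-1 * f x)) ^+ 2 =
    t * a u ^+ 2 - (t * t^-1) * (2 * s * (a u * f x)) + (t * t^-1) * (t^-1 * f x ^+ 2) * s ^+ 2.
    by ring.
  (* The two signs bound the product from above and from below. *)
  have := h 1; have := h (- 1); rewrite !E tt.
  have : 0 <= t * a u ^+ 2 by rewrite mulr_ge0 ?sqr_ge0 // ltW.
  have : 0 <= t^-1 * f x ^+ 2 by rewrite mulr_ge0 ?sqr_ge0 // ltW.
  move: (t * a u ^+ 2) (t^-1 * f x ^+ 2) (a u * f x) => p q s; clear => h1 h2 h3 h4.
  by apply/andP; split; lra.
have iR : (leb2 R).-integrable K (EFin \o (fun u => (t * ml) * a u ^+ 2 + t^-1 * (1 * Q u))).
  by apply: integrableD_fun => //; exact: integrableZ_fun.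
apply: le_trans; first by apply: (le_normr_Rintegral _ iaf); exact: mK.
apply: le_trans; first by apply: (le_Rintegral _ (integrable_norm iaf) iR pt_bound); exact: mK.
rewrite RintegralD //; [|exact: integrableZ_fun|exact: integrableZ_fun].
have E1 : \int[leb2 R]_(u in K) (t * ml * a u ^+ 2) =
  t * ml * \int[leb2 R]_(u in K) (a u ^+ 2) by exact: RintegralZl.
have E2 : \int[leb2 R]_(u in K) (t^-1 * (1 * Q u)) =
  t^-1 * \int[leb2 R]_(u in K) (1 * Q u) by exact: RintegralZl.
rewrite E1 E2 mulrDr [ml * (t * _)]mulrA (mulrC ml t) lerD2l.
rewrite (kernel_fubini mK i1 if2 mkap kb).
rewrite [leRHS](_ : _ = t^-1 * (4 * ml * \int[leb2 R]_(x in K) (f x ^+ 2))); last by ring.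
rewrite ler_pM2l // -RintegralZl //.
pose ks (q : (R * R) * (R * R)) := kap c r lam (q.2, q.1).
have mks : measurable_fun setT ks by apply: (measurableT_comp mkap); exact: measurable_swap.
have ksb u x : K u -> K x -> `|ks (u, x)| <= 1 by move=> _ _; exact: kap_bound.
apply: le_Rintegral; [exact: mK| | |move=> x _].
- exact: (kernel_integrable mK if2 i1 mks ksb).
- by apply: integrableZ_fun; [exact: mK|exact: if2].
rewrite mulrC ler_wpM2r ?sqr_ge0 //.
under eq_Rintegral do rewrite mul1r.
apply: le_trans (mass_le x) _.
rewrite ler_pdivrMr ?exprn_gt0 // mulrAC.
have h4 : 1 <= 4 * lam ^+ 2 by nra.
by rewrite ler_peMl.
Qed.

(** Where the kernel is nonzero, [x] is close to [u] for [lam] near 1, so f(x) may be replaced by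
    f(u) at the cost of [w]; the remaining integral in [x] is the mass. *)
Lemma kap_continuous_bound a f w : sqint (leb2 R) K a -> continuous f -> 0 < w ->
  exists2 d, 0 < d & forall lam, 0 < lam -> 1 - d < lam -> lam < 1 ->
  `|Bkap K c r lam a f - m lam * \int[leb2 R]_(x in K) (a x * f x)| <=
  m lam * (w * \int[leb2 R]_(x in K) `|a x|).
Proof.
move=> sa cf w0; have [e e0 he] := uniform_continuity cf w0.
have [M M0 hM] := compact_bounded2 cK.
(* On the support each coordinate of u - x is at most (1 - lam) (|u - c| + r/2), which [C] dominates
   after the factor 1 - lam. *)
pose C := M + `|c.1| + `|c.2| + r.
have C0 : 0 < C by rewrite /C ltr_wpDl // !addr_ge0 // ltW.
exists (e / C); first exact: divr_gt0.
move=> lam lam0 lamd lam1; have lam1' : 0 < 1 - lam by lra.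
have lC : (1 - lam) * C < e by rewrite -ltr_pdivlMr //; lra.
have := kap_mass cK r0 starK lam0 lam1.
have : 0 <= m lam by exact: sqr_ge0.
move: (m lam) => ml ml0 mass.
have int g : sqint (leb2 R) K g -> (leb2 R).-integrable K (EFin \o g).
  by apply: sqint_integrable => //; exact: leb2_compact_lty.
have mkap := measurable_kap c r lam.
have kb u x : K u -> K x -> `|kap c r lam (u, x)| <= 1 by move=> _ _; exact: kap_bound.
have kge u x : 0 <= kap c r lam (u, x) by exact: bump2_ge0.
have sf : sqint (leb2 R) K f by exact: sqint_continuous.
have iaf := kernel_integrable mK (int _ sa) (int _ sf) mkap kb.
have ck u : continuous (fun x => kap c r lam (u, x)) :=
  @continuous_bump2 R (ctr c lam u) (rad r lam).
have ia2 : (leb2 R).-integrable K (EFin \o (fun x => a x * f x)) by exact: integrable_mul.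
have ima : (leb2 R).-integrable K (EFin \o (fun x => ml * (a x * f x))).
  by apply: integrableZ_fun; [exact: mK|exact: ia2].
have id : (leb2 R).-integrable K (EFin \o (fun u =>
    a u * \int[leb2 R]_(x in K) (f x * kap c r lam (u, x)) - ml * (a u * f u))).
  by apply: integrableB_fun; [exact: mK|exact: iaf|exact: ima].
rewrite /Bkap -RintegralZl // -RintegralB //.
have pt_bound u : K u -> `|a u * \int[leb2 R]_(x in K) (f x * kap c r lam (u, x)) -
    ml * (a u * f u)| <= (ml * w) * `|a u|.
  move=> Ku; rewrite (mulrCA (ml)) -mulrBr normrM mulrC ler_wpM2r //.
  have ifk := integrable_inner1 mK (int _ sf) mkap kb Ku.
  have ik := integrable_continuous2 cK (ck u).
  rewrite -(mass _ Ku) mulrC -RintegralZl // -RintegralB //; last first.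
    exact: integrableZ_fun.
  rewrite mulrC -RintegralZl //.
  have idu : (leb2 R).-integrable K
    (EFin \o (fun x => f x * kap c r lam (u, x) - f u * kap c r lam (u, x))).
    by apply: integrableB_fun => //; exact: integrableZ_fun.
  apply: le_trans; first by apply: (le_normr_Rintegral _ idu); exact: mK.
  apply: le_Rintegral; [exact: mK|exact: (integrable_norm idu)|exact: integrableZ_fun|].
  move=> x Kx; rewrite -mulrBl normrM (ger0_norm (kge u x)).
  have [->|nz] := eqVneq (kap c r lam (u, x)) 0; first by rewrite !mulr0.
  rewrite ler_wpM2r // ltW //; apply: he => //.
  have [s1 s2] := bump2_neq0 (rad_gt0 r0 lam1) nz.
  have [u1 u2] := hM _ Ku.
  have near (xi ui ci : R) : `|ui| <= M -> `|ci| <= `|c.1| + `|c.2| ->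
      `|xi - (lam * ui + (1 - lam) * ci)| <= rad r lam -> `|ui - xi| < e.
    move=> hu hc hx; apply: le_lt_trans lC.
    rewrite (_ : ui - xi = (1 - lam) * (ui - ci) - (xi - (lam * ui + (1 - lam) * ci)));
      last by ring.
    apply: le_trans (ler_normB _ _) _; rewrite normrM (gtr0_norm lam1').
    have h1 := ler_normB ui ci; move: hx; rewrite /rad /C.
    have h2 : `|ui - ci| <= M + `|c.1| + `|c.2| by lra.
    have := ler_wpM2l (ltW lam1') h2; have : 0 <= (1 - lam) * r by rewrite mulr_ge0 // ltW.
    move: `|ui - ci| `|_ - _| {h1 h2} => A B; lra.
  split; rewrite /ball /=; [apply: near s1 => //|apply: near s2 => //].
    by rewrite lerDl.
  by rewrite lerDr.
apply: le_trans; first by apply: (le_normr_Rintegral _ id); exact: mK.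
have ina := integrable_norm (int _ sa).
rewrite mulrA -RintegralZl //.
by apply: le_Rintegral;
  [exact: mK|exact: (integrable_norm id)|exact: integrableZ_fun|exact: pt_bound].
Qed.

End KernelLimit.

Section StarGreen.
Variable R : realType.
Variables (K : set (R * R)) (c : R * R) (r : R).
Hypothesis cK : compact K.
Hypothesis r0 : 0 < r.
Hypothesis starK : star_shaped K c r.
Let mK : measurable K := compact_measurable2 cK.

(** Approximation by continuous functions is asked only of the functions concerned: components of
    the gradient of w are limits of smooth ones through the trace sequence, and p is a
    polynomial. *)
Definition approximable (f : R * R -> R) := forall e, 0 < e ->
  exists2 g, continuous g & \int[leb2 R]_(x in K) ((f x - g x) ^+ 2) < e.

Notation m lam := ((rad r lam * bump_mass R) ^+ 2).

(** The error carries the factor [m lam], which itself tends to 0. A continuous [g] replaces [b]: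
    the difference is controlled by [kap_schur] and Young's inequality, [g] itself by
    [kap_continuous_bound]. *)
Lemma kernel_limit a b e : sqint (leb2 R) K a -> sqint (leb2 R) K b ->
  approximable b -> 0 < e ->
  exists2 d, 0 < d & forall lam, 1 / 2 <= lam -> 1 - d < lam -> lam < 1 ->
  `|Bkap K c r lam a b - m lam * \int[leb2 R]_(x in K) (a x * b x)| <= m lam * e.
Proof.
move=> sa sb apb e0.
pose A := \int[leb2 R]_(x in K) (a x ^+ 2); pose B := \int[leb2 R]_(x in K) `|a x|.
have A0 : 0 <= A by apply: Rintegral_ge0 => x _; exact: sqr_ge0.
have B0 : 0 <= B by apply: Rintegral_ge0 => x _; exact: normr_ge0.
have A1 : 0 < A + 1 by lra.
have B1 : 0 < B + 1 by lra.
(* Relative to the mass, the three parts are at most e/8 + 4 (e/64), e/4 and e/8 + e/64, less than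
   [e] together. *)
pose t := e / 8 / (A + 1); have t0 : 0 < t by rewrite !divr_gt0.
have tA : t * A <= e / 8.
  rewrite /t mulrAC ler_pdivrMr // ler_wpM2l //; lra.
pose w := e / 4 / (B + 1); have w0 : 0 < w by rewrite !divr_gt0.
have wB : w * B <= e / 4.
  rewrite /w mulrAC ler_pdivrMr // ler_wpM2l //; lra.
have h0 : 0 < e / 64 * t by rewrite mulr_gt0 // divr_gt0.
have [g cg hg] := apb _ h0.
have sg : sqint (leb2 R) K g by exact: sqint_continuous.
have sbg : sqint (leb2 R) K (fun x => b x - g x) by exact: sqintB.
have tg : t^-1 * \int[leb2 R]_(x in K) ((b x - g x) ^+ 2) <= e / 64.
  by rewrite mulrC ler_pdivrMr // ltW.
have [d d0 hd] := kap_continuous_bound cK r0 starK sa cg w0.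
exists d => // lam lam2 lamd lam1; have lam0 : 0 < lam by lra.
have := hd lam lam0 lamd lam1; rewrite -/B.
have := kap_schur cK r0 starK lam2 lam1 t0 sa sbg; rewrite -/A.
have yo : `|\int[leb2 R]_(x in K) (a x * (b x - g x))| <=
    t * A + t^-1 * \int[leb2 R]_(x in K) ((b x - g x) ^+ 2) by exact: young_Rintegral.
have int f : sqint (leb2 R) K f -> (leb2 R).-integrable K (EFin \o f).
  by apply: sqint_integrable => //; exact: leb2_compact_lty.
have mkap := measurable_kap c r lam.
have kb u x : K u -> K x -> `|kap c r lam (u, x)| <= 1 by move=> _ _; exact: kap_bound.
have ib := kernel_integrable mK (int _ sa) (int _ sb) mkap kb.
have ig := kernel_integrable mK (int _ sa) (int _ sg) mkap kb.
have -> : Bkap K c r lam a (fun x => b x - g x) =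
    Bkap K c r lam a b - Bkap K c r lam a g.
  rewrite /Bkap -RintegralB //; apply: eq_Rintegral => u /set_mem Ku.
  have ibk := integrable_inner1 mK (int _ sb) mkap kb Ku.
  have igk := integrable_inner1 mK (int _ sg) mkap kb Ku.
  rewrite -mulrBr -RintegralB //; congr (_ * _).
  by apply: eq_Rintegral => x _; rewrite mulrBl.
have iab : (leb2 R).-integrable K (EFin \o (fun x => a x * b x)) by exact: integrable_mul.
have iag : (leb2 R).-integrable K (EFin \o (fun x => a x * g x)) by exact: integrable_mul.
have E : \int[leb2 R]_(x in K) (a x * (b x - g x)) =
    \int[leb2 R]_(x in K) (a x * b x) - \int[leb2 R]_(x in K) (a x * g x).
  rewrite -RintegralB //; apply: eq_Rintegral => x _; exact: mulrBr.
rewrite {}E in yo.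
have : 0 <= m lam by exact: sqr_ge0.
move: (m lam) yo => ml yo ml0 h1 h2.
set X := Bkap K c r lam a b in h1 *; set Y := Bkap K c r lam a g in h1 h2.
set x := Rintegral _ _ _ in yo *; set y := \int[leb2 R]_(x in K) (a x * g x) in yo h2.
set q := Rintegral _ _ _ in tg h1 yo.
have E : X - ml * x = (X - Y) + (Y - ml * y) - ml * (x - y) by ring.
rewrite E; apply: le_trans (ler_normB _ _) _; rewrite normrM (ger0_norm ml0).
apply: le_trans (lerD (ler_normD _ _) (ler_wpM2l ml0 yo)) _.
have h3 : ml * (w * B) <= ml * (e / 4) by exact: ler_wpM2l.
have h4 : ml * (t * A + 4 * t^-1 * q) <= ml * (e / 8 + 4 * (e / 64)).
  by apply: ler_wpM2l => //; rewrite -mulrA; lra.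
have h5 : ml * (t * A + t^-1 * q) <= ml * (e / 8 + e / 64).
  by apply: ler_wpM2l => //; lra.
apply: le_trans (lerD (lerD (le_trans h1 h4) (le_trans h2 h3)) h5) _.
rewrite -!mulrDr; apply: ler_wpM2l => //; lra.
Qed.

Lemma star_green (z p : R * R -> R) (D G : bool -> R * R -> R) :
  sqint (leb2 R) K z -> sqint (leb2 R) K p -> approximable p ->
  (forall b, sqint (leb2 R) K (D b)) -> (forall b, sqint (leb2 R) K (G b)) ->
  (forall b, approximable (G b)) ->
  (forall b phi, smooth phi -> \int[leb2 R]_(x in K) (z x * dd b phi x) =
     - \int[leb2 R]_(x in K) (D b x * phi x)) ->
  (forall phi, test K phi ->
     \int[leb2 R]_(x in K) (G true x * dd true phi x) +
     \int[leb2 R]_(x in K) (G false x * dd false phi x) =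
     - \int[leb2 R]_(x in K) (p x * phi x)) ->
  \int[leb2 R]_(x in K) (D true x * G true x) +
  \int[leb2 R]_(x in K) (D false x * G false x) =
  - \int[leb2 R]_(x in K) (z x * p x).
Proof.
move=> sz sp ap sD sG aG zD Gp.
set X1 := Rintegral _ _ _; set X2 := Rintegral _ _ _; set Y := Rintegral _ _ _.
apply/eqP; rewrite -subr_eq0 opprK -normr_le0; apply/ler_addgt0Pr => e e0; rewrite add0r.
have e4 : 0 < e / 4 by rewrite divr_gt0.
have [d1' d10 h1] := kernel_limit (sD true) (sG true) (aG true) e4.
have [d2' d20 h2] := kernel_limit (sD false) (sG false) (aG false) e4.
have [d3' d30 h3] := kernel_limit sz sp ap e4.
(* Absorbs the factor [lam] of the energy identity: it makes (1 - lam) |Y| at most [e / 4]. *)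
pose d4 := e / 4 / (`|Y| + 1).
have Y1 : 0 < `|Y| + 1 by rewrite ltr_wpDl.
have d40 : 0 < d4 by rewrite !divr_gt0.
pose lam := 1 - Num.min (1 / 2) (Num.min (Num.min d1' d2') (Num.min d3' d4)) / 2.
have [dm0 [dm1 [dm2 [dm3 [dm4 dm5]]]]] : 0 < 1 - lam /\ (1 - lam <= 1 / 2 /\
    (1 - lam < d1' /\ (1 - lam < d2' /\ (1 - lam < d3' /\ 1 - lam < d4)))).
  rewrite /lam subKr; set d := Num.min _ _.
  have d0 : 0 < d by rewrite !lt_min d10 d20 d30 d40; lra.
  have : d <= d by []; rewrite {2}/d !le_min => /and3P[a1 /andP[a2 a3] /andP[a4 a5]].
  by do !split; lra.
have lam1 : lam < 1 by lra.
have lam2 : 1 / 2 <= lam by lra.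
have lam0 : 0 < lam by lra.
have l1 : 1 - d1' < lam by lra.
have l2 : 1 - d2' < lam by lra.
have l3 : 1 - d3' < lam by lra.
move: (h1 lam lam2 l1 lam1) (h2 lam lam2 l2 lam1) (h3 lam lam2 l3 lam1).
have := energy_identity cK r0 starK lam0 lam1 sz sp sD sG zD Gp.
rewrite -/X1 -/X2 -/Y.
have : 0 < m lam.
  by rewrite exprn_gt0 // mulr_gt0 ?bump_mass_gt0 // rad_gt0.
move: (m lam) => ml ml0; move: (Bkap _ _ _ _ _ _) => B1.
move: (Bkap _ _ _ _ _ _) => B2; move: (Bkap _ _ _ _ _ _) => B3 hB b1 b2 b3.
have hY : (1 - lam) * `|Y| <= e / 4.
  have : (1 - lam) * (`|Y| + 1) <= e / 4 by rewrite -ler_pdivlMr // ltW.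
  lra.
rewrite -(ler_pM2l ml0) -{1}(gtr0_norm ml0) -normrM.
(* The kernel terms cancel by [B1 + B2 = - lam * B3]; four errors of at most [ml * (e / 4)]
   remain. *)
have -> : ml * (X1 + X2 + Y) = - (B1 - ml * X1) - (B2 - ml * X2) - lam * (B3 - ml * Y)
   + ml * ((1 - lam) * Y) by rewrite !mulrBr mulrDr; lra.
have b4 : `|lam * (B3 - ml * Y)| <= ml * (e / 4).
  rewrite normrM (gtr0_norm lam0); apply: le_trans b3; rewrite ler_piMl //; lra.
have b5 : `|ml * ((1 - lam) * Y)| <= ml * (e / 4).
  by rewrite normrM (gtr0_norm ml0) ler_pM2l // normrM (gtr0_norm dm0).
apply: le_trans (ler_normD _ _) _.
apply: le_trans (lerD (ler_normB _ _) b5) _.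
apply: le_trans (lerD (lerD (ler_normB _ _) b4) (lexx _)) _.
rewrite normrN; move: b1 b2; move: `|_| `|_| => n1 n2.
have -> : ml * e = ml * (e / 4) + ml * (e / 4) + ml * (e / 4) + ml * (e / 4) by field.
lra.
Qed.

End StarGreen.

(** * Degrees of freedom *)

Section Edges.
Variable R : realType.
Notation leb := (@lebesgue_measure R).

Lemma continuous_ge0_integral_eq0 (G : R -> R) : continuous G ->
  (forall t, 0 <= t <= 1 -> 0 <= G t) -> \int[leb]_(t in `[0, 1]) G t = 0 ->
  forall t, 0 < t < 1 -> G t = 0.
Proof.
move=> cG G0 I0 s /andP[s0 s1]; apply/eqP/negPn/negP => Gs.
have Gs0 : 0 < G s by rewrite lt_neqAle eq_sym Gs G0 // !ltW.
have Gs2 : 0 < G s / 2 by rewrite divr_gt0.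
have /cvgrPdist_lt/(_ _ Gs2)/nbhs_ballP[e /= e0 he] := cG s.
pose d := Num.min (e / 2) (1 - s).
have d0 : 0 < d by rewrite lt_min divr_gt0 //= subr_gt0.
have [de ds] : d <= e / 2 /\ d <= 1 - s by split; rewrite ge_min lexx ?orbT.
have i (a b : R) := continuous_integrable_itv a b cG.
suff : 0 < \int[leb]_(t in `[0, 1]) G t by rewrite I0 ltxx.
apply: (@lt_le_trans _ _ (\int[leb]_(t in `[s, s + d]) cst (G s / 2) t)).
  rewrite Rintegral_cst //= lebesgue_measure_itv /= lte_fin ltrDl d0.
  by rewrite -EFinB /= mulr_gt0 // addrAC subrr add0r.
apply: (@le_trans _ _ (\int[leb]_(t in `[s, s + d]) G t)).
  have icst : leb.-integrable `[s, s + d] (EFin \o cst (G s / 2)).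
    by apply: (continuous_integrable_itv (G := cst (G s / 2))) => x; exact: cvg_cst.
  apply: (le_Rintegral _ icst (i _ _)) => // t /=; rewrite in_itv /= => /andP[st td].
  have : `|G s - G t| < G s / 2.
    by apply: he; rewrite /ball /= ltr_norml; apply/andP; split; lra.
  rewrite ltr_norml => /andP[_]; lra.
rewrite /Rintegral fine_le //.
- exact: integrable_fin_num (i _ _).
- exact: integrable_fin_num (i _ _).
have h1 : (\int[leb]_(t in `[s, (s + d)%R]) (G t)%:E <=
    \int[leb]_(t in `[s, (s + d)%R]) `|G t|%R%:E)%E.
  by apply: le_integral => //; [exact: (integrable_norm (i _ _))|
    move=> t _; rewrite lee_fin ler_norm].
apply: le_trans h1 _.
rewrite [leRHS](_ : _ = (\int[leb]_(t in `[0%R, 1%R]) `|G t|%R%:E)%E); last first.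
  by apply: eq_integral => t; rewrite inE /= in_itv /= => t01; rewrite ger0_norm // G0.
apply: ge0_subset_integral => //.
- by have /integrableP[] := integrable_norm (i 0 1).
- by move=> t /=; rewrite !in_itv /= => /andP[? ?]; apply/andP; split; lra.
Qed.

(** The two roots leave D = t (t - 1) q with [q] of degree less than [k], so [D] is orthogonal to
    [q]. Then t (1 - t) q^2 is nonnegative with zero integral. *)
Lemma edge_poly_eq0 k (D : {poly R}) : (size D <= k.+2)%N -> D.[0] = 0 -> D.[1] = 0 ->
  (forall j, (j < k)%N -> \int[leb]_(t in `[0, 1]) (D.[t] * (t - 1 / 2) ^+ j) = 0) ->
  forall t, 0 <= t <= 1 -> D.[t] = 0.
Proof.
move=> sD D0 D1 DM.
have [q Dq] : exists q, D = q * ('X - 1%:P) * ('X - 0%:P).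
  have /factor_theorem[q1 q1D] : root D 0 by apply/eqP.
  have /factor_theorem[q q1q] : root q1 1.
    move: D1; rewrite q1D hornerM hornerXsubC subr0 mulr1 => h; exact/eqP.
  by exists q; rewrite q1D q1q.
have sq : (size q <= k)%N.
  have [->|q0] := eqVneq q 0; first by rewrite size_poly0.
  move: sD; rewrite Dq !size_Mmonic ?monicXsubC ?mulf_neq0 ?polyXsubC_eq0 //.
  by rewrite !size_XsubC !addn2.
(* Recentred at the midpoint, since the edge moments are taken against powers of t - 1/2. *)
pose Q := q \Po ('X + (1 / 2)%:P).
have sQ : (size Q <= k)%N.
  have [q0|q0] := eqVneq q 0; first by rewrite /Q q0 comp_poly0 size_poly0.
  apply: leq_trans (size_comp_poly_leq _ _) _.
  by rewrite size_XaddC muln1 prednK // lt0n size_poly_eq0.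
have cp (p : {poly R}) : continuous (fun t => p.[t]) := @continuous_horner R p.
have cDM j : continuous (fun t => D.[t] * (t - 1 / 2) ^+ j).
  have -> : (fun t => D.[t] * (t - 1 / 2) ^+ j) = fun t => (D * ('X - (1 / 2)%:P) ^+ j).[t].
    by apply/funext => t; rewrite hornerM horner_exp hornerXsubC.
  exact: cp.
have Dq0 : \int[leb]_(t in `[0, 1]) (D.[t] * q.[t]) = 0.
  have E t : D.[t] * q.[t] = \sum_(j < k) Q`_j * (D.[t] * (t - 1 / 2) ^+ j).
    have -> : q.[t] = Q.[t - 1 / 2].
      by rewrite horner_comp hornerD hornerX hornerC subrK.
    rewrite (horner_coef_wide _ sQ) mulr_sumr; apply: eq_bigr => j _; exact: mulrCA.
  under eq_Rintegral do rewrite E.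
  rewrite Rintegral_sum //; last first.
    move=> j; apply: integrableZ_fun => //; exact: continuous_integrable_itv.
  rewrite big1 // => j _; rewrite RintegralZl //; last exact: continuous_integrable_itv.
  by rewrite DM // mulr0.
pose G (t : R) := - (D * q).[t].
have GE t : G t = t * (1 - t) * q.[t] ^+ 2.
  by rewrite /G Dq !hornerM !hornerXsubC subr0; ring.
have G0 t : 0 < t < 1 -> G t = 0.
  apply: continuous_ge0_integral_eq0.
  - by move=> x; apply: cvgN; exact: cp.
  - by move=> x /andP[x0 x1]; rewrite GE mulr_ge0 ?sqr_ge0 // mulr_ge0 // subr_ge0.
  - transitivity (- 1 * \int[leb]_(t in `[0, 1]) (D.[t] * q.[t])).
      rewrite -RintegralZl //; first by apply: eq_Rintegral => x _; rewrite /G hornerM mulN1r.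
      have -> : (fun t => D.[t] * q.[t]) = fun t => (D * q).[t].
        by apply/funext => x; rewrite hornerM.
      exact: continuous_integrable_itv.
    by rewrite Dq0 mulr0.
move=> t /andP[t0 t1].
have [->|nt0] := eqVneq t 0; first by [].
have [->|nt1] := eqVneq t 1; first by [].
have t01 : 0 < t < 1 by rewrite !lt_neqAle t0 t1 eq_sym nt0 nt1.
have /eqP := G0 _ t01; rewrite GE; case/andP: t01 => t0' t1'.
rewrite !mulf_eq0 (gt_eqF t0') subr_eq0 (gt_eqF t1') /= ?orbb => /eqP qt.
by rewrite Dq !hornerM qt !mul0r.
Qed.

Lemma distE (a b : R * R) : dist a b ^+ 2 = dotp (b - a) (b - a).
Proof.
have h (x : R * R) : 0 <= dotp x x by rewrite addr_ge0 // -expr2 sqr_ge0.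
by rewrite sqr_sqrtr // /dotp /=; ring.
Qed.

Lemma dist_gt0 (a b : R * R) : a <> b -> 0 < dist a b.
Proof.
move=> ab; rewrite lt_neqAle sqrtr_ge0 andbT eq_sym; apply/eqP => d0; apply: ab.
have := distE a b; rewrite d0 expr0n /= /dotp -!expr2 => /esym/eqP.
rewrite paddr_eq0 ?sqr_ge0 // !sqrf_eq0 !subr_eq0.
by case: a b {d0} => [a1 a2] [b1 b2] /= /andP[/eqP-> /eqP->].
Qed.

Lemma Pol_edge_Pol a b (r : nat) f : @Pol R r f ->
  exists2 p : {poly R}, (size p <= r.+1)%N & forall t, f (lin a b t) = p.[t].
Proof.
move=> [c ->].
pose l1 : {poly R} := a.1%:P + (b.1 - a.1)%:P * 'X.
pose l2 : {poly R} := a.2%:P + (b.2 - a.2)%:P * 'X.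
have sl (x y : R) : (size (x%:P + y%:P * 'X)%R <= 2)%N.
  rewrite (leq_trans (size_polyD _ _)) // geq_max (leq_trans (size_polyC_leq1 _)) //=.
  by rewrite mul_polyC (leq_trans (size_scale_leq _ _)) // size_polyX.
have sX (l : {poly R}) i : (size l <= 2)%N -> (size (l ^+ i) <= i.+1)%N.
  move=> l2'; rewrite (leq_trans (size_poly_exp_leq _ _)) // ltnS.
  by rewrite -[leqRHS]mul1n leq_mul2r; case: (size l) l2' => [|[|[]]] //=; rewrite orbT.
exists (\sum_(i < r.+1) \sum_(j < r.+1 | (i + j <= r)%N) (c i j)%:P * l1 ^+ i * l2 ^+ j).
  apply: (leq_trans (size_sum _ _ _)); apply/bigmax_leqP => i _.
  apply: (leq_trans (size_sum _ _ _)); apply/bigmax_leqP => j ij.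
  rewrite -mulrA mul_polyC (leq_trans (size_scale_leq _ _)) //.
  rewrite (leq_trans (size_polyMleq _ _)) //.
  have := leq_add (sX l1 i (sl _ _)) (sX l2 j (sl _ _)); rewrite addSn addnS.
  by move=> h; rewrite -ltnS; move: h; case: (_ + _)%N => [|s] //=; rewrite ltnS => h;
    apply: leq_trans h _; rewrite ltnS.
move=> t; rewrite horner_sum; apply: eq_bigr => i _.
rewrite horner_sum; apply: eq_bigr => j _.
by rewrite !hornerM !horner_exp !hornerE /= (mulrC t) (mulrC t).
Qed.

(** The barycentric coordinate of the opposite vertex, of index [ordS (ordS j)], vanishes along the
    edge. *)
Lemma bubble_edge (T : 'I_3 -> R * R) j t : bubble T (lin (T j) (T (ordS j)) t) = 0.
Proof.
rewrite /bubble (bigD1 (ordS (ordS j))) //= /bary_coord.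
have -> : ordS (ordS (ordS j)) = j by apply/val_inj; elim/ord3P: j.
rewrite (_ : cross (T j - _) _ = 0) ?mul0r //.
case: (T j) (T (ordS j)) => [a1 a2] [b1 b2]; rewrite /cross /lin /=.
ring.
Qed.

Lemma lin_rev (a b : R * R) t : lin b a t = lin a b (1 - t).
Proof. by rewrite /lin; congr (_, _); ring. Qed.

Context n (P : 'I_n -> R * R) (K : set (R * R)) N (T : 'I_N -> 'I_3 -> R * R) (k : nat).

(** An edge of [K] is a full edge of a triangle, where the bubble terms vanish; their higher degree
    is therefore invisible there. *)
Lemma Vmacro_edge sigma f i : triangulation sigma P K T -> Vmacro K T k.+1 f ->
  Pol_edge (P i) (P (ordS i)) k.+1 f.
Proof.
move=> [_ _ _ _ /(_ i)[l [j hj]]] [_ /(_ l)[g [p [q0 [q1 [q2 [pp _ _ _ gE]]]]] fg]].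
have fp t : 0 <= t <= 1 -> f (lin (P i) (P (ordS i)) t) = p (lin (P i) (P (ordS i)) t).
  have bary s : 0 <= s <= 1 -> f (lin (T l j) (T l (ordS j)) s) = p (lin (T l j) (T l (ordS j)) s).
    move=> /andP[s0 s1]; rewrite fg.
      by rewrite gE bubble_edge !mul0r !addr0.
    exists (fun m => if m == j then 1 - s else if m == ordS j then s else 0); split.
    - by move=> m; case: ifP => _; [rewrite subr_ge0|case: ifP].
    - by [].
    - by rewrite sum3; elim/ord3P: j {hj}; rewrite !ordS3 /=; ring.
    - by rewrite sum3; elim/ord3P: j {hj}; rewrite !ordS3 /=; ring.
    - by rewrite sum3; elim/ord3P: j {hj}; rewrite !ordS3 /=; ring.
  move=> t01; case: hj => -[<- <-]; first exact: bary.
  (* The triangle may run through the edge in the direction opposite to that of the polygon. *)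
  rewrite [lin _ _ _]lin_rev; apply: bary; case/andP: t01 => ? ?; apply/andP; split; lra.
have [q sq pq] := Pol_edge_Pol (P i) (P (ordS i)) pp.
by exists q; split => // t t01; rewrite fp.
Qed.

Lemma interp_boundary rho sigma v f : mesh_polygon rho P K -> triangulation sigma P K T ->
  (1 <= k)%N -> Vnc P K k v -> is_interp P K T k v f ->
  forall x, boundary P x -> f x = v x.
Proof.
move=> [[n3 injP _ _ _] _ _] tr k1 [[_ _ [_ vB] _] _ _] [Vf [fV _ fE _ _]] x [i _ [t t01 <-]].
have [p [sp hp]] := Vmacro_edge i tr Vf.
have [q [sq hq]] := vB i.
(* An index equal to its cyclic successor would force [n = 1]. *)
have ab : P i <> P (ordS i).
  move/injP => /(congr1 val) /=; have := ltn_ord i; rewrite leq_eqVlt => /orP[/eqP in_|in_].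
    rewrite in_ modnn => i0; move: n3; rewrite -in_; move: i0 => /= ->.
    by [].
  by rewrite modn_small // => /esym/eqP; rewrite (gtn_eqF (ltnSn _)).
have d0 := dist_gt0 ab.
have lin0 : lin (P i) (P (ordS i)) 0 = P i.
  by rewrite /lin !mul0r !addr0 -surjective_pairing.
have lin1 : lin (P i) (P (ordS i)) 1 = P (ordS i).
  by rewrite /lin !mul1r !(addrC _ (_ - _)) !subrK -surjective_pairing.
apply/eqP; rewrite -subr_eq0; move: t01; rewrite /= in_itv /= => t01.
rewrite hp // hq // -hornerN -hornerD; apply/eqP.
apply: (@edge_poly_eq0 k) => //.
- by rewrite (leq_trans (size_polyD _ _)) // geq_max sp size_polyN sq.
- by rewrite hornerD hornerN -hp ?lexx ?ler01 // -hq ?lexx ?ler01 // lin0 fV subrr.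
- by rewrite hornerD hornerN -hp ?lexx ?ler01 // -hq ?lexx ?ler01 // lin1 fV subrr.
move=> j jk.
have jk' : (j%:Z <= k%:Z - 1)%R by rewrite lerBrDr -[1]/(1%:Z) -PoszD lez_nat addn1.
have := fE i _ (ex_intro _ j (conj jk' erefl)).
rewrite /int_seg => /eqP; rewrite mulf_eq0 (gt_eqF d0) /= => /eqP I0; rewrite -[RHS]I0.
apply: eq_Rintegral => s; rewrite inE /= in_itv /= => s01.
rewrite hornerD hornerN -hp // -hq //; congr (_ * _ ^+ _).
(* On the edge, the scaled tangential coordinate of [Mon_edge] is [s - 1 / 2]. *)
apply/esym; apply: (canLR (mulfK _)); first by rewrite expf_neq0 // gt_eqF.
by rewrite distE /dotp /lin /=; ring.
Qed.

End Edges.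

(** * Orthogonal projection onto finitely many functions *)

Section Projection.
Context d (X : measurableType d) (R : realType) (mu : {measure set X -> \bar R}).
Variable D : set X.
Hypothesis mD : measurable D.
Implicit Types (f g h : X -> R).

Lemma Rintegral_mul_lin h f g a : sqint mu D h -> sqint mu D f -> sqint mu D g ->
  \int[mu]_(x in D) (h x * (f x + a * g x)) =
  \int[mu]_(x in D) (h x * f x) + a * \int[mu]_(x in D) (h x * g x).
Proof.
move=> sh sf sg.
have ihf : mu.-integrable D (EFin \o (fun x => h x * f x)) by exact: integrable_mul.
have ihg : mu.-integrable D (EFin \o (fun x => h x * g x)) by exact: integrable_mul.
have iahg : mu.-integrable D (EFin \o (fun x => a * (h x * g x))) by exact: integrableZ_fun.
rewrite -RintegralZl // -RintegralD //.
by apply: eq_Rintegral => x _; rewrite mulrDr (mulrCA a).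
Qed.

(** Young's inequality with weight (G + 1) / e leaves only e G / (G + 1). *)
Lemma norm0_orthogonal f g : sqint mu D f -> sqint mu D g ->
  \int[mu]_(x in D) (f x ^+ 2) = 0 -> \int[mu]_(x in D) (f x * g x) = 0.
Proof.
move=> sf sg f0; pose G := \int[mu]_(x in D) (g x ^+ 2).
have G0 : 0 <= G by apply: Rintegral_ge0 => x _; exact: sqr_ge0.
apply/eqP; rewrite -normr_le0; apply/ler_addgt0Pr => e e0; rewrite add0r.
have t0 : 0 < (G + 1) / e by rewrite divr_gt0 // ltr_wpDl.
have := young_Rintegral mD t0 sf sg; rewrite f0 mulr0 add0r -/G => h.
apply: le_trans h _; rewrite invf_div mulrAC ler_pdivrMr ?ltr_wpDl //.
by rewrite ler_pM2l // lerDl.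
Qed.

Variables (I : eqType) (e : I -> X -> R).
Hypothesis se : forall i, sqint mu D (e i).

Definition comb (s : seq I) (c : I -> R) (x : X) : R := \sum_(i <- s) c i * e i x.

Lemma sqint_comb s c : sqint mu D (comb s c).
Proof. by apply: sqint_sum => // i; exact: sqintZ. Qed.

Lemma comb_orthogonal s c h : sqint mu D h ->
  (forall i, i \in s -> \int[mu]_(x in D) (h x * e i x) = 0) ->
  \int[mu]_(x in D) (h x * comb s c x) = 0.
Proof.
move=> sh; elim: s => [|i s IH] h0.
  rewrite (_ : \int[mu]_(x in D) _ = \int[mu]_(x in D) 0).
    by rewrite /Rintegral integral0.
  by apply: eq_Rintegral => x _; rewrite /comb big_nil mulr0.
transitivity (\int[mu]_(x in D) (h x * (comb s c x + c i * e i x))).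
  by apply: eq_Rintegral => x _; rewrite /comb big_cons addrC.
rewrite Rintegral_mul_lin //; last exact: sqint_comb.
rewrite IH ?h0 ?mem_head ?mulr0 ?addr0 // => j js.
by rewrite h0 // inE js orbT.
Qed.

(* Gram-Schmidt; [e i] may be a null vector modulo the others, in which case it
   is orthogonal to everything by [norm0_orthogonal]. *)
Lemma projection_exists s v : uniq s -> sqint mu D v ->
  exists c, forall i, i \in s -> \int[mu]_(x in D) ((v x - comb s c x) * e i x) = 0.
Proof.
elim: s v => [v _ _|i s IH v /= /andP[nis us] sv]; first by exists (fun=> 0).
have [c1 h1] := IH _ us sv; have [c0 h0] := IH _ us (se i).
pose e' x := e i x - comb s c0 x.
have se' : sqint mu D e' by apply: sqintB => //; exact: sqint_comb.
pose z x := v x - comb s c1 x.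
have sz : sqint mu D z by apply: sqintB => //; exact: sqint_comb.
pose A := \int[mu]_(x in D) (e' x ^+ 2).
pose a := (\int[mu]_(x in D) (z x * e' x)) / A.
exists (fun j => if j == i then a else c1 j - a * c0 j).
have E x : v x - comb (i :: s) (fun j => if j == i then a else c1 j - a * c0 j) x =
    z x - a * e' x.
  rewrite /comb big_cons eqxx /z /e' mulrBr.
  have -> : \sum_(j <- s) (if j == i then a else c1 j - a * c0 j) * e j x =
      comb s c1 x - a * comb s c0 x.
    rewrite /comb mulr_sumr -sumrB !big_seq; apply: eq_bigr => j js.
    by case: eqP => [ji|_]; [rewrite -ji js in nis|rewrite mulrBl mulrA].
  by ring.
have szae : sqint mu D (fun x => z x - a * e' x).
  by apply: sqintB => //; exact: sqintZ.
have os j : j \in s -> \int[mu]_(x in D) ((z x - a * e' x) * e j x) = 0.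
  move=> js; transitivity (\int[mu]_(x in D) (e j x * (z x + (- a) * e' x))).
    by apply: eq_Rintegral => x _; rewrite mulrC mulNr.
  rewrite Rintegral_mul_lin //.
  under eq_Rintegral do rewrite mulrC; rewrite h1 // add0r.
  by under eq_Rintegral do rewrite mulrC; rewrite h0 // mulr0.
move=> j; rewrite inE => /orP[/eqP ->|js]; last first.
  by rewrite -(os _ js); apply: eq_Rintegral => x _; rewrite E.
transitivity (\int[mu]_(x in D) ((z x - a * e' x) * (e' x + 1 * comb s c0 x))).
  by apply: eq_Rintegral => x _; rewrite E mul1r subrK.
rewrite Rintegral_mul_lin //; last exact: sqint_comb.
rewrite comb_orthogonal // mulr0 addr0.
transitivity (\int[mu]_(x in D) (e' x * (z x + (- a) * e' x))).
  by apply: eq_Rintegral => x _; rewrite mulrC mulNr.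
rewrite Rintegral_mul_lin //.
have -> : \int[mu]_(x in D) (e' x * z x) = \int[mu]_(x in D) (z x * e' x).
  by apply: eq_Rintegral => x _; rewrite mulrC.
have -> : \int[mu]_(x in D) (e' x * e' x) = A by [].
have [A0|A0] := eqVneq A 0; last by rewrite mulNr divfK // subrr.
rewrite A0 mulr0 addr0 -[RHS](norm0_orthogonal se' sz A0).
by apply: eq_Rintegral => x _; rewrite mulrC.
Qed.

End Projection.

(** * Polynomial projections and moments *)

Section Moments.
Variable R : realType.

Definition mono m (i : 'I_m.+1 * 'I_m.+1) (x : R * R) : R := x.1 ^+ i.1 * x.2 ^+ i.2.

Lemma Pol_comb (m : nat) : exists2 s : seq ('I_m.+1 * 'I_m.+1)%type, uniq s &
  (forall i, i \in s -> (i.1 + i.2 <= m)%N) /\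
  forall f : R * R -> R, Pol m f <->
    exists c : _ -> R, f = fun x => \sum_(i <- s) c i * mono i x.
Proof.
pose s := [seq i : 'I_m.+1 * 'I_m.+1 <- index_enum ('I_m.+1 * 'I_m.+1)%type | (i.1 + i.2 <= m)%N].
exists s; first by rewrite filter_uniq // index_enum_uniq.
split; first by move=> i; rewrite mem_filter => /andP[].
move=> f; split => [[c ->]|[c ->]].
  exists (fun i : 'I_m.+1 * 'I_m.+1 => c i.1 i.2); apply/funext => x.
  rewrite big_filter pair_big_dep /=.
  by apply: eq_bigr => i _; rewrite /mono mulrA.
exists (fun i j => c (inord i, inord j)); apply/funext => x.
rewrite big_filter pair_big_dep /=.
by apply: eq_bigr => i _; rewrite /mono !inord_val -surjective_pairing mulrA.
Qed.

Lemma smooth_mono m (i : 'I_m.+1 * 'I_m.+1) : smooth (mono i).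
Proof. by apply: smoothM; apply: smoothX; [exact: smooth_fst|exact: smooth_snd]. Qed.

Lemma sqint_smooth (K : set (R * R)) f : compact K -> smooth f -> sqint (leb2 R) K f.
Proof. by move=> cK sf; apply: sqint_continuous => //; exact: smooth_continuous. Qed.

(** [Qproj] is a choice with default 0; Gram-Schmidt on the monomials supplies the existence that
    gives access to its defining properties. *)
Lemma QprojP (K : set (R * R)) (m : nat) v : compact K -> sqint (leb2 R) K v ->
  Pol m (Qproj K m v) /\
  forall q, Pol m q -> dotL2 K (Qproj K m v) q = dotL2 K v q.
Proof.
move=> cK sv; have mK := compact_measurable2 cK.
suff [p hp] : exists p, Pol m p /\ forall q, Pol m q -> dotL2 K p q = dotL2 K v q.
  by rewrite /Qproj; case: xgetP => [q -> //|/(_ p)].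
have [s us [_ sP]] := Pol_comb m.
pose e : 'I_m.+1 * 'I_m.+1 -> R * R -> R := @mono m.
have se i : sqint (leb2 R) K (e i) by apply: sqint_smooth => //; exact: smooth_mono.
have [c hc] : exists c, forall i, i \in s ->
    \int[leb2 R]_(x in K) ((v x - comb e s c x) * e i x) = 0.
  by apply: projection_exists.
exists (comb e s c); split; first by apply/sP; exists c.
move=> q /sP[c' ->].
have sc a : sqint (leb2 R) K (comb e s a) by exact: sqint_comb.
have svc : sqint (leb2 R) K (fun x => v x - comb e s c x) by exact: sqintB.
have orth : \int[leb2 R]_(x in K) ((v x - comb e s c x) * comb e s c' x) = 0.
  by apply: comb_orthogonal.
have iv : (leb2 R).-integrable K (EFin \o (fun x => v x * comb e s c' x)) by exact: integrable_mul.
have ic : (leb2 R).-integrable K (EFin \o (fun x => comb e s c x * comb e s c' x)).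
  by exact: integrable_mul.
move: orth; under eq_Rintegral do rewrite mulrBl.
by rewrite RintegralB // => /eqP; rewrite subr_eq0 => /eqP/esym.
Qed.

Lemma Mon_orthogonal (S : set (R * R)) (m : nat) z q : compact S -> diam S != 0 ->
  sqint (leb2 R) S z -> (forall q, Mon S m%:Z q -> dotL2 S z q = 0) ->
  Pol m q -> dotL2 S z q = 0.
Proof.
move=> cS d0 sz hz; have mS := compact_measurable2 cS.
have [s us [sm sP]] := Pol_comb m.
pose X1 (x : R * R) := (x.1 - (bary S).1) / diam S.
pose X2 (x : R * R) := (x.2 - (bary S).2) / diam S.
have E1 x : x.1 = (bary S).1 + diam S * X1 x.
  by rewrite /X1 mulrC divfK // addrC subrK.
have E2 x : x.2 = (bary S).2 + diam S * X2 x.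
  by rewrite /X2 mulrC divfK // addrC subrK.
have sX1 : smooth X1.
  apply: smoothM; last exact: smooth_cst.
  by apply: smoothB; [exact: smooth_fst|exact: smooth_cst].
have sX2 : smooth X2.
  apply: smoothM; last exact: smooth_cst.
  by apply: smoothB; [exact: smooth_snd|exact: smooth_cst].
(* Mixed monomials in plain and scaled coordinates: one plain factor at a time is replaced by
   barycenter plus diameter times scaled coordinate, without raising the degree, until only scaled
   factors remain. *)
pose M a b i j (x : R * R) := x.1 ^+ a * X1 x ^+ i * (x.2 ^+ b * X2 x ^+ j).
have sM a b i j : sqint (leb2 R) S (M a b i j).
  apply: sqint_smooth => //.
  by do 2![apply: smoothM]; apply: smoothX;
    [exact: smooth_fst|exact: sX1|exact: smooth_snd|exact: sX2].
have step f g h al be : (forall x, f x = al * g x + be * h x) ->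
    sqint (leb2 R) S g -> sqint (leb2 R) S h ->
    \int[leb2 R]_(x in S) (z x * g x) = 0 -> \int[leb2 R]_(x in S) (z x * h x) = 0 ->
    \int[leb2 R]_(x in S) (z x * f x) = 0.
  move=> fE sg sh g0 h0.
  have sag : sqint (leb2 R) S (fun x => al * g x) by exact: sqintZ.
  transitivity (\int[leb2 R]_(x in S) (z x * (al * g x + be * h x))).
    by apply: eq_Rintegral => x _; rewrite fE.
  have -> : \int[leb2 R]_(x in S) (z x * (al * g x + be * h x)) =
      \int[leb2 R]_(x in S) (z x * (al * g x)) + be * \int[leb2 R]_(x in S) (z x * h x).
    exact: Rintegral_mul_lin.
  rewrite h0 mulr0 addr0; under eq_Rintegral do rewrite mulrCA.
  rewrite RintegralZl // ?g0 ?mulr0 //; exact: integrable_mul.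
have key a b i j : (a + i + (b + j) <= m)%N -> \int[leb2 R]_(x in S) (z x * M a b i j x) = 0.
  elim: a i => [|a IHa] i.
    rewrite add0n; elim: b j => [|b IHb] j le_m.
      rewrite -[RHS](hz (fun x => X1 x ^+ i * X2 x ^+ j)); last by exists i, j.
      by apply: eq_Rintegral => x _; rewrite /M !expr0 !mul1r.
    apply: (step _ (M 0 b i j) (M 0 b i j.+1) (bary S).2 (diam S)) => //.
    - by move=> x; rewrite /M {1}exprS {1}E2 exprS; ring.
    - by apply: IHb; rewrite (leq_trans _ le_m) // leq_add2l addSn.
    - by apply: IHb; rewrite addnS -addSn.
  move=> le_m.
  apply: (step _ (M a b i j) (M a b i.+1 j) (bary S).1 (diam S)) => //.
  - by move=> x; rewrite /M {1}exprS {1}E1 exprS; ring.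
  - by apply: IHa; rewrite (leq_trans _ le_m) // leq_add2r addSn.
  - by apply: IHa; rewrite addnS -addSn.
move=> /sP[c ->].
pose e : 'I_m.+1 * 'I_m.+1 -> R * R -> R := @mono m.
have se i : sqint (leb2 R) S (e i).
  by apply: sqint_smooth => //; exact: smooth_mono.
suff : \int[leb2 R]_(x in S) (z x * comb e s c x) = 0 by [].
apply: comb_orthogonal => // i /sm im.
rewrite -[RHS](key i.1 i.2 0%N 0%N) ?addn0 //.
by apply: eq_Rintegral => x _; rewrite /M !expr0 !mulr1.
Qed.

End Moments.

(** * Weak gradients and the final identity *)

Section InterpolantGradient.
Variable R : realType.
Implicit Types (K : set (R * R)) (v w f : R * R -> R) (F G : R * R -> R * R).

Lemma L2_sqint K f : compact K -> L2 K f <-> sqint (leb2 R) K f.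
Proof.
move=> cK; have mK := compact_measurable2 cK.
have E : EFin \o (fun x => (f \_ K) x ^+ 2) = (EFin \o (fun x => f x ^+ 2)) \_ K.
  apply/funext => x; rewrite /patch /=; case: ifP => // _.
  by rewrite expr0n.
split => [Lf|[mf if2]].
- split.
    move: Lf; rewrite /L2 inE => /andP[+ _]; rewrite inE /= => mf.
    exact/measurable_restrictT.
  have [_] := integrable_mkcond (mu := leb2 R) (EFin \o (fun x => f x ^+ 2)) mK.
  by apply; rewrite -E; exact: Lfun2_integrable_sqr.
- have mfK : measurable_fun setT (f \_ K) by apply/(measurable_restrictT _ mK).
  rewrite /L2 inE; apply/andP; split; rewrite inE //=.
  apply: (@lty_poweRy _ _ 2) => //; rewrite powR_Lnorm //.
  have := integrable_mkcond (mu := leb2 R) (EFin \o (fun x => f x ^+ 2)) mK.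
  move=> [+ _] => /(_ if2); rewrite -E => /integrableP[_].
  apply: le_lt_trans; rewrite le_eqVlt; apply/orP; left; apply/eqP.
  apply: eq_integral => x _; rewrite poweR_EFin abse_EFin.
  by rewrite powR_mulrn // normrX.
Qed.

Definition gcomp (b : bool) G (x : R * R) : R := if b then (G x).1 else (G x).2.

Lemma wgradP K v : compact K -> (exists G, is_wgrad K v G) ->
  (forall b, sqint (leb2 R) K (gcomp b (wgrad K v))) /\
  forall b phi, test K phi -> \int[leb2 R]_(x in K) (gcomp b (wgrad K v) x * phi x) =
    - \int[leb2 R]_(x in K) (v x * dd b phi x).
Proof.
move=> cK /(xgetPex (fun=> (0, 0) : R * R)); rewrite -/(wgrad K v) => -[L1 L2' h].
split=> [[]|[] phi /h[]]; [exact/L2_sqint|exact/L2_sqint| |].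
- by rewrite /dotL2 => h1 _; rewrite -[LHS]opprK -h1.
- by rewrite /dotL2 => _ h2; rewrite -[LHS]opprK -h2.
Qed.

Lemma dotL2vE K F G : measurable (K : set (measurableTypeR R * measurableTypeR R)) ->
  (forall b, sqint (leb2 R) K (gcomp b F)) -> (forall b, sqint (leb2 R) K (gcomp b G)) ->
  dotL2v K F G = \int[leb2 R]_(x in K) (gcomp true F x * gcomp true G x) +
                 \int[leb2 R]_(x in K) (gcomp false F x * gcomp false G x).
Proof.
move=> mK sF sG.
have i b : (leb2 R).-integrable K (EFin \o (fun x => gcomp b F x * gcomp b G x)).
  exact: integrable_mul.
by rewrite -RintegralD.
Qed.

(** The sequence defining the trace, with the convergence of gradients split into components: each
    is dominated by the full norm. *)
Lemma H1_approx n (P : 'I_n -> R * R) K v : compact K -> H1 P K v ->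
  exists u : nat -> R * R -> R, [/\ forall m, smooth (u m),
    \int[leb2 R]_(x in K) ((u m x - v x) ^+ 2) @[m --> \oo] --> (0 : R),
    forall b, \int[leb2 R]_(x in K) ((dd b (u m) x - gcomp b (wgrad K v) x) ^+ 2)
      @[m --> \oo] --> (0 : R) &
    int_bd P (fun x => (u m x - v x) ^+ 2) @[m --> \oo] --> (0 : R)].
Proof.
move=> cK [_ exG [_ [u [su u0 ug ub]]]]; exists u; split => // b.
have mK := compact_measurable2 cK.
have [sG _] := wgradP cK exG.
have sd m b' : sqint (leb2 R) K (gcomp b' (fun x => cgrad (u m) x - wgrad K v x)).
  have h : sqint (leb2 R) K (fun x => dd b' (u m) x - gcomp b' (wgrad K v) x).
    by apply: sqintB => //; apply: sqint_smooth => //; exact: smooth_dd.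
  by case: b' h.
apply: (squeeze_cvgr _ (cvg_cst 0) ug); apply: nearW => m.
rewrite dotL2vE //; apply/andP; split.
  by apply: Rintegral_ge0 => x _; exact: sqr_ge0.
have p0 b' : 0 <= \int[leb2 R]_(x in K)
    (gcomp b' (fun x => cgrad (u m) x - wgrad K v x) x *
     gcomp b' (fun x => cgrad (u m) x - wgrad K v x) x).
  by apply: Rintegral_ge0 => x _; exact: sqr_ge0.
by case: b; [rewrite lerDl|rewrite lerDr]; exact: p0.
Qed.

Lemma dist_le_diam K x y : compact K -> K x -> K y -> dist x y <= diam K.
Proof.
move=> cK Kx Ky; apply: ub_le_sup; last by exists x => //; exists y.
have [M M0 hM] := compact_bounded2 cK.
(* Each coordinate differs by at most 2M. A finite upper bound is needed for [sup] to dominate its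
   set. *)
exists (Num.sqrt (8 * M ^+ 2)) => _ [a Ka [b Kb <-]].
apply: ler_wsqrtr; rewrite /dotp /=.
have sq (s t : R) : `|s| <= M -> `|t| <= M -> (s - t) * (s - t) <= 4 * M ^+ 2.
  rewrite !ler_norml => /andP[? ?] /andP[? ?]; nra.
have [a1 a2] := hM _ Ka; have [b1 b2] := hM _ Kb.
have := sq _ _ a1 b1; have := sq _ _ a2 b2; lra.
Qed.

Lemma diam_gt0 K x y : compact K -> K x -> K y -> x <> y -> 0 < diam K.
Proof. by move=> cK Kx Ky /dist_gt0 d0; exact: lt_le_trans d0 (dist_le_diam cK Kx Ky). Qed.

Context (rho sigma : R) (n : nat) (P : 'I_n -> R * R) (K : set (R * R))
  (N : nat) (T : 'I_N -> 'I_3 -> R * R) (k : nat).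
Hypothesis rho0 : 0 < rho.
Hypothesis sigma0 : 0 < sigma.
Hypothesis KP : mesh_polygon rho P K.
Hypothesis KT : triangulation sigma P K T.

Let cK : compact K.
Proof. by case: KP => -[]. Qed.

Let mK := compact_measurable2 cK.

Let diamK : 0 < diam K.
Proof.
have [[n3 injP _ _ bd] _ _] := KP.
have KPi i : K (P i).
  have [] // : (closure K `\` interior K) (P i).
    rewrite bd; exists i => //; exists 0; first by rewrite /= in_itv /= lexx ler01.
    by rewrite /lin !mul0r !addr0 -surjective_pairing.
  by rewrite -(closure_id K).1 //; exact: compact_closed2.
have n0 : (0 < n)%N by exact: leq_trans n3.
have n1 : (1 < n)%N by exact: leq_trans n3.
by apply: (diam_gt0 cK (KPi (Ordinal n0)) (KPi (Ordinal n1))) => /injP.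
Qed.

Lemma diam_triangle_gt0 i : 0 < diam (triangle (T i)).
Proof.
by have [_ _ _ /(_ i) h _] := KT; apply: lt_le_trans h; exact: mulr_gt0.
Qed.

Lemma mesh_triangulation : mesh P K T.
Proof.
have [[_ _ _ _ bd] _ _] := KP; have [KE Tc Td _ _] := KT.
split=> // j; have [c [r [rd sub]]] := Td j.
by apply: disc_nondeg sub; apply: lt_le_trans rd; rewrite mulr_gt0 // diam_triangle_gt0.
Qed.
Let PKT := mesh_triangulation.

(** Against a polynomial of degree at most k + 1, [v] may be replaced on [K] by its projection; the
    moments of the interpolant then match triangle by triangle. *)
Lemma moment_orthogonal v Iv p : sqint (leb2 R) K v -> sqint (leb2 R) K Iv ->
  is_interp P K T k v Iv -> Pol k.+1 p ->
  \int[leb2 R]_(x in K) ((Iv x - v x) * p x) = 0.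
Proof.
move=> sv sI [_ [_ _ _ _ mom]] pp.
have [Qp Qv] := QprojP k.+1 cK sv; set Q := Qproj K k.+1 v in Qp Qv mom.
have sp : sqint (leb2 R) K p by apply: sqint_smooth => //; exact: smooth_Pol pp.
have sQ : sqint (leb2 R) K Q by apply: sqint_smooth => //; exact: smooth_Pol Qp.
have sIQ : sqint (leb2 R) K (fun x => Iv x - Q x) by exact: sqintB.
have iIQ : (leb2 R).-integrable K (EFin \o (fun x => (Iv x - Q x) * p x)).
  exact: integrable_mul.
have iQp : (leb2 R).-integrable K (EFin \o (fun x => Q x * p x)) by exact: integrable_mul.
have ivp : (leb2 R).-integrable K (EFin \o (fun x => v x * p x)) by exact: integrable_mul.
have iIp : (leb2 R).-integrable K (EFin \o (fun x => Iv x * p x)) by exact: integrable_mul.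
have -> : \int[leb2 R]_(x in K) ((Iv x - v x) * p x) =
    \int[leb2 R]_(x in K) ((Iv x - Q x) * p x).
  under eq_Rintegral do rewrite mulrBl.
  under [RHS]eq_Rintegral do rewrite mulrBl.
  by rewrite !RintegralB //; congr (_ - _); exact/esym/Qv.
rewrite (mesh_integral_sum PKT iIQ) big1 // => i _.
have cT : compact (triangle (T i)) by exact: (mesh_triangle_compact PKT).
apply: (Mon_orthogonal cT _ _ (mom i) pp); first by rewrite gt_eqF // diam_triangle_gt0.
have [mIQ iIQ2] := sIQ; split.
  by apply: measurable_funS mIQ => //; exact: (mesh_triangle_sub PKT).
apply: integrableS iIQ2 => //; last exact: (mesh_triangle_sub PKT).
exact: (mesh_triangle_measurable PKT).
Qed.

Lemma interp_wgrad v Iv w : (1 <= k)%N -> Vnc P K k v -> is_interp P K T k v Iv ->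
  Vnc P K k w -> dotL2v K (wgrad K Iv) (wgrad K w) = dotL2v K (wgrad K v) (wgrad K w).
Proof.
move=> k1 Vv Ii Vw.
have Ib := interp_boundary KP KT k1 Vv Ii.
have [[H1v _ [_ vB] _] _ _] := Vv; have [[H1w [p pp wp] _ _] _ _] := Vw.
have [L2v exGv _] := H1v; have [L2w exGw _] := H1w.
have sv : sqint (leb2 R) K v by exact/L2_sqint.
have [u [su u0 ug ub]] := H1_approx cK H1v.
have [y [sy _ yg _]] := H1_approx cK H1w.
have [sGv _] := wgradP cK exGv; have [sGw _] := wgradP cK exGw.
have [[cIv Vg] _] := Ii.
have /choice[g hg] : forall j, exists g, smooth g /\ forall x, triangle (T j) x -> Iv x = g x.
  by move=> j; have [g0 Vg0 Ig0] := Vg j; exists g0; split => //; exact: smooth_VT Vg0.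
have sg j : smooth (g j) by case: (hg j).
have Ig j x : triangle (T j) x -> Iv x = g j x by case: (hg j) => _; apply.
have sI : sqint (leb2 R) K Iv by exact: sqint_compact.
have ev : edge_continuous P v.
  move=> i; have [q [_ qv]] := vB i; exists (fun t => q.[t]) => //.
  exact: continuous_horner.
have eI : edge_continuous P Iv.
  move=> i; have [H cH hH] := ev i; exists H => // t t01; rewrite -hH //.
  by apply: Ib; exists i => //; exists t => //; rewrite /= in_itv.
have spg b : sqint (leb2 R) K (pgrad T g b) by exact: (sqint_pgrad PKT sg).
have pgw := pgrad_weak PKT cIv sg Ig eI.
(* Existence guarantees that [wgrad K Iv] is a weak gradient and not the default value of the
   choice. *)
have exGI : exists G, is_wgrad K Iv G.
  exists (fun x => (pgrad T g true x, pgrad T g false x)); split.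
  - by apply/L2_sqint => //; exact: spg.
  - by apply/L2_sqint => //; exact: spg.
  - by move=> f tf; split; rewrite /dotL2; apply/esym; rewrite -[RHS]opprK; congr (- _);
      [exact: (pgw true)|exact: (pgw false)].
have [sGI GIw] := wgradP cK exGI.
(* [wgrad K Iv] is only one of the weak gradients of [Iv]; they need not be
   compared almost everywhere, only against limits of smooth functions. *)
have unique b : \int[leb2 R]_(x in K) (gcomp b (wgrad K Iv) x * gcomp b (wgrad K w) x) =
    \int[leb2 R]_(x in K) (pgrad T g b x * gcomp b (wgrad K w) x).
  have sd : sqint (leb2 R) K (fun x => gcomp b (wgrad K Iv) x - pgrad T g b x).
    exact: sqintB.
  have sy' m : sqint (leb2 R) K (dd b (y m)).
    by apply: sqint_smooth => //; exact: smooth_dd.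
  have iGI f : sqint (leb2 R) K f ->
      (leb2 R).-integrable K (EFin \o (fun x => gcomp b (wgrad K Iv) x * f x)).
    by move=> sf; exact: integrable_mul.
  have ipg f : sqint (leb2 R) K f ->
      (leb2 R).-integrable K (EFin \o (fun x => pgrad T g b x * f x)).
    by move=> sf; exact: integrable_mul.
  have split f : sqint (leb2 R) K f ->
      \int[leb2 R]_(x in K) ((gcomp b (wgrad K Iv) x - pgrad T g b x) * f x) =
      \int[leb2 R]_(x in K) (gcomp b (wgrad K Iv) x * f x) -
      \int[leb2 R]_(x in K) (pgrad T g b x * f x).
    move=> sf; rewrite -RintegralB //; [|exact: iGI|exact: ipg].
    by apply: eq_Rintegral => x _; rewrite mulrBl.
  apply/eqP; rewrite -subr_eq0 -split //; apply/eqP.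
  (* Both functions are weak derivatives of [Iv], so their difference is orthogonal to test
     functions, hence to all smooth functions by [test_orthogonal]. *)
  have z0 m : \int[leb2 R]_(x in K) (dd b (y m) x *
      (gcomp b (wgrad K Iv) x - pgrad T g b x)) = 0.
    under eq_Rintegral do rewrite mulrC.
    apply: test_orthogonal => //; [exact: boundary_null PKT| |exact: smooth_dd].
    move=> f tf; rewrite split ?GIw ?pgw ?subrr //.
    by case: tf => sf _; exact: sqint_smooth.
  under eq_Rintegral do rewrite mulrC.
  have lim : \int[leb2 R]_(x in K) (dd b (y m) x * (gcomp b (wgrad K Iv) x - pgrad T g b x))
      @[m --> \oo] -->
      \int[leb2 R]_(x in K) (gcomp b (wgrad K w) x * (gcomp b (wgrad K Iv) x - pgrad T g b x)).
    by apply: cvg_Rintegral_mul; [exact: mK|exact: sy'|exact: sGw|exact: sd|exact: yg].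
  apply: (cvg_unique (@norm_hausdorff _ R^o) lim).
  by rewrite (_ : (fun m => _) = cst 0); [exact: cvg_cst|apply/funext => m; exact: z0].
have sz : sqint (leb2 R) K (fun x => Iv x - v x) by exact: sqintB.
have sp : sqint (leb2 R) K p by apply: sqint_smooth => //; exact: smooth_Pol pp.
have sD b : sqint (leb2 R) K (fun x => pgrad T g b x - gcomp b (wgrad K v) x).
  exact: sqintB.
have [[c [r [rK starK]]] _] : (exists c r, rho * diam K <= r /\ star_shaped K c r) /\ True.
  by case: KP.
have r0 : 0 < r by apply: lt_le_trans rK; exact: mulr_gt0.
have appw b : approximable K (gcomp b (wgrad K w)).
  move=> e e0; have /cvgrPdist_lt/(_ e e0)[m _ /(_ m (leqnn m))] := yg b.
  rewrite sub0r normrN => /(le_lt_trans (ler_norm _)) h.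
  exists (dd b (y m)); first by apply: smooth_continuous; exact: smooth_dd.
  apply: le_lt_trans h; rewrite le_eqVlt; apply/orP; left; apply/eqP.
  by apply: eq_Rintegral => x _; rewrite -sqrrN opprB.
have app : approximable K p.
  move=> e e0; exists p; first by apply: smooth_continuous; exact: smooth_Pol pp.
  under eq_Rintegral do rewrite subrr expr0n.
  by rewrite /Rintegral integral0.
(* Here z is [Iv - v], with derivative [pgrad] minus the weak gradient of [v]; the right side
   vanishes by the moment conditions. *)
have green := star_green cK r0 starK sz sp app sD sGw appw.
rewrite (moment_orthogonal sv sI Ii pp) oppr0 in green.
have split F : (forall b, sqint (leb2 R) K (gcomp b F)) -> dotL2v K F (wgrad K w) =
    \int[leb2 R]_(x in K) (gcomp true F x * gcomp true (wgrad K w) x) +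
    \int[leb2 R]_(x in K) (gcomp false F x * gcomp false (wgrad K w) x).
  by move=> sF; apply: dotL2vE; [exact: mK|exact: sF|exact: sGw].
rewrite (split _ sGI) (split _ sGv) !unique.
apply/eqP; rewrite -subr_eq0 opprD addrACA; apply/eqP.
have iD b : \int[leb2 R]_(x in K) ((pgrad T g b x - gcomp b (wgrad K v) x) *
     gcomp b (wgrad K w) x) =
   \int[leb2 R]_(x in K) (pgrad T g b x * gcomp b (wgrad K w) x) -
   \int[leb2 R]_(x in K) (gcomp b (wgrad K v) x * gcomp b (wgrad K w) x).
  rewrite -RintegralB //; [|exact: integrable_mul|exact: integrable_mul].
  by apply: eq_Rintegral => x _; rewrite mulrBl.
rewrite -!iD; apply: green => [b phi sphi|phi tphi].
  exact: (green_limit (Gv := fun b => gcomp b (wgrad K v)) PKT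
    cIv sg Ig ev Ib sv (sGv b) su u0 (ug b) ub sphi).
have := wp phi tphi; rewrite dotL2vE; [exact|exact: mK|exact: sGw|].
move=> b; case: tphi => sphi _.
have : sqint (leb2 R) K (dd b phi) by apply: sqint_smooth => //; exact: smooth_dd.
by case: b.
Qed.

End InterpolantGradient.

Theorem lemma3p6 (R : realType) (rho sigma : R)
    (n : nat) (P : 'I_n -> R * R) (K : set (R * R))
    (N : nat) (T : 'I_N -> 'I_3 -> R * R) (k : nat) :
  0 < rho -> 0 < sigma ->
  mesh_polygon rho P K -> triangulation sigma P K T -> (1 <= k)%N ->
  forall v Iv : R * R -> R, Vnc P K k v -> is_interp P K T k v Iv ->
  forall w : R * R -> R, Vnc P K k w ->
    dotL2v K (wgrad K Iv) (wgrad K w) = dotL2v K (wgrad K v) (wgrad K w).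
Proof.
move=> rho0 sigma0 KP KT k1 v Iv Vv Ii w Vw.
exact: (interp_wgrad rho0 sigma0 KP KT k1 Vv Ii Vw).
Qed.
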